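(* Let the action of a semitopological semigroup $G$ on $K$ be uniquely ergodic with invariant probability measure $\mu$, let $N\in\mathbb N$ and let $\mathcal S$ and $\mathcal S_2$ be the corresponding Koopman representations on $C(K,\mathbb C^N)$ and $L^2(K,\mathbb C^N,\mu)$, respectively. Let $\gamma:G\times K\to U(N)$ be a continuous cocycle. Consider either of the following two settings: (a) $G$ is right amenable, and ''net'' below means strong right $\gamma\mathcal S$-ergodic net; (b) $G$ is amenable, and ''net'' below means strong $\gamma\mathcal S$-ergodic net. In each of the two settings the following assertions are equivalent. (1) $\operatorname{Fix}\gamma\mathcal S_2\subseteq\operatorname{Fix}\gamma\mathcal S$ (i.e. every element of $\operatorname{Fix}\gamma\mathcal S_2$ has a representative in $\operatorname{Fix}\gamma\mathcal S$). (2) $\gamma\mathcal S$ is mean ergodic on $C(K,\mathbb C^N)$ with mean ergodic projection $P_\gamma$. (3) $\operatorname{Fix}\gamma\mathcal S$ separates $\operatorname{Fix}(\gamma\mathcal S)'$. (4) $C(K,\mathbb C^N)=\operatorname{Fix}\gamma\mathcal S\oplus\overline{\operatorname{lin}}\operatorname{rg}(I-\gamma\mathcal S)$. (5) $A_\alpha f$ converges weakly (equivalently, converges weakly to a fixed point of $\gamma\mathcal S$) for all $f\in C(K,\mathbb C^N)$, for some (equivalently, for every) net $(A_\alpha)$. (6) $A_\alpha f$ converges in norm (equivalently, converges in norm to a fixed point of $\gamma\mathcal S$) for all $f\in C(K,\mathbb C^N)$, for some (equivalently, for every) net $(A_\alpha)$. The limit $P_\gamma$ of the nets $(A_\alpha)$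 in the strong (respectively weak) operator topology is the mean ergodic projection of $\gamma\mathcal S$, mapping $C(K,\mathbb C^N)$ onto $\operatorname{Fix}\gamma\mathcal S$ along $\overline{\operatorname{lin}}\operatorname{rg}(I-\gamma\mathcal S)$.
   Context: $K$ is a compact (Hausdorff) space; $C(K,\mathbb C^N)$ is the space of continuous $\mathbb C^N$-valued functions with norm $\|f\|=\sup_{x\in K}\|f(x)\|_2$ ($\|\cdot\|_2$ Euclidean). $\mathscr L(X)$ (bounded operators) carries the strong operator topology, in which closures are taken. $U(N)$ is the group of unitary operators on $\mathbb C^N$. A semitopological semigroup is a semigroup with a topology making multiplication separately continuous. A mean on $C_b(G)$ (bounded continuous functions on $G$) is $m\in C_b(G)'$ with $\langle m,\mathbf 1\rangle=\|m\|=1$. For $g\in G$ and $f\in C_b(G)$ put $R_gf(h)=f(hg)$ and $L_gf(h)=f(gh)$, $h\in G$. $G$ is called right amenable if there is a mean $m$ with $\langle m,R_gf\rangle=\langle m,f\rangle$ for all $g\in G$, $f\in C_b(G)$. $G$ is called amenable if there is a mean $m$ with $\langle m,R_gf\rangle=\langle m,L_gf\rangle=\langle m,f\rangle$ for all $g\in G$, $f\in C_b(G)$. A (semigroup) action of $G$ on $K$ is a continuous map $G\times K\to K$, $(g,x)\mapsto gx$, with $(g_1g_2)x=g_1(g_2x)$. It is uniquely ergodic if there is a unique $G$-invariant probability measure $\mu$ on $K$, where $G$-invariant means $\mu(A)=\mu(\{x:gx\in A\})$ for all Borel $A$ and $g\in G$. The Koopman representation $\mathcal S=\{S_g:g\in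 G\}$ on $C(K,\mathbb C^N)$ is $S_gf(x)=f(gx)$; $\mathcal S_2=\{S_{g,2}\}$ is its extension to $L^2(K,\mathbb C^N,\mu)$. A continuous cocycle into a topological group $\Omega$ is a continuous map $\gamma:G\times K\to\Omega$ with $\gamma(g_1g_2,x)=\gamma(g_2,x)\gamma(g_1,g_2x)$. For $\gamma$ with values in $U(N)$, $\gamma\mathcal S=\{\gamma(g,\cdot)S_g:g\in G\}$ with $\gamma(g,\cdot)S_gf(x)=\gamma(g,x)f(gx)$, and $\gamma\mathcal S_2$ is the analogous semigroup on $L^2(K,\mathbb C^N,\mu)$. For a semigroup $\mathcal V=\{V_g:g\in G\}$ of operators on a Banach space $X$ write $\operatorname{Fix}\mathcal V=\{f:V_gf=f\ \forall g\}$, $\operatorname{Fix}\mathcal V'=\{\nu\in X':V_g'\nu=\nu\ \forall g\}$, and $\overline{\operatorname{lin}}\operatorname{rg}(I-\mathcal V)$ for the closed linear span of $\{f-V_gf:f\in X,g\in G\}$. $\mathcal V$ is mean ergodic if $\overline{\operatorname{co}}\,\mathcal V$ contains a zero element $P$ ($PT=TP=P$ for all $T\in\overline{\operatorname{co}}\,\mathcal V$); $P$ is the mean ergodic projection. A strong right $\mathcal V$-ergodic net is a net $(A_\alpha)$ in $\overline{\operatorname{co}}\,\mathcal V$ with $\lim_\alpha(A_\alpha f-A_\alpha V_gf)=0$ for all $f,g$; it is a strong $\mathcal V$-ergodic net if moreover $\lim_\alpha(A_\alpha f-V_gA_\alpha f)=0$ for all $f,g$. A set $E\subseteq X$ separates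 $F\subseteq X'$ if distinct elements of $F$ differ at some element of $E$.
   Formalization: In (a), ''G is right amenable'' is replaced by ''the opposite of G is right amenable, or G is right amenable and a strong right γS-ergodic net exists'', and ''for some net'' requires convergence to a fixed point of γS; as printed, (a) has counterexamples. *)

(* Defs.v *)
From HB Require Import structures.
From mathcomp Require Import all_boot all_order all_algebra.
From mathcomp Require Import all_classical all_reals all_analysis.
From mathcomp Require Import complex ring lra.

Set Implicit Arguments.
Unset Strict Implicit.
Unset Printing Implicit Defensive.

Import Order.TTheory GRing.Theory Num.Theory numFieldNormedType.Exports.

Local Open Scope classical_set_scope.
Local Open Scope complex_scope.
Local Open Scope ring_scope.

#[warnings="-redundant-canonical-projection"]
HB.instance Definition _ (R : rcfType) := NormedModule.copy R[i] R[i]^o.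

Definition Renorm (R : realType) (E : normedModType R[i]) (v : E) : R :=
  complex.Re `|v|.

Section Renorm.
Variables (R : realType) (E : normedModType R[i]).
Implicit Types v w : E.

Lemma RenormK v : (Renorm v)%:C = `|v|.
Proof. by rewrite /Renorm RRe_real // normr_real. Qed.

Lemma Renorm_ge0 v : 0 <= Renorm v.
Proof. by rewrite -lecR RenormK; exact: normr_ge0. Qed.

Lemma RenormD v w : Renorm (v + w) <= Renorm v + Renorm w.
Proof. by rewrite -lecR rmorphD /= !RenormK ler_normD. Qed.

Lemma RenormZ (z : R[i]) v : Renorm (z *: v) = Renorm z * Renorm v.
Proof. by rewrite {1}/Renorm normrZ -!RenormK -rmorphM. Qed.

Lemma Renorm_eq0 v : Renorm v = 0 -> v = 0.
Proof. by move=> v0; apply/normr0_eq0; rewrite -RenormK v0. Qed.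

Lemma Renorm0 : Renorm (0 : E) = 0.
Proof. by rewrite /Renorm normr0. Qed.
End Renorm.

Section EuclideanNorm.
Variables (R : realType) (N : nat).
Implicit Types v w : 'cV[R[i]]_N.

Definition l2norm v : R := Num.sqrt (\sum_i Renorm (v i 0) ^+ 2).

Lemma cauchy_schwarz (a b : 'I_N -> R) :
  (\sum_i a i * b i) ^+ 2 <= (\sum_i a i ^+ 2) * (\sum_i b i ^+ 2).
Proof.
have : 0 <= \sum_i \sum_j (a i * b j - a j * b i) ^+ 2.
  by apply: sumr_ge0 => i _; apply: sumr_ge0 => j _; exact: sqr_ge0.
have -> : \sum_i \sum_j (a i * b j - a j * b i) ^+ 2 =
    ((\sum_i a i ^+ 2) * (\sum_i b i ^+ 2) - (\sum_i a i * b i) ^+ 2) *+ 2.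
  have E1 : (\sum_i a i ^+ 2) * (\sum_i b i ^+ 2) =
      \sum_i \sum_j a i ^+ 2 * b j ^+ 2.
    by rewrite mulr_suml; apply: eq_bigr => i _; rewrite mulr_sumr.
  have E2 : \sum_i \sum_j a i ^+ 2 * b j ^+ 2 =
      \sum_i \sum_j a j ^+ 2 * b i ^+ 2 by rewrite exchange_big.
  have E3 : (\sum_i a i * b i) ^+ 2 = \sum_i \sum_j (a i * b i) * (a j * b j).
    by rewrite expr2 mulr_suml; apply: eq_bigr => i _; rewrite mulr_sumr.
  rewrite mulr2n E1 {2}E2 E3 -!sumrB -big_split /=.
  apply: eq_bigr => i _; rewrite -!sumrB -big_split /=.
  by apply: eq_bigr => j _; ring.
by rewrite pmulrn_lge0 // subr_ge0.
Qed.

Lemma l2norm_ge0 v : 0 <= l2norm v. Proof. exact: sqrtr_ge0. Qed.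

Lemma l2norm_sqr v : l2norm v ^+ 2 = \sum_i Renorm (v i 0) ^+ 2.
Proof. by rewrite sqr_sqrtr // sumr_ge0 // => i _; rewrite sqr_ge0. Qed.

Lemma l2normD v w : l2norm (v + w) <= l2norm v + l2norm w.
Proof.
rewrite -(@ler_pXn2r _ 2%N) // ?nnegrE ?addr_ge0 ?l2norm_ge0 //.
rewrite sqrrD !l2norm_sqr.
have CS : \sum_i Renorm (v i 0) * Renorm (w i 0) <= l2norm v * l2norm w.
  rewrite -(@ler_pXn2r _ 2%N) // ?nnegrE ?mulr_ge0 ?l2norm_ge0 //.
    by rewrite exprMn !l2norm_sqr cauchy_schwarz.
  by apply: sumr_ge0 => i _; rewrite mulr_ge0 ?Renorm_ge0.
apply: (@le_trans _ _ (\sum_i Renorm (v i 0) ^+ 2 +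
    (\sum_i Renorm (v i 0) * Renorm (w i 0)) *+ 2 +
    \sum_i Renorm (w i 0) ^+ 2)); last by lra.
rewrite -sumrMnl -!big_split /=; apply: ler_sum => i _.
rewrite mxE -sqrrD ler_pXn2r // ?nnegrE ?addr_ge0 ?Renorm_ge0 //.
exact: RenormD.
Qed.

Lemma l2normZ (z : R[i]) v : l2norm (z *: v) = Renorm z * l2norm v.
Proof.
have z0 : 0 <= Renorm z := Renorm_ge0 z.
rewrite /l2norm -[X in _ = X * _](ger0_norm z0) -sqrtr_sqr -sqrtrM ?sqr_ge0 //.
congr Num.sqrt; rewrite mulr_sumr; apply: eq_bigr => i _.
by rewrite mxE RenormZ exprMn.
Qed.

Lemma l2norm_eq0 v : l2norm v = 0 -> v = 0.
Proof.
move=> v0; have : \sum_i Renorm (v i 0) ^+ 2 = 0.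
  by rewrite -l2norm_sqr v0 expr0n.
move/psumr_eq0P => h; apply/matrixP => i j; rewrite ord1 mxE.
apply/Renorm_eq0/eqP; rewrite -sqrf_eq0 h // => k _.
exact: sqr_ge0.
Qed.

Lemma coord_le_l2norm v i : Renorm (v i 0) <= l2norm v.
Proof.
rewrite -(@ler_pXn2r _ 2%N) // ?nnegrE ?Renorm_ge0 ?l2norm_ge0 //.
rewrite l2norm_sqr (bigD1 i) //= lerDl sumr_ge0 // => j _; exact: sqr_ge0.
Qed.

Lemma l2norm_le_sum v : l2norm v <= \sum_i Renorm (v i 0).
Proof.
have h0 : 0 <= \sum_i Renorm (v i 0).
  by apply: sumr_ge0 => i _; exact: Renorm_ge0.
rewrite -(@ler_pXn2r _ 2%N) // ?nnegrE ?l2norm_ge0 //.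
rewrite l2norm_sqr expr2 mulr_suml.
apply: ler_sum => i _; rewrite expr2 ler_wpM2l ?Renorm_ge0 //.
rewrite (bigD1 i) //= lerDl sumr_ge0 // => j _; exact: Renorm_ge0.
Qed.

Lemma l2norm_sqrC v : ((l2norm v) ^+ 2)%:C = ((map_mx Num.conj v^T) *m v) 0 0.
Proof.
rewrite l2norm_sqr rmorph_sum mxE; apply: eq_bigr => i _.
by rewrite rmorphXn /= RenormK !mxE mulrC -normCK.
Qed.

Lemma l2norm_unitary (U : 'M[R[i]]_N) v :
  U \is unitarymx -> l2norm (U *m v) = l2norm v.
Proof.
move=> Uu; apply/eqP; rewrite -(@eqrXn2 _ 2%N) ?l2norm_ge0 //.
rewrite -(inj_eq (@complexI R)) !l2norm_sqrC trmx_mul map_mxM /=.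
rewrite mulmxA -[X in X *m v]mulmxA.
have := Uu; rewrite -trmxC_unitary => /unitarymxP.
by rewrite map_trmx trmxK map_mxCK => ->; rewrite mulmx1.
Qed.

End EuclideanNorm.

(* C^N with the Euclidean norm; the norm that 'cV[R[i]]_N carries by default
   is the maximum norm. *)
Definition euclidean (R : realType) (N : nat) : Type := 'cV[R[i]]_N.

Section EuclideanNormedModule.
Variables (R : realType) (N : nat).

HB.instance Definition _ := GRing.Lmodule.on (euclidean R N).

Let norm (v : euclidean R N) : R[i] := (l2norm v)%:C.

Let normD v w : norm (v + w) <= norm v + norm w.
Proof. by rewrite /norm -rmorphD lecR l2normD. Qed.

Let normZ (z : R[i]) v : norm (z *: v) = `|z| * norm v.
Proof. by rewrite /norm -[`|z|]RenormK -rmorphM -l2normZ. Qed.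

Let norm_eq0 v : norm v = 0 -> v = 0.
Proof. by move=> v0; apply/l2norm_eq0/(@complexI R). Qed.

HB.instance Definition _ :=
  Lmodule_isNormed.Build R[i] (euclidean R N) normD normZ norm_eq0.

Lemma euclidean_normE (v : euclidean R N) : `|v| = (l2norm v)%:C.
Proof. by []. Qed.
End EuclideanNormedModule.

Lemma cvg_bigsum (R : numFieldType) (T : topologicalType) (V : normedModType R)
    (x : T) n (F : 'I_n -> T -> V) (l : 'I_n -> V) :
  (forall i, F i y @[y --> x] --> l i) ->
  \sum_(i < n) F i y @[y --> x] --> \sum_(i < n) l i.
Proof.
elim: n F l => [|n IHn] F l Fl.
  rewrite big_ord0 (_ : (fun y => _) = fun=> 0); first exact: cvg_cst.
  by apply/funext => y; rewrite big_ord0.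
rewrite big_ord_recl (_ : (fun y => _) =
    fun y => F ord0 y + \sum_(i < n) F (lift ord0 i) y); last first.
  by apply/funext => y; rewrite big_ord_recl.
by apply: cvgD; [exact: Fl|apply: IHn => i; exact: Fl].
Qed.

Section EuclideanContinuity.
Variables (R : realType) (N : nat).

Lemma euclidean_coord_continuous (i : 'I_N) :
  continuous (fun v : euclidean R N => (v : 'cV[R[i]]_N) i 0).
Proof.
move=> v; apply/(@cvgrPdist_lt _ _ _ (nbhs v)) => e e0.
have : \forall w \near v, `|v - w| < e.
  by apply/nbhs_normP; exists e.
apply: filterS => w; apply: le_lt_trans; rewrite euclidean_normE -RenormK lecR.
have := coord_le_l2norm (v - w : 'cV[R[i]]_N) i.
by rewrite !mxE.
Qed.

Lemma euclidean_continuous (T : topologicalType) (f : T -> euclidean R N) :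
  (forall i, continuous (fun x => (f x : 'cV[R[i]]_N) i 0)) -> continuous f.
Proof.
move=> fc x; apply/cvgrPdist_le => e e0.
have S0 : (fun y => \sum_i `|(f x : 'cV[R[i]]_N) i 0 - (f y : 'cV[R[i]]_N) i 0|)
    @ x --> \sum_(i < N) `|(f x : 'cV[R[i]]_N) i 0 - (f x : 'cV[R[i]]_N) i 0|.
  apply: cvg_bigsum => i; apply: cvg_norm.
  by apply: cvgB; [exact: cvg_cst|exact: fc].
rewrite big1 in S0; last by move=> i _; rewrite subrr normr0.
move/cvgrPdist_le : S0 => /(_ e e0); apply: filterS => y.
rewrite sub0r normrN; apply: le_trans; rewrite euclidean_normE.
rewrite ger0_norm; last by apply: sumr_ge0.
rewrite (eq_bigr (fun i => (Renorm ((f x - f y : 'cV[R[i]]_N) i 0))%:C)).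
  by rewrite -rmorph_sum lecR l2norm_le_sum.
by move=> i _; rewrite RenormK !mxE.
Qed.
End EuclideanContinuity.

Section BoundedContinuous.
Variables (R : realType) (T : topologicalType) (E : normedModType R[i]).

Definition bounded_continuous : {pred T -> E} :=
  fun f => `[< continuous f /\ bounded_fun f >].

Record bcfun := BCFun {
  bcfun_val :> T -> E;
  bcfunP : bcfun_val \in bounded_continuous }.

HB.instance Definition _ := [isSub for bcfun_val].
HB.instance Definition _ := [Choice of bcfun by <:].

Lemma bounded_funE (f : T -> E) :
  bounded_fun f <-> exists M : R, forall x, Renorm (f x) <= M.
Proof.
split=> [[M [_ /(_ (M + 1))]]|[M Mf]].
  rewrite ltrDl ltr01 => /(_ isT) Mf; exists (complex.Re (M + 1)) => x.
  by have := Mf x I; rewrite /= -RenormK lecE => /andP[].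
exists M%:C; split; first by rewrite complex_real.
by move=> L /ltW ML x _ /=; apply: le_trans ML; rewrite -RenormK lecR.
Qed.

Lemma bounded_continuous_submod : submod_closed bounded_continuous.
Proof.
split=> [|z f g].
  apply/asboolP; split; first exact: cst_continuous.
  by apply/bounded_funE; exists 0 => x; rewrite Renorm0.
move=> /asboolP[cf /bounded_funE[M Mf]] /asboolP[cg /bounded_funE[L Lg]].
apply/asboolP; split.
  move=> x; apply: continuousD; last exact: cg.
  by apply: continuousZ; [exact: cst_continuous|exact: cf].
apply/bounded_funE; exists (Renorm z * M + L) => x.
rewrite (le_trans (RenormD _ _)) // lerD // RenormZ.
by rewrite ler_wpM2l // Renorm_ge0.
Qed.

HB.instance Definition _ := GRing.isSubmodClosed.Build R[i] (T -> E)
  bounded_continuous bounded_continuous_submod.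
HB.instance Definition _ := [SubChoice_isSubLmodule of bcfun by <:].

Implicit Types f g : bcfun.

Lemma bcfun_cont f : continuous f. Proof. by have /asboolP[] := bcfunP f. Qed.

Lemma bcfun_bounded f : bounded_fun f.
Proof. by have /asboolP[] := bcfunP f. Qed.

Definition supnorm f : R := sup [set Renorm (f x) | x in [set: T]].

Let normset_ub f : has_ubound [set Renorm (f x) | x in [set: T]].
Proof.
have /bounded_funE[M Mf] := bcfun_bounded f.
by exists M => _ [x _ <-]; exact: Mf.
Qed.

Lemma supnorm_ub f x : Renorm (f x) <= supnorm f.
Proof. by apply: ub_le_sup => //; exists x. Qed.

Lemma supnorm_ge0 f : 0 <= supnorm f.
Proof.
have [/set0P[_ [x _ _]]|/negP/negPn/eqP s0] :=
    EM ([set Renorm (f x) | x in [set: T]] != set0).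
  exact: le_trans (Renorm_ge0 (f x)) (supnorm_ub f x).
by rewrite /supnorm s0 sup0.
Qed.

Lemma supnorm_le f (M : R) :
  0 <= M -> (forall x, Renorm (f x) <= M) -> supnorm f <= M.
Proof.
move=> M0 fM; rewrite /supnorm.
have [s0|/negP/negPn/eqP ->] :=
    EM ([set Renorm (f x) | x in [set: T]] != set0); last by rewrite sup0.
by apply: ge_sup; [exact/set0P|move=> _ [x _ <-]].
Qed.

Let norm f : R[i] := (supnorm f)%:C.

Let normD f g : norm (f + g) <= norm f + norm g.
Proof.
rewrite /norm -rmorphD lecR; apply: supnorm_le => [|x].
  by rewrite addr_ge0 // supnorm_ge0.
by rewrite (le_trans (RenormD _ _)) // lerD // supnorm_ub.
Qed.

Let normZ (z : R[i]) f : norm (z *: f) = `|z| * norm f.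
Proof.
rewrite /norm -[`|z|]RenormK -rmorphM; congr (_%:C); apply/eqP.
have le (y : R[i]) g : supnorm (y *: g) <= Renorm y * supnorm g.
  apply: supnorm_le => [|x]; first by rewrite mulr_ge0 ?Renorm_ge0 ?supnorm_ge0.
  by rewrite RenormZ ler_wpM2l ?Renorm_ge0 // supnorm_ub.
rewrite eq_le le /=; have [->|z0] := eqVneq z 0.
  by rewrite Renorm0 mul0r supnorm_ge0.
have := le z^-1 (z *: f); rewrite scalerA mulVf // scale1r => h.
have := ler_wpM2l (Renorm_ge0 z) h; rewrite mulrA.
suff -> : Renorm z * Renorm z^-1 = 1 by rewrite mul1r.
by rewrite -RenormZ [_ *: _]mulfV // /Renorm normr1.
Qed.

Let norm_eq0 f : norm f = 0 -> f = 0.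
Proof.
move=> /(@complexI R) f0; apply/val_inj/funext => x.
apply/Renorm_eq0/eqP; rewrite eq_le Renorm_ge0 andbT -f0.
exact: supnorm_ub.
Qed.

HB.instance Definition _ :=
  Lmodule_isNormed.Build R[i] bcfun normD normZ norm_eq0.

Lemma bcfun_normE f : `|f| = (supnorm f)%:C.
Proof. by []. Qed.
End BoundedContinuous.

HB.mixin Record isSemitopologicalSemigroup G of Topological G & Semigroup G := {
  mulg_contl : forall g : G, continuous (fun h : G => (g * h)%g);
  mulg_contr : forall g : G, continuous (fun h : G => (h * g)%g) }.

#[short(type="semitopologicalSemigroupType")]
HB.structure Definition SemitopologicalSemigroup :=
  {G of Topological G & Semigroup G & isSemitopologicalSemigroup G}.

Definition opposite (G : Type) : Type := G.

Section Opposite.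
Variable G : semitopologicalSemigroupType.

HB.instance Definition _ := Topological.copy (opposite G) G.

Let opp_mulgA : associative (fun g h : opposite G => (h * g)%g : G).
Proof. by move=> g h k; rewrite mulgA. Qed.

HB.instance Definition _ := isSemigroup.Build (opposite G) opp_mulgA.

Let opp_contl (g : opposite G) : continuous (fun h : opposite G => (g * h)%g).
Proof. exact: (@mulg_contr G). Qed.

Let opp_contr (g : opposite G) : continuous (fun h : opposite G => (h * g)%g).
Proof. exact: (@mulg_contl G). Qed.

HB.instance Definition _ :=
  isSemitopologicalSemigroup.Build (opposite G) opp_contl opp_contr.
End Opposite.

Section Precomposition.
Variables (R : realType) (S T : topologicalType) (E : normedModType R[i]).

Lemma bccomp_subproof (phi : S -> T) (phi_cont : continuous phi)
  (f : bcfun T E) : f \o phi \in @bounded_continuous R S E.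
Proof.
apply/asboolP; split.
  by move=> x; apply: continuous_comp; [exact: phi_cont|exact: bcfun_cont].
have /bounded_funE[M Mf] := bcfun_bounded f.
by apply/bounded_funE; exists M => x; exact: Mf.
Qed.

Definition bccomp (phi : S -> T) (phi_cont : continuous phi)
  (f : bcfun T E) : bcfun S E := BCFun (bccomp_subproof phi_cont f).
End Precomposition.

Section Amenability.
Variables (R : realType) (G : semitopologicalSemigroupType).
Notation CbG := (bcfun G R[i]).
Implicit Types (g h : G) (f : CbG).

Lemma one_subproof : (fun=> 1) \in @bounded_continuous R G R[i].
Proof.
apply/asboolP; split; first exact: cst_continuous.
by apply/bounded_funE; exists (Renorm (1 : R[i])).
Qed.

Definition bcone : CbG := BCFun one_subproof.

Definition rtrans g f : CbG := bccomp (mulg_contr g) f.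
Definition ltrans g f : CbG := bccomp (mulg_contl g) f.
End Amenability.

Section DualSpace.
Variables (R : realType) (X : normedModType R[i]).

Definition dual : set (X -> R[i]) :=
  [set nu : X -> R[i] | scalar nu /\ continuous nu].

Definition dual_norm (nu : X -> R[i]) : R :=
  sup [set Renorm (nu f) | f in [set f : X | `|f| <= 1]].

Definition bounded_operator : set (X -> X) :=
  [set T : X -> X | linear T /\ continuous T].
End DualSpace.

Section Means.
Variables (R : realType) (G : semitopologicalSemigroupType).
Implicit Types m : bcfun G R[i] -> R[i].

Definition mean m : Prop :=
  [/\ dual m, m (bcone R G) = 1 & dual_norm m = 1].

Definition right_amenable : Prop := exists m, mean m /\
  forall (g : G) f, m (rtrans g f) = m f.

Definition amenable : Prop := exists m, mean m /\
  forall (g : G) f, m (rtrans g f) = m f /\ m (ltrans g f) = m f.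
End Means.

Record directedSet := DirectedSet {
  directed_carrier :> Type;
  directed_le : directed_carrier -> directed_carrier -> Prop;
  directed_refl : forall i, directed_le i i;
  directed_trans : forall i j k,
    directed_le i j -> directed_le j k -> directed_le i k;
  directed_ub : forall i j, exists k, directed_le i k /\ directed_le j k;
  directed_inhabited : inhabited directed_carrier }.

Definition tails (I : directedSet) : set_system I :=
  [set P | exists i0, forall i, directed_le i0 i -> P i].

Arguments tails : clear implicits.

Section Operators.
Variables (R : realType) (X : normedModType R[i]) (G : Type) (V : G -> X -> X).

Definition Fix : set X := [set f | forall g, V g f = f].

Definition Fix_dual : set (X -> R[i]) :=
  [set nu | dual nu /\ forall g, nu \o V g = nu].

Definition lin (A : set X) : set X :=
  [set f | exists (n : nat) (c : 'I_n -> R[i]) (u : 'I_n -> X),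
    (forall i, A (u i)) /\ f = \sum_i c i *: u i].

Definition range_IV : set X := [set f | exists g h, f = h - V g h].

Definition clin_range_IV : set X := closure (lin range_IV).

Definition convex_comb : set (X -> X) :=
  [set T | exists (n : nat) (t : 'I_n -> R) (g : 'I_n -> G),
    [/\ forall i, 0 <= t i, \sum_i t i = 1 &
        T = fun f => \sum_i (t i)%:C *: V (g i) f]].

(* The strong operator topology is the topology of pointwise convergence
   on the space of bounded operators. *)
Definition closed_convex_hull : set (X -> X) :=
  @bounded_operator R X `&` closure (convex_comb : set {ptws X -> X}).

Definition mean_ergodic_projection (P : X -> X) : Prop :=
  closed_convex_hull P /\
  forall T, closed_convex_hull T -> P \o T = P /\ T \o P = P.

Definition mean_ergodic : Prop := exists P, mean_ergodic_projection P.

Definition right_ergodic_net (I : directedSet) (A : I -> X -> X) : Prop :=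
  (forall i, closed_convex_hull (A i)) /\
  forall f g, (fun i => A i f - A i (V g f)) @ tails I --> (0 : X).

Definition ergodic_net (I : directedSet) (A : I -> X -> X) : Prop :=
  right_ergodic_net A /\
  forall f g, (fun i => A i f - V g (A i f)) @ tails I --> (0 : X).

Definition separates (E : set X) (F : set (X -> R[i])) : Prop :=
  forall nu1 nu2, F nu1 -> F nu2 -> nu1 <> nu2 ->
    exists2 f, E f & nu1 f <> nu2 f.

Definition direct_sum_decomposition (E F : set X) : Prop :=
  (forall f, exists u v, [/\ E u, F v & f = u + v]) /\ E `&` F = [set 0].

Definition projection_along (P : X -> X) (E F : set X) : Prop :=
  [/\ bounded_operator P, P \o P = P, range P = E & P @^-1` [set 0] = F].

Definition norm_limit (I : directedSet) (u : I -> X) (l : X) : Prop :=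
  u @ tails I --> l.

Definition weak_limit (I : directedSet) (u : I -> X) (l : X) : Prop :=
  forall nu, dual nu -> (fun i => nu (u i)) @ tails I --> nu l.

Definition norm_convergent (I : directedSet) (A : I -> X -> X) : Prop :=
  forall f, exists l, norm_limit (A^~ f) l.

Definition norm_convergent_to_fixed (I : directedSet) (A : I -> X -> X) :=
  forall f, exists2 l, Fix l & norm_limit (A^~ f) l.

Definition weakly_convergent (I : directedSet) (A : I -> X -> X) : Prop :=
  forall f, exists l, weak_limit (A^~ f) l.

Definition weakly_convergent_to_fixed (I : directedSet) (A : I -> X -> X) :=
  forall f, exists2 l, Fix l & weak_limit (A^~ f) l.
End Operators.

Section NetQuantifiers.
Variable X : Type.
Implicit Types Net Q : forall I : directedSet, (I -> X -> X) -> Prop.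

Definition some_net Net Q : Prop := exists I A, Net I A /\ Q I A.

Definition every_net Net Q : Prop := forall I A, Net I A -> Q I A.
End NetQuantifiers.

Section Action.
Variables (G : semitopologicalSemigroupType) (K : topologicalType).

Record semigroup_action := SemigroupAction {
  act :> G -> K -> K;
  act_cont : continuous (fun p : G * K => act p.1 p.2);
  actM : forall g h x, act (g * h)%g x = act g (act h x) }.

Lemma act_contr (a : semigroup_action) (g : G) : continuous (a g).
Proof.
move=> x; apply: (@continuous_comp _ _ _ (fun x => (g, x))
  (fun p : G * K => a p.1 p.2)); last exact: act_cont.
by apply: cvg_pair; [exact: cvg_cst|exact: cvg_id].
Qed.
End Action.

Definition borel (K : ptopologicalType) := g_sigma_algebraType (@open K).

Section Measures.
Variables (R : realType) (G : semitopologicalSemigroupType).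
Variables (K : ptopologicalType).
Implicit Types mu nu : probability (borel K) R.

(* Probability measures on a compact space are meant to be regular: these are
   the ones that represent the states of C(K). *)
Definition regular_measure mu : Prop :=
  forall A : set (borel K), measurable A ->
    mu A = ereal_inf (mu @` [set U | @open K U /\ A `<=` U]) /\
    mu A = ereal_sup (mu @` [set C | @compact K C /\ C `<=` A]).

Definition invariant_measure (a : semigroup_action G K) mu : Prop :=
  forall (A : set (borel K)) (g : G), measurable A -> mu A = mu (a g @^-1` A).

Definition uniquely_ergodic (a : semigroup_action G K) mu : Prop :=
  [/\ regular_measure mu, invariant_measure a mu &
      forall nu, regular_measure nu -> invariant_measure a nu ->
        forall A : set (borel K), measurable A -> nu A = mu A].

(* A measurable function with square integrable norm, i.e. a representative
   of an element of L^2(K, C^N, mu). *)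
Definition L2 N mu (f : K -> euclidean R N) : Prop :=
  [/\ forall i, measurable_fun [set: borel K] (fun x => complex.Re (f x i 0)),
      forall i, measurable_fun [set: borel K] (fun x => complex.Im (f x i 0)) &
      (\int[mu]_x (Renorm (f x) ^+ 2)%:E < +oo)%E].
End Measures.

Section CocycleKoopman.
Variables (R : realType) (N : nat) (G : semitopologicalSemigroupType).
Variables (K : topologicalType) (a : semigroup_action G K).

Record cocycle := Cocycle {
  cocycle_val :> G -> K -> 'M[R[i]]_N;
  cocycle_unitary : forall g x, cocycle_val g x \is unitarymx;
  cocycle_cont : continuous (fun p : G * K => cocycle_val p.1 p.2);
  cocycleM : forall g h x,
    cocycle_val (g * h)%g x = cocycle_val h x *m cocycle_val g (a h x) }.

Definition koopman (g : G) :
    bcfun K (euclidean R N) -> bcfun K (euclidean R N) :=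
  bccomp (@act_contr _ _ a g).

Variable c : cocycle.

Lemma cocycle_mul_subproof (g : G) (f : bcfun K (euclidean R N)) :
  (fun x => c g x *m f x : euclidean R N)
    \in @bounded_continuous R K (euclidean R N).
Proof.
apply/asboolP; split; last first.
  have /bounded_funE[M Mf] := bcfun_bounded f.
  apply/bounded_funE; exists M => x.
  rewrite /Renorm euclidean_normE l2norm_unitary ?cocycle_unitary //.
  exact: Mf.
apply: euclidean_continuous => i x.
have -> : (fun y => (c g y *m f y) i 0) =
    (fun y => \sum_(j < N) c g y i j * f y j 0).
  by apply/funext => y; rewrite mxE.
apply: cvg_bigsum => j.
apply: cvgM.
  apply: (@continuous_comp _ _ _ (c g) (fun U : 'M[R[i]]_N => U i j)).
    apply: (@continuous_comp _ _ _ (fun y => (g, y))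
      (fun p : G * K => c p.1 p.2)); last exact: cocycle_cont.
    by apply: cvg_pair; [exact: cvg_cst|exact: cvg_id].
  exact: coord_continuous.
apply: (@continuous_comp _ _ _ f
  (fun v : euclidean R N => (v : 'cV[R[i]]_N) j 0)).
  exact: bcfun_cont.
exact: euclidean_coord_continuous.
Qed.

Definition cocycle_mul (g : G) (f : bcfun K (euclidean R N)) :
  bcfun K (euclidean R N) := BCFun (cocycle_mul_subproof g f).

Definition cocycle_koopman (g : G) (f : bcfun K (euclidean R N)) :
  bcfun K (euclidean R N) := cocycle_mul g (koopman g f).

(* g |-> cocycle_koopman g reverses products: it is a representation of the
   opposite semigroup of G. *)
Lemma cocycle_koopmanM (g h : G) :
  cocycle_koopman (g * h)%g = cocycle_koopman h \o cocycle_koopman g.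
Proof.
apply/funext => f; apply/val_inj/funext => x /=.
by rewrite cocycleM actM mulmxA.
Qed.

(* The formula on representatives for the extension to L^2(K, C^N, mu). *)
Definition cocycle_koopman2 (g : G) (f : K -> euclidean R N) :
  K -> euclidean R N := fun x => c g x *m f (a g x).
End CocycleKoopman.

Definition Fix2 (R : realType) (N : nat) (G : semitopologicalSemigroupType)
    (K : ptopologicalType) (a : semigroup_action G K)
    (mu : probability (borel K) R)
    (c : cocycle R N a) : set (K -> euclidean R N) :=
  [set f | L2 mu f /\
    forall g, {ae mu, forall x, cocycle_koopman2 c g f x = f x}].

(* Main.v *)
Require Import Defs.
From HB Require Import structures.
From mathcomp Require Import all_boot all_order all_algebra.
From mathcomp Require Import all_classical all_reals all_analysis.
From mathcomp Require Import complex.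
From mathcomp Require Import measurable_realfun finmap ring lra.

Set Implicit Arguments.
Unset Strict Implicit.
Unset Printing Implicit Defensive.

Import Order.TTheory GRing.Theory Num.Theory numFieldNormedType.Exports.

Local Open Scope classical_set_scope.
Local Open Scope complex_scope.
Local Open Scope ring_scope.

(** A functional [nu] in the dual that is fixed by the semigroup [V] of the
    cocycle has a total variation [|nu|], which is a positive functional on the
    continuous functions. Since the cocycle is unitary, [V g] maps the functions
    dominated by [phi] to functions dominated by [phi \o a g], so [|nu|] is
    invariant under the action; by the Riesz-Markov theorem ([riesz_markov]) and
    unique ergodicity it is a multiple of [mu]
    ([invariant_functional_integral]). Hence [nu] is bounded in mean: [|nu f|]
    is at most [B] times the integral of the pointwise norm of [f]
    ([fixed_functional_L1_bound]). Both links between the space of continuous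
    functions and the square-integrable functions rest on this bound.

    From the square-integrable functions to the continuous ones: [nu] has a
    bounded density [h] by Radon-Nikodym, and [h] is fixed by the extended
    semigroup because the latter consists of isometries ([fixed_density]). If
    [h] has a continuous fixed representative [u], then the real part of [nu u]
    is the square norm of [h], so [nu u] vanishes only if [nu] does: the fixed
    functions separate the fixed functionals ([fix_separates_of_Fix2]).

    From the continuous functions to the square-integrable ones: if [P] is the
    mean ergodic projection, then the coordinates of [P f] at the points of the
    space are fixed functionals of [f], hence bounded in mean uniformly in the
    point. So [P] maps continuous functions that approximate a fixed
    square-integrable [f] in mean to a uniform Cauchy sequence of continuous
    fixed functions, and its limit represents [f]
    ([Fix2_sub_of_mean_ergodic]).

    The remaining equivalences hold for every contractive semigroup with an
    ergodic net. Separation makes [Fix V] plus the range of [I - V] dense by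
    Hahn-Banach; a right ergodic net fixes the first summand, tends to zero on
    the second and is contractive, so the sum is closed and direct
    ([decomposition_of_separates]), and the limit of all such nets is the
    projection ([ergodic_projection]). Conversely a net with fixed weak limits
    forces separation, because fixed functionals are constant along the net. A
    weak limit of a two-sided ergodic net is always fixed; for right ergodic
    nets the limits are fixed as soon as every net converges, since the net
    that alternates between [A i] and [V g \o A i] is right ergodic as well
    ([every_weak_to_fixed]).

    Ergodic nets come from amenability: if the convex combinations over [x] of
    the vectors [V x f - V x (V g f)], for finitely many pairs [(f, g)] at once,
    stayed away from zero, a separating functional would produce a bounded
    function with a positive lower bound on which the invariant mean vanishes
    ([small_convex_combination]). *)


(** * Elementary estimates *)

Section Estimates.
Variable R : realType.
Implicit Types (B c e x y : R).

Lemma small_multiple B e : 0 <= B -> 0 < e -> exists2 d : R, 0 < d & B * d < e.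
Proof.
move=> B0 e0; have B1 : 0 < B + 1 by rewrite ltr_wpDl.
exists (e / (B + 1)); first by rewrite divr_gt0.
by rewrite mulrCA gtr_pMr // ltr_pdivrMr // mul1r ltrDl.
Qed.

Lemma ler_add_multiple c x y : 0 <= c ->
  (forall e, 0 < e -> x <= y + c * e) -> x <= y.
Proof.
move=> c0 h; apply/ler_addgt0Pr => e e0; have [d d0 cd] := small_multiple c0 e0.
by apply: le_trans (h d d0) _; rewrite lerD2l ltW.
Qed.

Lemma harmonic_small e : 0 < e ->
  exists n : nat, forall p : nat, (n <= p)%N -> p.+1%:R^-1 < e.
Proof.
move=> e0; exists (Num.bound e^-1) => p np; rewrite invf_plt ?posrE //.
apply: (lt_le_trans (archi_boundP _)); first by rewrite invr_ge0 ltW.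
by rewrite ler_nat (leq_trans np).
Qed.
End Estimates.

Section ConcatenatedFamilies.
Variables (T : Type) (n m : nat) (f : 'I_n -> T) (g : 'I_m -> T).

Definition family_cat (k : 'I_(n + m)) : T :=
  match fintype.split k with inl i => f i | inr j => g j end.

Lemma family_catl i : family_cat (lshift m i) = f i.
Proof. by have e := @unsplitK n m (inl i); rewrite /= in e; rewrite /family_cat e. Qed.

Lemma family_catr j : family_cat (rshift n j) = g j.
Proof. by have e := @unsplitK n m (inr j); rewrite /= in e; rewrite /family_cat e. Qed.

Lemma family_catP (P : T -> Prop) k :
  (forall i, P (f i)) -> (forall j, P (g j)) -> P (family_cat k).
Proof. by rewrite /family_cat; case: (fintype.split k). Qed.
End ConcatenatedFamilies.


(** * Hahn-Banach separation *)

Section HahnBanach.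
Variables (R : realType) (Y : lmodType R[i]).
Implicit Types (p q l : Y -> R) (x y : Y) (C : set Y).

Definition sublinear p : Prop :=
  (forall x y, p (x + y) <= p x + p y) /\
  (forall (t : R) x, 0 <= t -> p (t%:C *: x) = t * p x).

Definition real_linear l : Prop :=
  (forall x y, l (x + y) = l x + l y) /\
  (forall (t : R) x, l (t%:C *: x) = t * l x).

Lemma real_linear0 l : real_linear l -> l 0 = 0.
Proof. by move=> [_ lZ]; have := lZ 0 0; rewrite scaler0 mul0r. Qed.

Lemma real_linearN l x : real_linear l -> l (- x) = - l x.
Proof. by move=> [_ lZ]; have := lZ (-1) x; rewrite rmorphN1 scaleN1r mulN1r. Qed.

Lemma real_linearB l x y : real_linear l -> l (x - y) = l x - l y.
Proof. by move=> ll; have [lD _] := ll; rewrite lD real_linearN. Qed.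

Lemma sublinear0 p : sublinear p -> p 0 = 0.
Proof. by move=> [_ /(_ 0 0 (lexx _))]; rewrite scaler0 mul0r. Qed.

Lemma sublinear_lower_bound p x : sublinear p -> - p (- x) <= p x.
Proof.
move=> sp; have [pD _] := sp; rewrite lerNl -subr_ge0 opprK.
by rewrite -(sublinear0 sp) -[X in p X <= _](addNr x); exact: pD.
Qed.

(** Applied to [t^-1], the inequality gives its own converse. *)
Lemma positive_homogeneous p : p 0 = 0 ->
  (forall (t : R) x, 0 < t -> p (t%:C *: x) <= t * p x) ->
  forall (t : R) x, 0 <= t -> p (t%:C *: x) = t * p x.
Proof.
move=> p0 h t x; rewrite le_eqVlt => /predU1P[<-|t0].
  by rewrite scale0r p0 mul0r.
apply/eqP; rewrite eq_le h //= -ler_pdivlMl //.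
have := h t^-1 (t%:C *: x); rewrite invr_gt0 scalerA -rmorphM => /(_ t0).
by rewrite mulVf ?gt_eqF // scale1r.
Qed.

Definition tilt p (a x : Y) : R :=
  inf [set p (x + t%:C *: a) - t * p a | t in [set t : R | 0 <= t]].

Section Tilt.
Variables (p : Y -> R) (a : Y).
Hypothesis sp : sublinear p.

Let lb x (t : R) : 0 <= t -> - p (- x) <= p (x + t%:C *: a) - t * p a.
Proof.
have [pD pZ] := sp; move=> t0; rewrite -pZ //.
have := pD (x + t%:C *: a) (- x); rewrite addrAC subrr add0r; lra.
Qed.

Let has_lb x :
  has_lbound [set p (x + t%:C *: a) - t * p a | t in [set t : R | 0 <= t]].
Proof. by exists (- p (- x)) => _ [t t0 <-]; exact: lb. Qed.

Let ne x :
  [set p (x + t%:C *: a) - t * p a | t in [set t : R | 0 <= t]] !=set0.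
Proof. by exists (p (x + 0%:C *: a) - 0 * p a); exists 0 => //=. Qed.

Lemma tilt_le x (t : R) : 0 <= t -> tilt p a x <= p (x + t%:C *: a) - t * p a.
Proof. by move=> t0; apply: ge_inf => //; exists t. Qed.

Lemma tilt_leP x : tilt p a x <= p x.
Proof.
by have := tilt_le x (lexx 0); rewrite scale0r addr0 mul0r subr0.
Qed.

Lemma tilt_sublinear : sublinear (tilt p a).
Proof.
have [pD pZ] := sp; split=> [x y|t x t0].
  rewrite -lerBlDr; apply: lb_le_inf => // _ [s s0 <-].
  rewrite lerBlDr -lerBlDl; apply: lb_le_inf => // _ [t t0 <-].
  rewrite lerBlDl.
  have st0 : 0 <= s + t by rewrite addr_ge0.
  apply: (le_trans (tilt_le (x + y) st0)).
  rewrite rmorphD scalerDl addrACA.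
  have := pD (x + s%:C *: a) (y + t%:C *: a); lra.
apply: positive_homogeneous t x t0 => [|t x tp].
  apply/eqP; rewrite eq_le; apply/andP; split.
    by have := tilt_leP 0; rewrite (sublinear0 sp).
  apply: lb_le_inf => // _ [s s0 <-].
  by rewrite add0r pZ // subrr.
rewrite -ler_pdivrMl //; apply: lb_le_inf => // _ [s s0 <-].
rewrite ler_pdivrMl //.
have ts0 : 0 <= t * s by rewrite mulr_ge0 // ltW.
apply: (le_trans (tilt_le _ ts0)).
by rewrite rmorphM -scalerA -scalerDr pZ ?(ltW tp) // -mulrA -mulrBr.
Qed.
End Tilt.

(** Tilting [p] along [a] produces a sublinear functional below it, hence [p]
    itself, and this is additivity in the direction [a]. *)
Lemma minimal_sublinear_linear p : sublinear p ->
  (forall q, sublinear q -> (forall x, q x <= p x) -> q = p) -> real_linear p.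
Proof.
move=> sp pmin; have [pD pZ] := sp.
have D x y : p (x + y) = p x + p y.
  apply/eqP; rewrite eq_le pD /=.
  have e : tilt p y = p by apply: pmin; [exact: tilt_sublinear|exact: tilt_leP].
  have := tilt_le y sp x ler01; rewrite e scale1r mul1r; lra.
have N x : p (- x) = - p x.
  by apply/eqP; rewrite -addr_eq0 -D addNr sublinear0.
split=> // t x; have [t0|/ltW t0] := leP 0 t; first exact: pZ.
rewrite -[t]opprK mulNr -pZ ?oppr_ge0 // -N; congr p.
by rewrite rmorphN scaleNr.
Qed.

(** Zorn's lemma: the pointwise infimum of a chain of sublinear functionals
    below [p] is sublinear, and finite by [sublinear_lower_bound]. *)
Lemma sublinear_minorant p : sublinear p ->
  exists2 l, real_linear l & forall x, l x <= p x.
Proof.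
move=> sp; pose T := {q : Y -> R | sublinear q /\ forall x, q x <= p x}.
pose r (s t : T) := `[< forall x, sval t x <= sval s x >].
have [||||[q [sq qp]] qmin] := @Zorn T r.
- by move=> t; apply/asboolP.
- move=> s t u /asboolP st /asboolP tu; apply/asboolP => x.
  exact: le_trans (tu x) (st x).
- move=> s t /asboolP st /asboolP ts.
  case: s t st ts => [s Hs] [t Ht] /= st ts; apply: eq_exist; apply/funext => x.
  by apply/eqP; rewrite eq_le st ts.
- move=> A tot; have [->|/set0P[s0 As0]] := eqVneq A set0.
    by exists (exist _ p (conj sp (fun x => lexx (p x)))).
  pose S x := [set sval s x | s in A].
  pose q x := inf (S x).
  have Slb x : has_lbound (S x).
    exists (- p (- x)) => _ [s As <-]; case: s {As} => q' [sq' q'p] /=.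
    by apply: le_trans (sublinear_lower_bound x sq'); rewrite lerN2.
  have Sne x : S x !=set0 by exists (sval s0 x), s0.
  have qle s x : A s -> q x <= sval s x by move=> As; apply: ge_inf => //; exists s.
  have sq : sublinear q.
    split=> [x y|t x t0].
      rewrite -lerBlDr; apply: lb_le_inf => // _ [s As <-].
      rewrite lerBlDr -lerBlDl; apply: lb_le_inf => // _ [t At <-].
      rewrite lerBlDl.
      have [/asboolP st|/asboolP ts] := tot _ _ As At.
        apply: (le_trans (qle t _ At)); have [[tD _] _] := svalP t.
        by apply: (le_trans (tD _ _)); rewrite lerD2r.
      apply: (le_trans (qle s _ As)); have [[sD _] _] := svalP s.
      by apply: (le_trans (sD _ _)); rewrite lerD2l.
    apply: positive_homogeneous t x t0 => [|t x tp].
      rewrite /q (_ : S 0 = [set 0]) ?inf1 //.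
      apply/seteqP; split=> [_ [s As <-]|_ ->] /=.
        by have [[ss _]] := svalP s => _; rewrite sublinear0 //; case: (svalP s).
      by exists s0 => //; rewrite sublinear0 //; case: (svalP s0).
    rewrite -ler_pdivrMl //; apply: lb_le_inf => // _ [s As <-].
    rewrite ler_pdivrMl //; have [[_ sZ] _] := svalP s.
    by rewrite -sZ ?(ltW tp) //; exact: qle.
  have qp x : q x <= p x.
    by apply: (le_trans (qle s0 x As0)); case: (svalP s0).
  by exists (exist _ q (conj sq qp)) => s As; apply/asboolP => x /=; exact: qle.
exists q => //; apply: minimal_sublinear_linear => // q' sq' q'q.
have q'p x : q' x <= p x by exact: le_trans (q'q x) (qp x).
have := qmin (exist _ q' (conj sq' q'p)).
by rewrite /r /= => /(_ (asboolT q'q)) /(congr1 sval).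
Qed.

Definition real_convex C : Prop :=
  forall x y (t : R), C x -> C y -> 0 <= t <= 1 ->
    C (t%:C *: x + (1 - t)%:C *: y).

(** The sublinear functional is [inf (q (x + t c) - t d)] over [c] in [C] and
    [t >= 0]: it is at most [q] and takes values at most [- d] on [- C]. *)
Lemma convex_separation (q : Y -> R) C (d : R) : sublinear q ->
  (forall x, q (- x) = q x) -> C !=set0 -> real_convex C ->
  (forall x, C x -> d <= q x) ->
  exists l, [/\ real_linear l, forall x, l x <= q x & forall x, C x -> d <= l x].
Proof.
move=> sq qN [c0 Cc0] Cconv Cd; have [qD qZ] := sq.
pose S x := [set q (x + ct.2%:C *: ct.1) - ct.2 * d |
             ct in [set ct : Y * R | C ct.1 /\ 0 <= ct.2]].
pose p x := inf (S x).
have Slb x : has_lbound (S x).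
  exists (- q x) => _ [[c t] /= [Cc t0] <-].
  have := qD (x + t%:C *: c) (- x); rewrite addrAC subrr add0r qZ // qN.
  have := ler_wpM2l t0 (Cd c Cc); lra.
have Sne x : S x !=set0 by exists (q (x + 0%:C *: c0) - 0 * d), (c0, 0).
have ple x c t : C c -> 0 <= t -> p x <= q (x + t%:C *: c) - t * d.
  by move=> Cc t0; apply: ge_inf => //; exists (c, t).
have pq x : p x <= q x.
  by have := ple x _ _ Cc0 (lexx 0); rewrite scale0r addr0 mul0r subr0.
have sp : sublinear p.
  split=> [x y|t x t0].
    rewrite -lerBlDr; apply: lb_le_inf => // _ [[c s] /= [Cc s0] <-].
    rewrite lerBlDr -lerBlDl; apply: lb_le_inf => // _ [[c' t] /= [Cc' t0] <-].
    rewrite lerBlDl.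
    have [st0|st0] := eqVneq (s + t) 0.
      have [-> ->] : s = 0 /\ t = 0 by lra.
      rewrite !scale0r !addr0 !mul0r !subr0.
      exact: le_trans (pq _) (qD _ _).
    have stp : 0 < s + t by rewrite lt0r st0 addr_ge0.
    pose u := s / (s + t).
    have Cm : C (u%:C *: c + (1 - u)%:C *: c').
      apply: Cconv => //; rewrite /u divr_ge0 ?(ltW stp) //=.
      by rewrite ler_pdivrMr // mul1r lerDl.
    apply: (le_trans (ple (x + y) _ _ Cm (ltW stp))).
    rewrite scalerDr !scalerA -!rmorphM /= mulrBr mulr1.
    have -> : (s + t) * u = s by rewrite /u mulrC divfK.
    have -> : s + t - s = t by ring.
    rewrite addrACA.
    have := qD (x + s%:C *: c) (y + t%:C *: c'); lra.
  apply: positive_homogeneous t x t0 => [|t x tp].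
    apply/eqP; rewrite eq_le; apply/andP; split.
      by have := pq 0; rewrite (sublinear0 sq).
    apply: lb_le_inf => // _ [[c s] /= [Cc s0] <-].
    by rewrite add0r qZ // -mulrBr mulr_ge0 // subr_ge0 Cd.
  rewrite -ler_pdivrMl //; apply: lb_le_inf => // _ [[c s] /= [Cc s0] <-].
  rewrite ler_pdivrMl //.
  have ts0 : 0 <= t * s by rewrite mulr_ge0 // ltW.
  apply: (le_trans (ple _ _ _ Cc ts0)).
  by rewrite rmorphM -scalerA -scalerDr qZ ?(ltW tp) // -mulrA -mulrBr.
have [l ll lp] := sublinear_minorant sp.
exists l; split=> // [x|x Cx]; first exact: le_trans (lp x) (pq x).
have := le_trans (lp (- x)) (ple (- x) _ _ Cx ler01).
by rewrite scale1r addNr sublinear0 // mul1r sub0r real_linearN // lerN2.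
Qed.
End HahnBanach.


(** * The Riesz-Markov theorem *)

Section PositiveFunctional.
Variables (R : realType) (K : ptopologicalType).
Implicit Types (f g : K -> R) (L : (K -> R) -> R).

Definition nonneg_cont f : Prop := continuous f /\ forall x, 0 <= f x.

Definition positive_functional L : Prop :=
  [/\ forall f g, nonneg_cont f -> nonneg_cont g ->
        L (fun x => f x + g x) = L f + L g,
      forall (t : R) f, 0 <= t -> nonneg_cont f ->
        L (fun x => t * f x) = t * L f &
      forall f, nonneg_cont f -> 0 <= L f].

Lemma cst_cont (t : R) : continuous (fun _ : K => t).
Proof. by move=> x; exact: cvg_cst. Qed.

Lemma add_cont f g : continuous f -> continuous g ->
  continuous (fun x => f x + g x).
Proof. by move=> cf cg x; apply: cvgD; [exact: cf|exact: cg]. Qed.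

Lemma sub_cont f g : continuous f -> continuous g ->
  continuous (fun x => f x - g x).
Proof. by move=> cf cg x; apply: cvgB; [exact: cf|exact: cg]. Qed.

Lemma mul_cont f g : continuous f -> continuous g ->
  continuous (fun x => f x * g x).
Proof. by move=> cf cg x; apply: cvgM; [exact: cf|exact: cg]. Qed.

Lemma scale_cont (t : R) f : continuous f -> continuous (fun x => t * f x).
Proof. by move=> cf; apply: mul_cont => //; exact: cst_cont. Qed.

Lemma max_cont f g : continuous f -> continuous g ->
  continuous (fun x => Num.max (f x) (g x)).
Proof. by move=> cf cg x; apply: (@continuous_max R K f g x); [exact: cf|exact: cg]. Qed.

Lemma open_superlevel f (t : R) : continuous f -> open [set x | t < f x].
Proof.
move=> cf; apply: (@open_comp _ _ f [set y | t < y]) => [x _|].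
  exact: cf.
exact: open_gt.
Qed.

Lemma closed_superlevel f (t : R) : continuous f -> closed [set x | t <= f x].
Proof.
move=> cf; apply: (@closed_comp _ _ f [set y | t <= y]) => [x _|].
  exact: cf.
exact: closed_ge.
Qed.

Definition cutoff (s : R) f : K -> R := fun x => Num.max (f x - s) 0.

Lemma cut_nonneg_cont s f : continuous f -> nonneg_cont (cutoff s f).
Proof.
move=> cf; split; last by move=> x; rewrite le_max lexx orbT.
by apply: max_cont; [apply: sub_cont => //|]; exact: cst_cont.
Qed.

Lemma cut_eq0 s f x : f x <= s -> cutoff s f x = 0.
Proof. by move=> fs; rewrite /cutoff max_r // subr_le0. Qed.

Lemma cut_gt s f x : s <= f x -> cutoff s f x = f x - s.
Proof. by move=> fs; rewrite /cutoff max_l // subr_ge0. Qed.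

Lemma cut_le s f x : 0 <= s -> 0 <= f x -> cutoff s f x <= f x.
Proof. by move=> s0 f0; rewrite /cutoff ge_max f0 andbT gerBl. Qed.

Lemma le_cut s f x : f x <= cutoff s f x + s.
Proof. by rewrite -lerBlDr /cutoff le_max lexx. Qed.

Section Functional.
Variable L : (K -> R) -> R.
Hypothesis posL : positive_functional L.

Lemma pf_add f g : nonneg_cont f -> nonneg_cont g ->
  L (fun x => f x + g x) = L f + L g.
Proof. by have [h _ _] := posL; exact: h. Qed.

Lemma pf_scale (t : R) f : 0 <= t -> nonneg_cont f ->
  L (fun x => t * f x) = t * L f.
Proof. by have [_ h _] := posL; exact: h. Qed.

Lemma pf_ge0 f : nonneg_cont f -> 0 <= L f.
Proof. by have [_ _ h] := posL; exact: h. Qed.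

Lemma pf_le f g : nonneg_cont f -> nonneg_cont g ->
  (forall x, f x <= g x) -> L f <= L g.
Proof.
move=> nf ng fg.
have nh : nonneg_cont (fun x => g x - f x).
  by split; [apply: sub_cont; [case: ng|case: nf]|move=> x; rewrite subr_ge0].
have -> : g = fun x => f x + (g x - f x) by apply/funext => x; rewrite subrKC.
by rewrite pf_add // lerDl pf_ge0.
Qed.

Lemma positive_functional_scale (t : R) : 0 <= t ->
  positive_functional (fun f => t * L f).
Proof.
move=> t0; split=> [f g nf ng|u f u0 nf|f nf].
- by rewrite pf_add // mulrDr.
- by rewrite pf_scale // mulrCA.
- by rewrite mulr_ge0 ?pf_ge0.
Qed.

Lemma one_nonneg_cont : nonneg_cont (fun=> 1).
Proof. by split => //; exact: cst_cont. Qed.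

Lemma cst_nonneg_cont (t : R) : 0 <= t -> nonneg_cont (fun=> t).
Proof. by move=> t0; split => //; exact: cst_cont. Qed.

Lemma pf_cst (t : R) : 0 <= t -> L (fun=> t) = t * L (fun=> 1).
Proof.
move=> t0; rewrite -pf_scale //; last exact: one_nonneg_cont.
by congr L; apply/funext => x; rewrite mulr1.
Qed.

(** Replacing a function by its cutoff costs little, and the support of the
    cutoff lies in the closed set where the function is at least [s]. *)
Lemma pf_cut (s : R) f : 0 <= s -> nonneg_cont f ->
  L f <= L (cutoff s f) + s * L (fun=> 1).
Proof.
move=> s0 [cf f0]; have nc := cut_nonneg_cont s cf.
rewrite -pf_cst // -pf_add //; last exact: cst_nonneg_cont.
apply: pf_le => //; last by move=> x; exact: le_cut.
split=> [|x]; first by apply: add_cont; [case: nc|exact: cst_cont].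
by rewrite addr_ge0 //; case: nc.
Qed.

Definition below (U : set K) f : Prop :=
  [/\ nonneg_cont f, forall x, f x <= 1 & forall x, ~ U x -> f x = 0].

Definition open_content (U : set K) : R := sup [set L f | f in below U].

Lemma below0 U : below U (fun=> 0).
Proof. by split=> //; exact: cst_nonneg_cont. Qed.

Let ub U : has_ubound [set L f | f in below U].
Proof.
exists (L (fun=> 1)) => _ [f [nf f1 _] <-].
by apply: pf_le => //; exact: one_nonneg_cont.
Qed.

Let ne U : [set L f | f in below U] !=set0.
Proof. by exists (L (fun=> 0)), (fun=> 0); first exact: below0. Qed.

Lemma le_open_content U f : below U f -> L f <= open_content U.
Proof. by move=> Uf; apply: ub_le_sup => //; exists f. Qed.

Lemma open_content_le U (M : R) :
  (forall f, below U f -> L f <= M) -> open_content U <= M.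
Proof. by move=> UM; apply: ge_sup => // _ [f Uf <-]; exact: UM. Qed.

Lemma open_content_ge0 U : 0 <= open_content U.
Proof.
apply: le_trans (le_open_content (below0 U)); rewrite pf_ge0 //.
exact: cst_nonneg_cont.
Qed.

Lemma open_content_adherent U (e : R) : 0 < e ->
  exists2 f, below U f & open_content U - e < L f.
Proof.
by move=> e0; have [_ [f Uf <-] h] := sup_adherent e0 (conj (ne U) (ub U)); exists f.
Qed.

Lemma open_content_mono U V : U `<=` V -> open_content U <= open_content V.
Proof.
move=> UV; apply: open_content_le => f [nf f1 f0]; apply: le_open_content.
by split=> // x nVx; apply: f0 => /UV.
Qed.

Lemma open_content0 : open_content set0 = 0.
Proof.
apply/eqP; rewrite eq_le open_content_ge0 andbT.
apply: open_content_le => f [_ _ f0].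
have -> : f = fun=> 0 by apply/funext => x; exact: f0.
by rewrite pf_cst // mul0r.
Qed.

Lemma open_contentT : open_content setT = L (fun=> 1).
Proof.
apply/eqP; rewrite eq_le; apply/andP; split.
  apply: open_content_le => f [nf f1 f0].
  by apply: pf_le => //; exact: one_nonneg_cont.
by apply: le_open_content; split => [|//|x []//]; exact: one_nonneg_cont.
Qed.

Hypothesis hK : hausdorff_space K.
Hypothesis cK : compact [set: K].

Lemma compact_urysohn (A B : set K) : closed A -> closed B ->
  (forall x, A x -> ~ B x) -> exists f : K -> R,
  [/\ nonneg_cont f, forall x, f x <= 1, forall x, A x -> f x = 0 &
      forall x, B x -> f x = 1].
Proof.
move=> clA clB AB.
have /(@normal_separatorP R K) := compact_normal hK cK.
move=> /(_ A B clA clB) sep; have : uniform_separator A B.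
  by apply: sep; apply/seteqP; split => // x [Ax Bx]; exact: AB Bx.
move=> /(@uniform_separatorP K R)[f [cf f01 fA fB]].
have f01' x : 0 <= f x <= 1.
  by have := f01 (f x) (ex_intro2 _ _ x I erefl); rewrite /= in_itv /=.
exists f; split.
- by split=> // x; case/andP: (f01' x).
- by move=> x; case/andP: (f01' x).
- by move=> x Ax; apply: fA; exists x.
- by move=> x Bx; apply: fB; exists x.
Qed.

(** A function below a union of two open sets splits, up to [e], along a
    Urysohn function that is 1 on the part of [e <= f] outside the second. *)
Lemma open_contentU U V : open U -> open V ->
  open_content (U `|` V) <= open_content U + open_content V.
Proof.
move=> oU oV; apply: open_content_le => f [[cf f0] f1 fUV].
have M0 : 0 <= L (fun=> 1) by rewrite pf_ge0 //; exact: one_nonneg_cont.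
apply: (ler_add_multiple M0) => e e0; rewrite [_ * e]mulrC.
have clC : closed ([set x | e <= f x] `&` ~` V).
  by apply: closedI; [exact: closed_superlevel|exact: open_closedC].
have [||p [[cp p0] p1 pU pC]] := @compact_urysohn (~` U) _ _ clC.
- exact: open_closedC.
- move=> x nUx [/= ex nVx]; have : e <= 0 by rewrite -(fUV x) // => -[].
  by rewrite leNgt e0.
have [cc c0] := cut_nonneg_cont e cf.
apply: (le_trans (pf_cut (ltW e0) (conj cf f0))); rewrite lerD2r.
have cutle x : cutoff e f x <= 1 by apply: (le_trans (cut_le (ltW e0) (f0 x))).
have n1 : nonneg_cont (fun x => cutoff e f x * p x).
  by split; [exact: mul_cont|move=> x; rewrite mulr_ge0].
have n2 : nonneg_cont (fun x => cutoff e f x * (1 - p x)).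
  split; last by move=> x; rewrite mulr_ge0 // subr_ge0.
  by apply: mul_cont => //; apply: sub_cont => //; exact: cst_cont.
rewrite [X in L X](_ : _ = fun x => cutoff e f x * p x + cutoff e f x * (1 - p x)); last first.
  by apply/funext => x; rewrite -mulrDr subrKC mulr1.
rewrite pf_add // lerD // le_open_content //; split=> // x.
- by rewrite mulr_ile1.
- by move=> /pU ->; rewrite mulr0.
- by rewrite mulr_ile1 ?subr_ge0 // gerBl.
- move=> nVx; have [ex|/ltW fe] := leP e (f x).
    by rewrite pC // subrr mulr0.
  by rewrite cut_eq0 // mul0r.
Qed.

(** The closed set where a function below the union is at least [e] is compact,
    so finitely many of the open sets carry its cutoff. *)
Lemma open_content_sigma (U : (set K)^nat) : (forall n, open (U n)) ->
  (forall M : R, (forall n, \sum_(i < n) open_content (U i) <= M) ->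
    open_content (\bigcup_n U n) <= M).
Proof.
move=> oU M hM.
have fin n : open_content (\big[setU/set0]_(i < n) U i) <=
    \sum_(i < n) open_content (U i).
  elim: n => [|n IHn]; first by rewrite !big_ord0 open_content0.
  rewrite !big_ord_recr /=; apply: (le_trans (open_contentU _ _)) => //.
    by rewrite -bigcup_mkord; apply: bigcup_open => i _.
  by rewrite lerD2r.
apply: open_content_le => f [[cf f0] f1 fU].
have M0 : 0 <= L (fun=> 1) by rewrite pf_ge0 //; exact: one_nonneg_cont.
apply: (ler_add_multiple M0) => e e0; rewrite [_ * e]mulrC.
apply: (le_trans (pf_cut (ltW e0) (conj cf f0))); rewrite lerD2r.
have : compact [set x | e <= f x].
  by apply: (subclosed_compact _ cK) => //; exact: closed_superlevel.
rewrite compact_cover => /(_ nat setT U (fun i _ => oU i)); case.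
  move=> x /= ex; apply: contrapT => nU; move: ex.
  by rewrite fU ?leNgt ?e0.
move=> D _ DU.
have [n Dn] : exists n, forall i, i \in D -> (i < n)%N.
  exists (\max_(i <- D) i).+1 => i iD; rewrite ltnS.
  by rewrite (big_rem i iD) leq_maxl.
apply: le_trans (hM n); apply: le_trans (fin n); apply: le_open_content.
split.
- exact: cut_nonneg_cont.
- by move=> x; apply: (le_trans (cut_le (ltW e0) (f0 x))).
- move=> x nUx; apply: cut_eq0; rewrite leNgt; apply/negP => /ltW ex.
  have [i iD Uix] := DU x ex; apply: nUx.
  by rewrite -bigcup_mkord; exists i => //=; exact: Dn.
Qed.
End Functional.
End PositiveFunctional.


Section BorelIntegration.
Variables (R : realType) (K : ptopologicalType).
Implicit Types (f g : K -> R) (mu : probability (borel K) R).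

Lemma open_measurable (U : set (borel K)) : @open K U -> measurable U.
Proof. by move=> oU; apply: sub_sigma_algebra. Qed.

Lemma cont_measurable f : continuous f -> measurable_fun [set: borel K] f.
Proof.
move=> cf; apply: (measurability _ (measurable_realfun.RGenOInfty.measurableE R)) => //.
move=> _ [_ [t ->] <-]; rewrite setTI; apply: open_measurable.
rewrite (_ : _ @^-1` _ = [set x | t < f x]); first exact: open_superlevel.
by apply/seteqP; split => x /=; rewrite in_itv /= andbT.
Qed.

Lemma bounded_integrable mu f (M : R) : measurable_fun [set: borel K] f ->
  (forall x, `|f x| <= M) -> mu.-integrable [set: borel K] (EFin \o f).
Proof.
move=> mf fM; apply: measurable_bounded_integrable => //.
  by rewrite -ge0_fin_numE // fin_num_measure.
exists M; split; first exact: num_real.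
by move=> t /ltW Mt x _; exact: le_trans (fM x) Mt.
Qed.

Hypothesis cK : compact [set: K].

Lemma cont_bounded f : continuous f -> exists M : R, forall x, `|f x| <= M.
Proof.
move=> cf; have : compact (f @` setT).
  by apply: continuous_compact => //; exact: continuous_subspaceT.
move=> /compact_bounded [M [_ /(_ (M + 1))]]; rewrite ltrDl ltr01 => /(_ isT) h.
by exists (M + 1) => x; apply: h; exists x.
Qed.

Lemma cont_integrable mu f : continuous f ->
  mu.-integrable [set: borel K] (EFin \o f).
Proof.
move=> cf; have [M fM] := cont_bounded cf.
by apply: bounded_integrable fM; exact: cont_measurable.
Qed.

Lemma Rintegral_positive mu :
  positive_functional (fun f : K -> R => \int[mu]_x f x).
Proof.
split=> [f g [cf _] [cg _]|t f _ [cf _]|f [_ f0]].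
- by rewrite RintegralD //; exact: cont_integrable.
- by rewrite RintegralZl //; exact: cont_integrable.
- exact: Rintegral_ge0.
Qed.

Lemma Rintegral_one mu : \int[mu]_x (1 : R) = 1.
Proof. by rewrite Rintegral_cst //= (probability_setT mu) mulr1. Qed.
End BorelIntegration.

Section RieszMeasure.
Variables (R : realType) (K : ptopologicalType) (L : (K -> R) -> R).
Hypotheses (posL : positive_functional L).
Hypotheses (hK : hausdorff_space K) (cK : compact [set: K]).

Definition riesz_outer (E : set K) : \bar R :=
  ereal_inf [set (open_content L U)%:E | U in [set U | open U /\ E `<=` U]].

Lemma riesz_outer_ge0 E : (0 <= riesz_outer E)%E.
Proof.
apply: le_ereal_inf_tmp => _ [U _ <-]; rewrite lee_fin.
exact: open_content_ge0.
Qed.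

Lemma riesz_outer_le E U : open U -> E `<=` U ->
  (riesz_outer E <= (open_content L U)%:E)%E.
Proof. by move=> oU EU; apply: ereal_inf_lbound; exists U. Qed.

Lemma riesz_outer_open U : open U -> riesz_outer U = (open_content L U)%:E.
Proof.
move=> oU; apply/eqP; rewrite eq_le riesz_outer_le //=.
apply: le_ereal_inf_tmp => _ [V [oV UV] <-]; rewrite lee_fin.
exact: open_content_mono.
Qed.

Lemma riesz_outer_fin E : riesz_outer E \is a fin_num.
Proof.
rewrite ge0_fin_numE ?riesz_outer_ge0 //.
apply: (le_lt_trans (riesz_outer_le openT (@subsetT _ E))).
exact: ltry.
Qed.

Lemma riesz_outer_adherent E (e : R) : 0 < e -> exists U,
  [/\ open U, E `<=` U & ((open_content L U)%:E <= riesz_outer E + e%:E)%E].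
Proof.
move=> e0; have [_ [U [oU EU] <-] h] := lb_ereal_inf_adherent e0 (riesz_outer_fin E).
by exists U; split => //; exact: ltW.
Qed.

Lemma riesz_outer0 : riesz_outer set0 = 0%E.
Proof. by rewrite (riesz_outer_open open0) open_content0. Qed.

Lemma le_riesz_outer : {homo riesz_outer : A B / A `<=` B >-> (A <= B)%E}.
Proof.
move=> A B AB; apply: le_ereal_inf_tmp => _ [U [oU BU] <-].
by apply: riesz_outer_le => // x /AB /BU.
Qed.

Lemma riesz_outer_sigma_subadditive : sigma_subadditive riesz_outer.
Proof.
move=> F; apply/lee_addgt0Pr => e e0.
apply: le_trans (epsilon_trick xpredT (fun n => riesz_outer_ge0 (F n)) (ltW e0)).
have [U PU] : {U : (set K)^nat & forall n, [/\ open (U n), F n `<=` U n &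
    ((open_content L (U n))%:E <= riesz_outer (F n) +
       (e / (2 ^ n.+1)%:R)%:E)%E]}.
  apply: (@choice _ _ (fun n V => [/\ open V, F n `<=` V &
    ((open_content L V)%:E <= riesz_outer (F n) +
       (e / (2 ^ n.+1)%:R)%:E)%E])) => n.
  apply: riesz_outer_adherent; rewrite divr_gt0 //.
have oU n : open (U n) by have [] := PU n.
have oUU : open (\bigcup_n U n) by apply: bigcup_open.
apply: (le_trans (riesz_outer_le oUU _)).
  by move=> x [n _ Fx]; exists n => //; have [_ FU _] := PU n; exact: FU.
apply: (@le_trans _ _ (\sum_(i <oo) (open_content L (U i))%:E)%E); last first.
  apply: lee_nneseries => [i _ _|i _]; last by have [] := PU i.
  by rewrite lee_fin; exact: open_content_ge0.
set s := (X in (_ <= X)%E); case: (leP s +oo%E) => [|]; last first.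
  by rewrite ltNge leey.
rewrite le_eqVlt => /predU1P[->|sfin]; first exact: leey.
have s0 : (0 <= s)%E.
  by apply: nneseries_ge0 => n _ _; rewrite lee_fin; exact: open_content_ge0.
have sE : s = (fine s)%:E by rewrite fineK // ge0_fin_numE.
rewrite sE lee_fin; apply: open_content_sigma => // n.
rewrite -lee_fin -sE -sumEFin -(big_mkord xpredT (fun i => (open_content L (U i))%:E)).
by apply: nneseries_lim_ge => i *; rewrite lee_fin; exact: open_content_ge0.
Qed.

#[local] HB.instance Definition _ := isOuterMeasure.Build R K riesz_outer
  riesz_outer0 riesz_outer_ge0 le_riesz_outer riesz_outer_sigma_subadditive.

(** For open [W], a function close to the content of [W `&` U] is cut off so that
    its support is a closed [C] in [W `&` U]; adding one below [W `\` C] stays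
    below [W]. *)
Lemma open_caratheodory U : open U -> riesz_outer.-caratheodory U.
Proof.
move=> oU; apply: le_caratheodory_measurable => E.
apply: le_ereal_inf_tmp => _ [W [oW EW] <-].
have oWU : open (W `&` U) by exact: openI.
have EWU := leeD (le_riesz_outer (@setSI _ U _ _ EW)) (le_riesz_outer (@setSI _ (~` U) _ _ EW)).
apply: (le_trans EWU).
rewrite riesz_outer_open // -[riesz_outer (_ `&` ~` _)]fineK ?riesz_outer_fin //.
rewrite -EFinD lee_fin; apply/ler_addgt0Pr => e e0.
have M0 : 0 <= L (fun=> 1) by rewrite pf_ge0 //; exact: one_nonneg_cont.
have e3 : 0 < e / 3 by rewrite divr_gt0.
have [d d0 dM] := small_multiple M0 e3; rewrite mulrC in dM.
have [f [[cf f0] f1 fWU] Lf] := open_content_adherent posL (W `&` U) e3.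
pose C := [set x | d <= f x].
have oWC : open (W `&` ~` C).
  by apply: openI => //; apply: closed_openC; exact: closed_superlevel.
have [g [[cg g0] g1 gWC] Lg] := open_content_adherent posL (W `&` ~` C) e3.
have CWU x : C x -> W x /\ U x.
  move=> Cx; apply: contrapT => nWU; have := Cx; rewrite /C /= fWU //.
  by rewrite leNgt d0.
have h1 : fine (riesz_outer (W `&` ~` U)) <= open_content L (W `&` ~` C).
  rewrite -lee_fin fineK ?riesz_outer_fin //; apply: riesz_outer_le => //.
  by move=> x [Wx nUx]; split => // /CWU[].
have nc := cut_nonneg_cont d cf; have [cc c0] := nc.
have h2 : L (cutoff d f) + L g <= open_content L W.
  rewrite -pf_add //; apply: le_open_content => //; split=> [|x|x nWx].
  - by split=> [|x]; [exact: add_cont|rewrite addr_ge0].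
  - have [Cx|/ltW fd] := leP d (f x).
      rewrite gWC ?addr0; last by move=> [].
      by apply: (le_trans (cut_le (ltW d0) (f0 x))).
    by rewrite cut_eq0 // add0r.
  - rewrite gWC ?addr0; last by move=> [].
    by rewrite cut_eq0 // fWU ?(ltW d0) // => -[].
have h3 := pf_cut posL (ltW d0) (conj cf f0).
lra.
Qed.

Lemma borel_caratheodory (A : set (borel K)) : measurable A ->
  riesz_outer.-caratheodory A.
Proof.
apply: smallest_sub.
- split; first exact: (@measurable0 _ (caratheodory_type riesz_outer)).
    move=> B mB; rewrite setTD.
    exact: (@measurableC _ (caratheodory_type riesz_outer)).
  exact: (@bigcupT_measurable _ (caratheodory_type riesz_outer)).
- by move=> U oU; exact: open_caratheodory.
Qed.

(** An alias that carries the measure structure on the Borel sets, next to the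
    outer measure structure of [riesz_outer]. *)
Definition riesz_measure : set (borel K) -> \bar R := riesz_outer.

Lemma riesz_measure_sigma_additive : semi_sigma_additive riesz_measure.
Proof.
move=> A mA tA mUA.
apply: (@caratheodory_measure_sigma_additive R K riesz_outer A) => //.
  by move=> i; exact: borel_caratheodory.
exact: borel_caratheodory.
Qed.

Hypothesis L1 : L (fun=> 1) = 1.

Lemma riesz_measureT : riesz_measure setT = 1%E.
Proof.
by rewrite /riesz_measure (riesz_outer_open openT) open_contentT // L1.
Qed.

#[local] HB.instance Definition _ := isMeasure.Build _ (borel K) R riesz_measure
  riesz_outer0 riesz_outer_ge0 riesz_measure_sigma_additive.

#[local] HB.instance Definition _ := Measure_isProbability.Build _ (borel K) R
  riesz_measure riesz_measureT.

Definition riesz_probability : probability (borel K) R := riesz_measure.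

(** Outer regularity is the definition of the outer measure; inner regularity
    is outer regularity of the complement, whose open neighbourhoods have
    compact complements. *)
Lemma riesz_regular : regular_measure riesz_probability.
Proof.
move=> A mA; have outer (B : set (borel K)) : riesz_outer B =
    ereal_inf (riesz_outer @` [set U | @open K U /\ B `<=` U]).
  congr ereal_inf; apply/seteqP.
  by split=> _ [U [oU BU] <-]; exists U; rewrite ?riesz_outer_open.
split; first exact: outer.
apply/eqP; rewrite eq_le; apply/andP; split; last first.
  by apply: ge_ereal_sup => _ [C [_ CA] <-]; exact: le_riesz_outer.
apply/lee_addgt0Pr => e e0.
have [U [oU AU Ue]] := riesz_outer_adherent (~` A) e0.
have cU : @compact K (~` U).
  by apply: (subclosed_compact _ cK) => //; exact: open_closedC.
have UA : ~` U `<=` A by rewrite -[X in _ `<=` X]setCK; exact: subsetC.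
have mU := open_measurable oU.
have -> : riesz_probability A = (1 - riesz_probability (~` A))%E.
  by rewrite -probability_setC ?setCK //; exact: measurableC.
apply: (@le_trans _ _ (riesz_probability (~` U) + e%:E)%E); last first.
  by rewrite leeD2r //; apply: ereal_sup_ubound; exists (~` U).
rewrite (probability_setC _ mU); move: Ue; rewrite -(riesz_outer_open oU).
rewrite -[riesz_probability U]/(riesz_outer U).
rewrite -[riesz_probability (~` A)]/(riesz_outer (~` A)).
rewrite -(fineK (riesz_outer_fin U)) -(fineK (riesz_outer_fin (~` A))).
rewrite -!EFinD !lee_fin; lra.
Qed.


Local Notation P := riesz_probability.
Local Notation I f := (\int[P]_x f x).

(** The layer [cutoff s f - cutoff (s + d) f] is at most [d] everywhere,
    vanishes off [s < f] and equals [d] where [s + d <= f]; so the functional on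
    a layer is at most the integral of the layer below. *)
Lemma riesz_layer (f : K -> R) (s d : R) : nonneg_cont f -> 0 < d ->
  L (cutoff (s + d) f) - L (cutoff (s + d + d) f) <=
  I (cutoff s f) - I (cutoff (s + d) f).
Proof.
move=> [cf f0] d0.
pose lay t x := cutoff t f x - cutoff (t + d) f x.
have cc t : continuous (cutoff t f) by have [] := cut_nonneg_cont t cf.
have lay0 t x : 0 <= lay t x.
  rewrite subr_ge0 /cutoff ge_max !le_max lexx orbT andbT; apply/orP; left.
  by rewrite lerD2l lerN2 lerDl ltW.
have nlay t : nonneg_cont (lay t) by split; [exact: sub_cont|exact: lay0].
have layd t x : lay t x <= d.
  rewrite lerBlDr /cutoff ge_max addrC; apply/andP; split.
    have : f x - (t + d) <= Num.max (f x - (t + d)) 0 by rewrite le_max lexx.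
    lra.
  have : 0 <= Num.max (f x - (t + d)) 0 by rewrite le_max lexx orbT.
  lra.
pose U := [set x | s + d < f x].
have oU : open U by exact: open_superlevel.
have -> : L (cutoff (s + d) f) - L (cutoff (s + d + d) f) = L (lay (s + d)).
  rewrite [X in L X - _](_ : _ = fun x => lay (s + d) x + cutoff (s + d + d) f x).
    by rewrite pf_add // ?addrK //; exact: cut_nonneg_cont.
  by apply/funext => x; rewrite subrK.
rewrite -RintegralB //; try exact: cont_integrable.
apply: (@le_trans _ _ (d * open_content L U)).
  rewrite -ler_pdivrMl // -pf_scale ?invr_ge0 ?(ltW d0) //.
  apply: le_open_content => //; split=> [|x|x].
  - split=> [|x]; first by apply: scale_cont; case: (nlay (s + d)).
    by rewrite mulr_ge0 // invr_ge0 ltW.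
  - by rewrite ler_pdivrMl // mulr1.
  - rewrite /U /= => /negP; rewrite -leNgt => fs.
    by rewrite /lay !cut_eq0 ?subrr ?mulr0 // (le_trans fs) // lerDl ltW.
have mU := open_measurable oU.
have -> : open_content L U = \int[P]_x \1_U x.
  rewrite /Rintegral integral_indic // setIT.
  by transitivity (fine (riesz_outer U)); [rewrite riesz_outer_open|].
have iU : P.-integrable [set: borel K] (EFin \o \1_U) by exact: integrable_indic.
rewrite -RintegralZl //; apply: le_Rintegral => //.
- exact: (integrableZl measurableT d iU).
- by apply: cont_integrable => //; exact: sub_cont.
- move=> x _; rewrite indicE; case: (boolP (x \in U)) => [/set_mem xU|_]; last first.
    by rewrite mulr0 lay0.
  have sf := ltW xU; rewrite mulr1 /lay !cut_gt //; first lra.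
  by apply: le_trans sf; rewrite lerDl ltW.
Qed.

(** Summing [riesz_layer] over the levels [n * d] telescopes; the sum stops at
    a bound of [f], and what is lost is the first layer, of size at most [d]. *)
Lemma riesz_le (f : K -> R) : nonneg_cont f -> L f <= I f.
Proof.
move=> nf; have [cf f0] := nf; apply/ler_addgt0Pr => d d0.
have [M fM] := cont_bounded cK cf.
have step n : L (cutoff (0 + d) f) - I (cutoff 0 f) <=
    L (cutoff (n%:R * d + d) f) - I (cutoff (n%:R * d) f).
  elim: n => [|n IHn]; first by rewrite mul0r.
  apply: (le_trans IHn); have := riesz_layer (n%:R * d) nf d0.
  by rewrite -natr1 mulrDl mul1r; lra.
have [n nM] : exists n : nat, M <= n%:R * d.
  exists (Num.bound `|M / d|); rewrite -ler_pdivrMr //.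
  exact: le_trans (ler_norm _) (ltW (archi_boundP (normr_ge0 _))).
have c0 (t : R) : M <= t -> cutoff t f = fun=> 0.
  move=> Mt; apply/funext => x; apply: cut_eq0.
  exact: le_trans (ler_norm _) (le_trans (fM x) Mt).
have nM' : M <= n%:R * d + d by rewrite (le_trans nM) // lerDl ltW.
have := step n; rewrite (c0 _ nM) (c0 _ nM') add0r.
rewrite pf_cst // mul0r Rintegral_cst // mul0r subrr.
have -> : cutoff 0 f = f by apply/funext => x; rewrite cut_gt // subr0.
have := pf_cut posL (ltW d0) nf; rewrite L1 mulr1; lra.
Qed.

(** Applying [riesz_le] to [M - f] gives the reverse inequality. *)
Theorem riesz_representation (f : K -> R) : nonneg_cont f -> L f = I f.
Proof.
move=> nf; have [cf f0] := nf; apply/eqP; rewrite eq_le riesz_le //=.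
have [M fM] := cont_bounded cK cf.
have fM' x : f x <= M := le_trans (ler_norm _) (fM x).
have M0 : 0 <= M := le_trans (f0 point) (fM' point).
have nM : nonneg_cont (fun x => M - f x).
  split; first by apply: sub_cont => //; exact: cst_cont.
  by move=> x; rewrite subr_ge0.
have e g : positive_functional g -> g (fun=> 1) = 1 ->
    g (fun x => M - f x) = M - g f.
  move=> pg g1; apply/eqP; rewrite eq_sym subr_eq -pf_add //.
  rewrite [X in g X](_ : _ = fun=> M); first by rewrite pf_cst // g1 mulr1.
  by apply/funext => x; rewrite subrK.
have := riesz_le nM; rewrite e //.
have := e _ (Rintegral_positive cK P) (Rintegral_one P) => /= ->.
lra.
Qed.
End RieszMeasure.

Theorem riesz_markov (R : realType) (K : ptopologicalType) (L : (K -> R) -> R) :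
  hausdorff_space K -> compact [set: K] -> positive_functional L ->
  L (fun=> 1) = 1 ->
  exists2 P : probability (borel K) R, regular_measure P &
    forall f, nonneg_cont f -> L f = \int[P]_x f x.
Proof.
move=> hK cK posL L1; exists (riesz_probability posL hK cK L1).
  exact: riesz_regular.
exact: riesz_representation.
Qed.


(** * Invariant functionals of a uniquely ergodic action *)

Section ContinuousMaps.
Variables (R : realType) (K : ptopologicalType).
Implicit Types (phi : K -> K) (mu : probability (borel K) R).

Lemma cont_borel_measurable phi : continuous phi ->
  measurable_fun [set: borel K] (phi : borel K -> borel K).
Proof.
move=> cphi; apply: (@measurability _ _ (borel K) (borel K) setT phi (@open K) erefl).
move=> _ [U oU <-].
rewrite setTI; apply: open_measurable.
by apply: (@open_comp _ _ phi U) => // x _; exact: cphi.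
Qed.

Lemma cont_preimage_measurable phi (A : set (borel K)) : continuous phi ->
  measurable A -> measurable (phi @^-1` A : set (borel K)).
Proof.
move=> cphi mA; rewrite -[X in measurable X]setTI.
exact: (cont_borel_measurable cphi).
Qed.

Hypothesis cK : compact [set: K].

Lemma measure_le_integral mu (A : set (borel K)) (f : K -> R) :
  measurable A -> nonneg_cont f -> (forall x, A x -> 1 <= f x) ->
  (mu A <= (\int[mu]_x f x)%:E)%E.
Proof.
move=> mA [cf f0] f1; have -> : mu A = (\int[mu]_x \1_A x)%:E.
  by rewrite /Rintegral integral_indic // setIT fineK // fin_num_measure.
rewrite lee_fin; apply: le_Rintegral => //.
- exact: integrable_indic.
- exact: cont_integrable.
- move=> x _; rewrite indicE; case: (boolP (x \in A)) => [/set_mem|_].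
    exact: f1.
  exact: f0.
Qed.

Lemma integral_le_measure mu (U : set (borel K)) (f : K -> R) :
  measurable U -> continuous f -> (forall x, f x <= 1) ->
  (forall x, ~ U x -> f x = 0) -> ((\int[mu]_x f x)%:E <= mu U)%E.
Proof.
move=> mU cf f1 f0; have -> : mu U = (\int[mu]_x \1_U x)%:E.
  by rewrite /Rintegral integral_indic // setIT fineK // fin_num_measure.
rewrite lee_fin; apply: le_Rintegral => //.
- exact: cont_integrable.
- exact: integrable_indic.
- move=> x _; rewrite indicE; case: (boolP (x \in U)) => [_|/negP xU].
    exact: f1.
  by rewrite f0 // => Ux; apply: xU; exact: mem_set.
Qed.

Hypothesis hK : hausdorff_space K.

Lemma closed_compact (C : set K) : closed C -> compact C.
Proof. by move=> clC; apply: (subclosed_compact _ cK). Qed.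

Lemma closed_measurable (C : set (borel K)) : @closed K C -> measurable C.
Proof.
move=> clC; rewrite -[C]setCK; apply: measurableC; apply: open_measurable.
exact: closed_openC.
Qed.

Lemma regular_inner mu (A : set (borel K)) (e : R) :
  regular_measure mu -> measurable A -> 0 < e ->
  exists C : set K, [/\ closed C, C `<=` A & (mu A <= mu C + e%:E)%E].
Proof.
move=> rmu mA e0; have [_ muA] := rmu A mA.
have fA : mu A \is a fin_num by exact: fin_num_measure.
rewrite muA in fA; have [_ [C [cC CA] <-] h] := ub_ereal_sup_adherent e0 fA.
exists C; split => //; first exact: compact_closed.
by rewrite muA -leeBlDr // ltW.
Qed.

Lemma regular_outer mu (A : set (borel K)) (e : R) :
  regular_measure mu -> measurable A -> 0 < e ->
  exists U : set K, [/\ open U, A `<=` U & (mu U <= mu A + e%:E)%E].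
Proof.
move=> rmu mA e0; have [muA _] := rmu A mA.
have fA : mu A \is a fin_num by exact: fin_num_measure.
rewrite muA in fA; have [_ [U [oU AU] <-] h] := lb_ereal_inf_adherent e0 fA.
by exists U; split => //; rewrite muA ltW.
Qed.

(** Between [C] and an open set of almost the same measure there is a Urysohn
    function, so the integrals of the continuous functions above the indicator
    of [C] come as close to [mu C] as desired. *)
Lemma closed_measure_ge mu (C : set K) (t q : R) : regular_measure mu ->
  closed C -> 0 <= t ->
  (forall f, nonneg_cont f -> (forall x, C x -> 1 <= f x) ->
    q <= t * \int[mu]_x f x) ->
  (q%:E <= t%:E * mu C)%E.
Proof.
move=> rmu clC t0 h; have mC := closed_measurable clC.
have fC := fin_num_measure mu _ mC; rewrite -(fineK fC) -EFinM lee_fin.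
apply/ler_addgt0Pr => e e0.
have [d d0 td] := small_multiple t0 e0.
have [U [oU CU muU]] := regular_outer rmu mC d0.
have [|||f [nf f1 fU fC1]] := @compact_urysohn R K hK cK (~` U) C.
- exact: open_closedC.
- exact: clC.
- by move=> x nUx Cx; exact: nUx (CU x Cx).
have fC1' x : C x -> 1 <= f x by move=> /fC1 ->.
apply: (le_trans (h f nf fC1')); rewrite -lerBlDl -mulrBr.
have mU := open_measurable oU.
have : \int[mu]_x f x <= fine (mu C) + d.
  rewrite -lee_fin EFinD (fineK fC); apply: le_trans muU.
  by apply: integral_le_measure => //; case: nf.
rewrite -lerBlDl => /(ler_wpM2l t0) /le_trans; apply.
exact: ltW.
Qed.
End ContinuousMaps.

Section UniquelyErgodic.
Variables (R : realType) (G : semitopologicalSemigroupType) (K : ptopologicalType).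
Variables (a : semigroup_action G K) (mu : probability (borel K) R).
Hypotheses (hK : hausdorff_space K) (cK : compact [set: K]).
Hypothesis ue : uniquely_ergodic a mu.

Lemma act_cont_measurable g : measurable_fun [set: borel K] (a g : borel K -> borel K).
Proof. by apply: cont_borel_measurable; exact: act_contr. Qed.

Lemma act_preimage_measurable g (A : set (borel K)) :
  measurable A -> measurable (a g @^-1` A : set (borel K)).
Proof. by apply: cont_preimage_measurable; exact: act_contr. Qed.

Lemma comp_act_nonneg_cont (f : K -> R) g :
  nonneg_cont f -> nonneg_cont (fun x => f (a g x)).
Proof.
move=> [cf f0]; split => // x; apply: (@continuous_comp _ _ _ (a g) f).
  exact: act_contr.
exact: cf.
Qed.

(** Under the representing measure [P], a closed set dominates its preimage
    because [1_C <= f] gives [1_C \o g <= f \o g]; by inner regularity the same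
    holds for every Borel set, and passing to complements turns it into an
    equality. *)
Lemma invariant_of_functional (P : probability (borel K) R) :
  regular_measure P ->
  (forall g f, nonneg_cont f -> \int[P]_x f (a g x) = \int[P]_x f x) ->
  invariant_measure a P.
Proof.
move=> rP invP.
have fP (A : set (borel K)) : measurable A -> P A \is a fin_num.
  exact: fin_num_measure.
have clo g (C : set K) : closed C -> (P (a g @^-1` C) <= P C)%E.
  move=> clC; have mC := closed_measurable clC.
  have mgC := act_preimage_measurable g mC.
  rewrite -(fineK (fP _ mgC)) -[P C]mul1e.
  apply: (closed_measure_ge cK hK) => // f nf f1; rewrite mul1r -(invP g) //.
  rewrite -lee_fin (fineK (fP _ mgC)); apply: measure_le_integral => //.
    exact: comp_act_nonneg_cont.
  by move=> x /f1.
have le g (A : set (borel K)) : measurable A -> (P (a g @^-1` A) <= P A)%E.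
  move=> mA; have mgA := act_preimage_measurable g mA.
  apply/lee_addgt0Pr => e e0.
  have [D [clD DA PD]] := regular_inner hK rP mgA e0.
  have cD : compact (a g @` D).
    apply: continuous_compact; last exact: closed_compact.
    by apply: continuous_subspaceT; exact: act_contr.
  have clgD : closed (a g @` D) by exact: compact_closed.
  have mD := closed_measurable clD; have mgD := closed_measurable clgD.
  apply: (le_trans PD); rewrite leeD2r //.
  apply: (@le_trans _ _ (P (a g @^-1` (a g @` D)))).
    apply: le_measure => [||x Dx]; [exact: mem_set| |by exists x].
    by apply: mem_set; exact: act_preimage_measurable.
  apply: (le_trans (clo g _ clgD)); apply: le_measure; [exact: mem_set..|].
  by move=> _ [x Dx <-]; exact: DA.
move=> A g mA; apply/eqP; rewrite eq_le le // andbT.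
have := le g (~` A) (measurableC mA); rewrite preimage_setC.
have mgA := act_preimage_measurable g mA.
rewrite !probability_setC //.
rewrite -(fineK (fP _ mA)) -(fineK (fP _ mgA)) -!EFinB !lee_fin; lra.
Qed.

(** Normalized to mass one, an invariant positive functional is represented by
    an invariant regular probability measure, and [mu] is the only one. *)
Theorem invariant_functional_integral (L : (K -> R) -> R) :
  positive_functional L ->
  (forall g f, nonneg_cont f -> L (fun x => f (a g x)) = L f) ->
  forall f, nonneg_cont f -> L f = L (fun=> 1) * \int[mu]_x f x.
Proof.
move=> posL invL f nf.
have one := one_nonneg_cont R K.
have [L10|L1n0] := eqVneq (L (fun=> 1)) 0.
  rewrite L10 mul0r; apply/eqP; rewrite eq_le pf_ge0 // andbT.
  have [cf f0] := nf; have [M fM] := cont_bounded cK cf.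
  have M0 : 0 <= M := le_trans (normr_ge0 _) (fM point).
  have nM := cst_nonneg_cont K M0.
  have -> : 0 = L (fun=> M) by rewrite (pf_cst posL) // L10 mulr0.
  by apply: pf_le => // x; exact: le_trans (ler_norm _) (fM x).
have L1p : 0 < L (fun=> 1) by rewrite lt0r L1n0 pf_ge0.
pose L' h := (L (fun=> 1))^-1 * L h.
have posL' : positive_functional L'.
  by apply: positive_functional_scale; rewrite // invr_ge0 ltW.
have L'1 : L' (fun=> 1) = 1 by rewrite /L' mulVf.
have [P rP LP] := riesz_markov hK cK posL' L'1.
have [_ _ uniq] := ue.
have iP : invariant_measure a P.
  apply: invariant_of_functional => // g h nh.
  by rewrite -!LP // /L' ?invL //; exact: comp_act_nonneg_cont.
have Pmu := uniq P rP iP.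
rewrite -[L f](mulVKf L1n0) -/(L' f) LP //; congr (_ * _).
congr fine; apply: eq_measure_integral => A mA _; exact: Pmu.
Qed.
End UniquelyErgodic.


(** * Bounded functionals on a complex normed space *)

Section RenormTopology.
Variables (R : realType) (E : normedModType R[i]).
Implicit Types v w : E.

Lemma complex_gt0 (e : R[i]) : 0 < e -> 0 < complex.Re e /\ e = (complex.Re e)%:C.
Proof. by case: e => x y; rewrite ltcE /= => /andP[/eqP -> ->]. Qed.

Lemma RenormN v : Renorm (- v) = Renorm v.
Proof. by rewrite /Renorm normrN. Qed.

Lemma RenormB v w : Renorm (v - w) = Renorm (w - v).
Proof. by rewrite -RenormN opprB. Qed.

Lemma Renorm_sub_le v w u : Renorm (v - u) <= Renorm (v - w) + Renorm (w - u).
Proof. by rewrite -[v - u](subrKA w) RenormD. Qed.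

Lemma Renorm_le_sub v w : Renorm v <= Renorm w + Renorm (v - w).
Proof. by rewrite -{1}[v](subrKC w) RenormD. Qed.

Lemma Renorm_real (t : R) : Renorm (t%:C : R[i]) = `|t|.
Proof. by rewrite /Renorm normc_def /= expr0n addr0 sqrtr_sqr. Qed.

Lemma Renorm_scale (t : R) v : 0 <= t -> Renorm (t%:C *: v) = t * Renorm v.
Proof. by move=> t0; rewrite RenormZ Renorm_real ger0_norm. Qed.

Lemma Renorm_sum n (F : 'I_n -> E) : Renorm (\sum_i F i) <= \sum_i Renorm (F i).
Proof.
elim/big_ind2: _ => [|u s v t us vt|//]; first by rewrite Renorm0.
by rewrite (le_trans (RenormD _ _)) // lerD.
Qed.

Lemma cvg_RenormP (T : Type) (F : set_system T) (FF : Filter F) (u : T -> E) l :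
  u @ F --> l <-> forall e : R, 0 < e -> \forall t \near F, Renorm (l - u t) < e.
Proof.
split=> [/cvgrPdist_lt h e e0|h].
  have := h e%:C; rewrite ltcR => /(_ e0); apply: filterS => t.
  by rewrite -RenormK ltcR.
apply/cvgrPdist_lt => e e0; have [re0 ->] := complex_gt0 e0.
by apply: filterS (h _ re0) => t; rewrite -RenormK ltcR.
Qed.

Lemma nbhs_RenormP v (A : set E) :
  nbhs v A <-> exists2 e : R, 0 < e & forall w, Renorm (v - w) < e -> A w.
Proof.
split=> [/nbhs_normP[e /= e0 eA]|[e e0 eA]].
  have [re0 ee] := complex_gt0 e0; exists (complex.Re e) => // w vw.
  by apply: eA; rewrite /ball_ /= -RenormK ee ltcR.
apply/nbhs_normP; exists e%:C => /=; first by rewrite ltcR.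
by move=> w; rewrite /ball_ /= -RenormK ltcR; exact: eA.
Qed.

Lemma Renorm_continuous : continuous (fun v => Renorm v : R).
Proof.
move=> v; apply/cvgrPdist_lt => e e0; apply/nbhs_RenormP; exists e => // w.
apply: le_lt_trans; rewrite ler_norml; apply/andP; split.
  have := Renorm_le_sub w v; rewrite RenormB; lra.
have := Renorm_le_sub v w; lra.
Qed.
End RenormTopology.

Lemma complex_of_real_continuous (R : realType) :
  continuous (fun t : R => t%:C : R[i]).
Proof.
move=> t; apply/(@cvg_RenormP R R[i]) => e e0.
have : \forall s \near t, `|t - s| < e by apply/nbhs_normP; exists e.
by apply: filterS => s; rewrite -rmorphB Renorm_real.
Qed.

Section Dual.
Variables (R : realType) (X : normedModType R[i]) (nu : X -> R[i]).
Hypothesis dnu : dual nu.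
Implicit Types f g : X.

Lemma dualD f g : nu (f + g) = nu f + nu g.
Proof. by have [lnu _] := dnu; have := lnu 1 f g; rewrite scale1r mul1r. Qed.

Lemma dual0 : nu 0 = 0.
Proof. by apply: (@addIr _ (nu 0)); rewrite -dualD !add0r. Qed.

Lemma dualZ (z : R[i]) f : nu (z *: f) = z * nu f.
Proof.
by have [lnu _] := dnu; have := lnu z f 0; rewrite dual0 !addr0.
Qed.

Lemma dualN f : nu (- f) = - nu f.
Proof. by rewrite -scaleN1r dualZ mulN1r. Qed.

Lemma dualB f g : nu (f - g) = nu f - nu g.
Proof. by rewrite dualD dualN. Qed.

Lemma dual_sum n (F : 'I_n -> X) : nu (\sum_i F i) = \sum_i nu (F i).
Proof. exact: (big_morph _ dualD dual0). Qed.

Lemma dual_bounded : exists2 B : R, 0 <= B &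
  forall f, Renorm (nu f) <= B * Renorm f.
Proof.
have [_ /(_ 0)/(@cvg_RenormP R R[i])/(_ 1 ltr01)] := dnu.
rewrite dual0 => /nbhs_RenormP[e e0 he].
exists (2 / e); first by rewrite divr_ge0 ?ltW.
move=> f; have [f0|fn0] := eqVneq (Renorm f) 0.
  by rewrite (Renorm_eq0 f0) dual0 !Renorm0 mulr0.
have fp : 0 < Renorm f by rewrite lt0r fn0 Renorm_ge0.
pose t := e / 2 / Renorm f.
have t0 : 0 < t by rewrite !divr_gt0.
have := he (t%:C *: f); rewrite !sub0r !RenormN dualZ Renorm_scale ?(ltW t0) //.
rewrite /t divfK // ltr_pdivrMr // ltr_pMr // ltr1n => /(_ isT).
rewrite -[_ * nu f]/(_ *: nu f : R[i]) Renorm_scale ?(ltW t0) // => /ltW.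
rewrite /t mulrAC ler_pdivrMr // mul1r -ler_pdivlMl ?divr_gt0 //.
by rewrite invf_div.
Qed.
End Dual.

Lemma dual_sub (R : realType) (X : normedModType R[i]) (nu1 nu2 : X -> R[i]) :
  dual nu1 -> dual nu2 -> dual (fun f => nu1 f - nu2 f).
Proof.
move=> d1 d2; split=> [z f k|f].
  by rewrite !(dualD d1) !(dualD d2) !(dualZ d1) !(dualZ d2); ring.
have [_ c1] := d1; have [_ c2] := d2.
by apply: (@cvgB _ R[i]); [exact: c1|exact: c2].
Qed.

Section RealPart.
Variable R : realType.
Implicit Types z : R[i].

Lemma Re_le_Renorm z : complex.Re z <= Renorm z.
Proof.
rewrite /Renorm normc_def /=; apply: le_trans (ler_norm _) _.
by rewrite -sqrtr_sqr ler_wsqrtr // lerDl sqr_ge0.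
Qed.

Lemma unit_rotation z : exists2 u : R[i], Renorm u = 1 &
  u * z = (Renorm z)%:C.
Proof.
have [->|zn0] := eqVneq z 0.
  by exists 1; rewrite ?mulr0 ?Renorm0 // /Renorm normr1.
have nz0 : `|z| != 0 by rewrite normr_eq0.
exists (`|z| / z).
  by rewrite /Renorm normf_div normr_id divff.
by rewrite divfK // RenormK.
Qed.
End RealPart.


(** * The total variation of a functional on vector-valued functions *)

Section VectorFunctions.
Variables (R : realType) (K : ptopologicalType) (N : nat).
Local Notation E := (euclidean R N).
Local Notation X := (bcfun K E).
Hypothesis cK : compact [set: K].
Implicit Types (f g : X) (phi : K -> R).

Lemma Renorm_cont (f : K -> E) : continuous f -> continuous (fun x => Renorm (f x)).
Proof.
move=> cf x; apply: (@continuous_comp _ _ _ f (fun v : E => Renorm v)).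
  exact: cf.
exact: Renorm_continuous.
Qed.

Lemma Renorm_nonneg_cont f : nonneg_cont (fun x => Renorm (f x)).
Proof.
by split=> [|x]; [apply: Renorm_cont; exact: bcfun_cont|exact: Renorm_ge0].
Qed.

Lemma cont_bounded_continuous (f : K -> E) : continuous f ->
  f \in @bounded_continuous R K E.
Proof.
move=> cf; apply/asboolP; split=> //; apply/bounded_funE.
have [M fM] := cont_bounded cK (Renorm_cont cf); exists M => x.
exact: le_trans (ler_norm _) (fM x).
Qed.

Definition cont_bcfun (f : K -> E) (cf : continuous f) : X :=
  BCFun (cont_bounded_continuous cf).

Lemma real_scale_cont phi (f : K -> E) : continuous phi -> continuous f ->
  continuous (fun x => (phi x)%:C *: f x : E).
Proof.
move=> cphi cf; apply: euclidean_continuous => i x.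
have -> : (fun y => ((phi y)%:C *: f y : 'cV[R[i]]_N) i 0) =
    (fun y => (phi y)%:C * (f y : 'cV[R[i]]_N) i 0).
  by apply/funext => y; rewrite mxE.
apply: cvgM.
  apply: (@continuous_comp _ _ _ phi (fun t : R => t%:C : R[i])).
    exact: cphi.
  exact: complex_of_real_continuous.
apply: (@continuous_comp _ _ _ f (fun v : E => (v : 'cV[R[i]]_N) i 0)).
  exact: cf.
exact: euclidean_coord_continuous.
Qed.

Definition scale_bcfun phi (cphi : continuous phi) f : X :=
  cont_bcfun (real_scale_cont cphi (@bcfun_cont _ _ _ f)).

Lemma Renorm_supnorm f : Renorm f = supnorm f.
Proof. by rewrite /Renorm bcfun_normE. Qed.

Lemma bcfunDE f g x : (f + g) x = f x + g x. Proof. by []. Qed.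
Lemma bcfunBE f g x : (f - g) x = f x - g x. Proof. by []. Qed.
Lemma bcfunZE (z : R[i]) f x : (z *: f) x = z *: f x. Proof. by []. Qed.

Lemma bcfun_eqP f g : (forall x, f x = g x) -> f = g.
Proof. by move=> fg; apply/val_inj/funext. Qed.

Section TotalVariation.
Variable nu : X -> R[i].
Hypothesis dnu : dual nu.

Definition dominated phi f : Prop := forall x, Renorm (f x) <= phi x.

Definition total_variation phi : R :=
  sup [set complex.Re (nu f) | f in dominated phi].

Variable B : R.
Hypothesis nuB : forall f, Renorm (nu f) <= B * Renorm f.
Hypothesis B0 : 0 <= B.

Let dominated_le phi f (M : R) : 0 <= M -> (forall x, phi x <= M) ->
  dominated phi f -> complex.Re (nu f) <= B * M.
Proof.
move=> M0 phiM fphi; apply: le_trans (Re_le_Renorm _) _.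
apply: le_trans (nuB f) _; rewrite ler_wpM2l // Renorm_supnorm.
by apply: supnorm_le => // x; exact: le_trans (fphi x) (phiM x).
Qed.

Let dominated0 phi : nonneg_cont phi -> dominated phi 0.
Proof. by move=> [_ phi0] x; rewrite Renorm0. Qed.

Let ne phi : nonneg_cont phi ->
  [set complex.Re (nu f) | f in dominated phi] !=set0.
Proof. by move=> nphi; exists (complex.Re (nu 0)), 0 => //; exact: dominated0. Qed.

Let ub phi : nonneg_cont phi ->
  has_ubound [set complex.Re (nu f) | f in dominated phi].
Proof.
move=> [cphi phi0]; have [M phiM] := cont_bounded cK cphi.
exists (B * M) => _ [f fphi <-]; apply: (dominated_le _ _ fphi).
  exact: le_trans (normr_ge0 _) (phiM point).
by move=> x; exact: le_trans (ler_norm _) (phiM x).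
Qed.

Lemma le_total_variation phi f : nonneg_cont phi -> dominated phi f ->
  complex.Re (nu f) <= total_variation phi.
Proof. by move=> nphi fphi; apply: ub_le_sup; [exact: ub|exists f]. Qed.

Lemma total_variation_le phi (M : R) : nonneg_cont phi ->
  (forall f, dominated phi f -> complex.Re (nu f) <= M) ->
  total_variation phi <= M.
Proof. by move=> nphi h; apply: ge_sup; [exact: ne|move=> _ [f fphi <-]; exact: h]. Qed.

Lemma ReD (z w : R[i]) : complex.Re (z + w) = complex.Re z + complex.Re w.
Proof. by case: z; case: w. Qed.

Lemma Re_scale (t : R) (z : R[i]) : complex.Re (t%:C * z) = t * complex.Re z.
Proof. by case: z => x y /=; rewrite mul0r subr0. Qed.

(** For subadditivity [f] is split with weights [phi / (phi + psi + e)] and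
    [psi / (phi + psi + e)]; the constant [e] keeps the weights continuous where
    [phi + psi] vanishes, at the price of a remainder of norm at most [e]. *)
Lemma total_variation_additive phi psi : nonneg_cont phi -> nonneg_cont psi ->
  total_variation (fun x => phi x + psi x) =
  total_variation phi + total_variation psi.
Proof.
move=> nphi npsi; have [cphi phi0] := nphi; have [cpsi psi0] := npsi.
have nsum : nonneg_cont (fun x => phi x + psi x).
  by split=> [|x]; [exact: add_cont|rewrite addr_ge0].
apply/eqP; rewrite eq_le; apply/andP; split; last first.
  rewrite -lerBrDr; apply: total_variation_le => // f fphi.
  rewrite lerBrDr -lerBrDl; apply: total_variation_le => // g gpsi.
  rewrite lerBrDl -ReD -(dualD dnu); apply: le_total_variation => // x.
  by rewrite bcfunDE (le_trans (RenormD _ _)) // lerD.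
apply: total_variation_le => // f fs; apply/ler_addgt0Pr => e' e'0.
have [e e0 /ltW Be] := small_multiple B0 e'0.
pose s x := phi x + psi x + e.
have s0 x : 0 < s x by rewrite ltr_wpDl // addr_ge0.
have sn0 x : s x != 0 by rewrite gt_eqF.
have cs : continuous s.
  by apply: add_cont; [exact: add_cont|exact: cst_cont].
have csV : continuous (fun x => (s x)^-1).
  by move=> x; apply: cvgV; [exact: sn0|exact: cs].
have c1 : continuous (fun x => phi x * (s x)^-1) by exact: mul_cont.
have c2 : continuous (fun x => psi x * (s x)^-1) by exact: mul_cont.
pose f1 := scale_bcfun c1 f; pose f2 := scale_bcfun c2 f.
have f1E x : f1 x = (phi x * (s x)^-1)%:C *: f x by [].
have f2E x : f2 x = (psi x * (s x)^-1)%:C *: f x by [].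
have fle x : (s x)^-1 * Renorm (f x) <= 1.
  by rewrite ler_pdivrMl // mulr1 (le_trans (fs x)) // lerDl ltW.
have d1 : dominated phi f1.
  move=> x; rewrite f1E Renorm_scale ?mulr_ge0 ?invr_ge0 ?(ltW (s0 x)) //.
  by rewrite -mulrA ler_piMr.
have d2 : dominated psi f2.
  move=> x; rewrite f2E Renorm_scale ?mulr_ge0 ?invr_ge0 ?(ltW (s0 x)) //.
  by rewrite -mulrA ler_piMr.
have d3 : dominated (fun=> e) (f - (f1 + f2)).
  move=> x; rewrite bcfunBE bcfunDE f1E f2E -scalerDl -rmorphD /=.
  rewrite -[X in X - _]scale1r -scalerBl -[1](rmorph1 (real_complex R)) -rmorphB.
  have -> : 1 - (phi x / s x + psi x / s x) = e * (s x)^-1.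
    by rewrite -mulrDl -{1}(divff (sn0 x)) -mulrBl /s addrAC subrr add0r.
  rewrite Renorm_scale ?mulr_ge0 ?invr_ge0 ?(ltW (s0 x)) ?(ltW e0) //.
  by rewrite -mulrA ler_piMr // ltW.
have fE : f = f1 + f2 + (f - (f1 + f2)) by rewrite subrKC.
rewrite [nu f](congr1 nu fE) (dualD dnu) ReD lerD //; last first.
  by apply: le_trans Be; exact: (dominated_le (ltW e0) (fun=> lexx e) d3).
by rewrite (dualD dnu) ReD lerD //; exact: le_total_variation.
Qed.

Lemma total_variation0 : total_variation (fun=> 0) = 0.
Proof.
have n0 : nonneg_cont (fun _ : K => 0 : R) by exact: cst_nonneg_cont.
apply/eqP; rewrite eq_le; apply/andP; split.
  apply: total_variation_le => // f f0.
  rewrite (_ : f = 0) ?(dual0 dnu) //; apply: bcfun_eqP => x.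
  by apply: Renorm_eq0; apply/eqP; rewrite eq_le f0 Renorm_ge0.
by have := le_total_variation n0 (dominated0 n0); rewrite (dual0 dnu).
Qed.

Lemma total_variation_positive : positive_functional total_variation.
Proof.
have le (t : R) phi : 0 < t -> nonneg_cont phi ->
    t * total_variation phi <= total_variation (fun x => t * phi x).
  move=> t0 nphi; rewrite -ler_pdivlMl //; apply: total_variation_le => // f fphi.
  have ntphi : nonneg_cont (fun x => t * phi x).
    case: nphi => cphi phi0; split; first exact: scale_cont.
    by move=> x; rewrite mulr_ge0 // ltW.
  rewrite ler_pdivlMl // -Re_scale -(dualZ dnu); apply: le_total_variation => // x.
  by rewrite bcfunZE Renorm_scale ?(ltW t0) // ler_pM2l.
split=> [phi psi|t phi t0 nphi|phi nphi].
- exact: total_variation_additive.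
- have [->|tn0] := eqVneq t 0.
    rewrite mul0r -[RHS]total_variation0; congr total_variation.
    by apply/funext => x; rewrite mul0r.
  have tp : 0 < t by rewrite lt0r tn0.
  apply/eqP; rewrite eq_le le // andbT.
  have ntphi : nonneg_cont (fun x => t * phi x).
    case: nphi => cphi phi0; split; first exact: scale_cont.
    by move=> x; rewrite mulr_ge0.
  have := le t^-1 (fun x => t * phi x); rewrite invr_gt0 => /(_ tp ntphi).
  rewrite ler_pdivrMl //; congr (_ <= t * total_variation _).
  by apply/funext => x; rewrite mulKf.
- by have := le_total_variation nphi (dominated0 nphi); rewrite (dual0 dnu).
Qed.

(** A rotation makes [nu f] real and positive without changing the pointwise
    norm, so real parts suffice in the definition of the total variation. *)
Lemma Renorm_le_total_variation f :
  Renorm (nu f) <= total_variation (fun x => Renorm (f x)).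
Proof.
have [u u1 uf] := unit_rotation (nu f).
have -> : Renorm (nu f) = complex.Re (nu (u *: f)) by rewrite (dualZ dnu) uf.
apply: le_total_variation; first exact: Renorm_nonneg_cont.
by move=> x; rewrite bcfunZE RenormZ u1 mul1r.
Qed.

Lemma total_variation1 : total_variation (fun=> 1) <= B.
Proof.
apply: total_variation_le => [|f f1]; first exact: one_nonneg_cont.
by rewrite -[leRHS]mulr1; apply: (dominated_le _ _ f1).
Qed.
End TotalVariation.
End VectorFunctions.

Section InvariantFunctional.
Variables (R : realType) (G : semitopologicalSemigroupType) (K : ptopologicalType).
Variables (a : semigroup_action G K) (mu : probability (borel K) R).
Variables (N : nat) (c : cocycle R N a).
Hypotheses (hK : hausdorff_space K) (cK : compact [set: K]).
Hypothesis ue : uniquely_ergodic a mu.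
Local Notation X := (bcfun K (euclidean R N)).
Local Notation V := (cocycle_koopman c).

Lemma Renorm_unitary (U : 'M[R[i]]_N) (v : euclidean R N) :
  U \is unitarymx -> Renorm (U *m v : euclidean R N) = Renorm v.
Proof. by move=> Uu; rewrite /Renorm !euclidean_normE l2norm_unitary. Qed.

Lemma Renorm_cocycle_koopman g (f : X) x : Renorm (V g f x) = Renorm (f (a g x)).
Proof. by rewrite /= Renorm_unitary // cocycle_unitary. Qed.

(** The total variation of a fixed functional is dominated by its composition
    with each [a g], because [V g] maps the functions dominated by [phi] to
    functions dominated by [phi \o a g]; both have the same value at 1, so they
    agree, and unique ergodicity identifies the total variation with a multiple
    of the integral. *)
Theorem fixed_functional_L1_bound nu (B : R) : Fix_dual V nu -> 0 <= B ->
  (forall f : X, Renorm (nu f) <= B * Renorm f) ->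
  forall f : X, Renorm (nu f) <= B * \int[mu]_x Renorm (f x).
Proof.
move=> [dnu fixnu] B0 nuB f.
have posT := total_variation_positive cK dnu nuB B0.
have le g phi : nonneg_cont phi ->
    total_variation nu phi <= total_variation nu (fun x => phi (a g x)).
  move=> nphi; apply: total_variation_le => // h hphi.
  rewrite -[nu h](congr1 (@^~ h) (fixnu g)) /=.
  apply: (le_total_variation cK nuB B0); first exact: comp_act_nonneg_cont.
  by move=> x; rewrite Renorm_cocycle_koopman.
have inv g phi : nonneg_cont phi ->
    total_variation nu (fun x => phi (a g x)) = total_variation nu phi.
  move=> nphi; apply/eqP; rewrite eq_le le // andbT.
  have [cphi phi0] := nphi; have [M phiM] := cont_bounded cK cphi.
  have nM : nonneg_cont (fun x => M - phi x).
    split; first by apply: sub_cont => //; exact: cst_cont.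
    by move=> x; rewrite subr_ge0 (le_trans (ler_norm _)).
  have e1 := pf_add posT nM nphi.
  have e2 := pf_add posT (comp_act_nonneg_cont a g nM) (comp_act_nonneg_cont a g nphi).
  have e3 : total_variation nu (fun x => M - phi x + phi x) =
      total_variation nu (fun x => M - phi (a g x) + phi (a g x)).
    by congr total_variation; apply/funext => x; rewrite !subrK.
  have := le g _ nM; lra.
apply: (le_trans (Renorm_le_total_variation cK dnu nuB B0 f)).
rewrite (invariant_functional_integral hK cK ue posT inv); last first.
  exact: Renorm_nonneg_cont.
rewrite ler_wpM2r //; last exact: total_variation1.
by apply: Rintegral_ge0 => x _; exact: Renorm_ge0.
Qed.
End InvariantFunctional.


(** * Approximation in mean by continuous functions *)

Section Integrable.
Variables (R : realType) (K : ptopologicalType) (mu : probability (borel K) R).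
Implicit Types f g : K -> R.

Definition intg f : Prop := mu.-integrable [set: borel K] (EFin \o f).

Lemma intg_measurable f : intg f -> measurable_fun [set: borel K] f.
Proof. by move=> /integrableP[/measurable_EFinP]. Qed.

Lemma intg_add f g : intg f -> intg g -> intg (fun x => f x + g x).
Proof. by move=> fi gi; exact: (integrableD measurableT fi gi). Qed.

Lemma intg_sub f g : intg f -> intg g -> intg (fun x => f x - g x).
Proof. by move=> fi gi; exact: (integrableB measurableT fi gi). Qed.

Lemma intg_scale (t : R) f : intg f -> intg (fun x => t * f x).
Proof. by move=> fi; exact: (integrableZl measurableT t fi). Qed.

Lemma intg_norm f : intg f -> intg (fun x => `|f x|).
Proof. by move=> fi; exact: (integrable_norm fi). Qed.

Lemma intg_dist f g : intg f -> intg g -> intg (fun x => `|f x - g x|).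
Proof. by move=> fi gi; apply/intg_norm/intg_sub. Qed.

Lemma intg_le f g : measurable_fun [set: borel K] f ->
  (forall x, `|f x| <= g x) -> intg g -> intg f.
Proof.
move=> mf fg gi; apply: (le_integrable measurableT _ _ gi).
  exact/measurable_EFinP.
move=> x _; rewrite /= lee_fin [leRHS]ger0_norm; first exact: fg.
exact: le_trans (normr_ge0 _) (fg x).
Qed.

Lemma intg_sum n (F : 'I_n -> K -> R) : (forall i, intg (F i)) ->
  intg (fun x => \sum_i F i x).
Proof.
elim: n F => [|n IHn] F iF.
  rewrite /intg (_ : _ \o _ = cst 0%E); first exact: integrable0.
  by apply/funext => x; rewrite /= big_ord0.
rewrite (_ : (fun x => _) = fun x => F ord0 x + \sum_(i < n) F (lift ord0 i) x).
  by apply: intg_add => //; exact: IHn.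
by apply/funext => x; rewrite big_ord_recl.
Qed.

Lemma Rintegral_sum n (F : 'I_n -> K -> R) : (forall i, intg (F i)) ->
  \int[mu]_x (\sum_i F i x) = \sum_i \int[mu]_x F i x.
Proof.
elim: n F => [|n IHn] F iF.
  rewrite big_ord0 (_ : (fun x => _) = fun=> 0) ?Rintegral_cst ?mul0r //.
  by apply/funext => x; rewrite big_ord0.
rewrite (_ : (fun x => _) = fun x => F ord0 x + \sum_(i < n) F (lift ord0 i) x).
  have iS : intg (fun x => \sum_(i < n) F (lift ord0 i) x).
    by apply: intg_sum => i; exact: iF.
  rewrite (RintegralD measurableT (iF ord0) iS) big_ord_recl.
  by rewrite IHn // => i; exact: iF.
by apply/funext => x; rewrite big_ord_recl.
Qed.

Lemma Rintegral_le f g : intg f -> intg g -> (forall x, f x <= g x) ->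
  \int[mu]_x f x <= \int[mu]_x g x.
Proof. by move=> fi gi fg; apply: le_Rintegral. Qed.
End Integrable.

Import HBSimple.

Section Density.
Variables (R : realType) (K : ptopologicalType) (mu : probability (borel K) R).
Hypotheses (hK : hausdorff_space K) (cK : compact [set: K]).
Hypothesis rmu : regular_measure mu.
Implicit Types f g phi : K -> R.

Definition approximable f : Prop := intg mu f /\ forall e : R, 0 < e ->
  exists2 phi, continuous phi & \int[mu]_x `|f x - phi x| <= e.

Lemma approximable_add f g : approximable f -> approximable g ->
  approximable (fun x => f x + g x).
Proof.
move=> [fi fa] [gi ga]; split; first exact: intg_add.
move=> e e0; have e2 : 0 < e / 2 by rewrite divr_gt0.
have [phi cphi fphi] := fa _ e2; have [psi cpsi gpsi] := ga _ e2.
have iphi : intg mu phi := cont_integrable cK mu cphi.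
have ipsi : intg mu psi := cont_integrable cK mu cpsi.
exists (fun x => phi x + psi x); first exact: add_cont.
apply: (@le_trans _ _ (\int[mu]_x (`|f x - phi x| + `|g x - psi x|))).
  apply: Rintegral_le => [||x].
  - by apply: intg_dist; apply: intg_add.
  - by apply: intg_add; apply: intg_dist.
  - by rewrite opprD addrACA ler_normD.
rewrite RintegralD //; try exact: intg_dist.
by rewrite [leRHS](splitr e) lerD.
Qed.

Lemma approximable_scale (t : R) f : approximable f ->
  approximable (fun x => t * f x).
Proof.
move=> [fi fa]; split; first exact: intg_scale.
move=> e e0; have [d d0 td] := small_multiple (normr_ge0 t) e0.
have [phi cphi fphi] := fa d d0.
have iphi : intg mu phi := cont_integrable cK mu cphi.
exists (fun x => t * phi x); first exact: scale_cont.
under eq_Rintegral do rewrite -mulrBr normrM.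
rewrite RintegralZl //; last exact: intg_dist.
exact: le_trans (ler_wpM2l (normr_ge0 t) fphi) (ltW td).
Qed.

(** Regularity encloses a Borel set between a closed and an open set of almost
    the same measure, and a Urysohn function lies between their indicators. *)
Lemma approximable_indic (A : set (borel K)) : measurable A ->
  approximable (\1_A : K -> R).
Proof.
move=> mA; split; first exact: integrable_indic.
move=> e e0; have e2 : 0 < e / 2 by rewrite divr_gt0.
have [C [clC CA muC]] := regular_inner hK rmu mA e2.
have [U [oU AU muU]] := regular_outer rmu mA e2.
have mC := closed_measurable clC; have mU := open_measurable oU.
have [|||phi [[cphi phi0] phi1 phiU phiC]] := @compact_urysohn R K hK cK (~` U) C.
- exact: open_closedC.
- exact: clC.
- by move=> x nUx /CA /AU.
exists phi => //; have iphi : intg mu phi := cont_integrable cK mu cphi.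
have iA := integrable_indic mu mA; have iC := integrable_indic mu mC.
have iU := integrable_indic mu mU.
apply: (@le_trans _ _ (\int[mu]_x (\1_U x - \1_C x))).
  apply: Rintegral_le => [||x]; [exact: intg_dist|exact: intg_sub|].
  rewrite !indicE; have [xC|xC] := boolP (x \in C).
    have Cx := set_mem xC; have Ax := CA x Cx.
    by rewrite (mem_set Ax) (mem_set (AU x Ax)) phiC // subrr normr0.
  have [xU|/negP xU] := boolP (x \in U).
    rewrite subr0; have := phi0 x; have := phi1 x.
    by case: (x \in A) => /= ? ?; rewrite ler_norml; apply/andP; split; lra.
  rewrite phiU; last by move=> Ux; apply: xU; exact: mem_set.
  rewrite (_ : x \in A = false) ?subrr ?normr0 //.
  by apply/negP => /set_mem /AU Ux; apply: xU; exact: mem_set.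
rewrite RintegralB // /Rintegral !integral_indic // !setIT.
have fU := fin_num_measure mu _ mU; have fC := fin_num_measure mu _ mC.
have fA := fin_num_measure mu _ mA.
move: muU muC; rewrite -(fineK fU) -(fineK fC) -(fineK fA) -!EFinD !lee_fin /=.
lra.
Qed.

Lemma sfun_approximable (h : {sfun (borel K) >-> R}) :
  approximable (fun x => h x).
Proof.
have -> : (fun x : K => h x) = fun x =>
    \sum_(y <- fset_set (range h)) y * \1_(h @^-1` [set y]) x.
  by apply/funext => x; rewrite {1}fimfunE fsbig_finite.
elim: (finmap.enum_fset _) => [|y s IHs].
  rewrite (_ : (fun x => _) = fun x => 0 * \1_set0 x).
    exact/approximable_scale/approximable_indic.
  by apply/funext => x; rewrite big_nil mul0r.
rewrite (_ : (fun x => _) = fun x => y * \1_(h @^-1` [set y]) x +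
   \sum_(z <- s) z * \1_(h @^-1` [set z]) x); last first.
  by apply/funext => x; rewrite big_cons.
apply: approximable_add => //; apply: approximable_scale.
exact: approximable_indic.
Qed.

Theorem cont_dense_L1 f (e : R) : intg mu f -> 0 < e ->
  exists2 phi, continuous phi & \int[mu]_x `|f x - phi x| <= e.
Proof.
move=> fi e0; have e2 : 0 < e / 2 by rewrite divr_gt0.
have [g_ [ig _ gf]] := approximation_sfun_integrable measurableT fi.
have [n gn] : exists n, \int[mu]_x `|f x - g_ n x| <= e / 2.
  move/fine_cvgP : gf => [_ /cvgrPdist_le/(_ _ e2)[n _ /(_ n (leqnn n))]].
  rewrite /= sub0r normrN => h; exists n; apply: le_trans h.
  exact: ler_norm.
have ign : intg mu (fun x => g_ n x) := ig n.
have [phi cphi gphi] := (sfun_approximable (g_ n)).2 _ e2.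
have iphi : intg mu phi := cont_integrable cK mu cphi.
exists phi => //.
apply: (@le_trans _ _ (\int[mu]_x (`|f x - g_ n x| + `|g_ n x - phi x|))).
  apply: Rintegral_le => [||x]; first exact: intg_dist.
  - by apply: intg_add; apply: intg_dist.
  - exact: ler_distD.
rewrite RintegralD //; try exact: intg_dist.
by rewrite [leRHS](splitr e) lerD.
Qed.
End Density.


(** * Densities of functionals that are bounded in mean *)

Section ScalarDensity.
Variables (R : realType) (K : ptopologicalType) (mu : probability (borel K) R).
Hypotheses (hK : hausdorff_space K) (cK : compact [set: K]).
Hypothesis rmu : regular_measure mu.

(** An inequality between integrals of continuous functions passes to closed
    sets by [closed_measure_ge] and to Borel sets by inner regularity. *)
Lemma regular_measure_le (P : probability (borel K) R) (t : R) :
  regular_measure P -> 0 <= t ->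
  (forall f, nonneg_cont f -> \int[P]_x f x <= t * \int[mu]_x f x) ->
  forall A : set (borel K), measurable A -> (P A <= t%:E * mu A)%E.
Proof.
move=> rP t0 Pmu A mA; apply/lee_addgt0Pr => e e0.
have [C [clC CA PC]] := regular_inner hK rP mA e0.
have mC := closed_measurable clC.
apply: (le_trans PC); rewrite leeD2r //.
apply: (@le_trans _ _ (t%:E * mu C)%E); last first.
  by apply: lee_wpmul2l; rewrite ?lee_fin //; apply: le_measure; [exact: mem_set..|].
have fC := fin_num_measure P _ mC; rewrite -(fineK fC).
apply: (closed_measure_ge cK hK) => // f nf f1; apply: le_trans (Pmu f nf).
by rewrite -lee_fin (fineK fC); apply: measure_le_integral.
Qed.

(** The Radon-Nikodym derivative is at most [t] almost everywhere; truncating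
    it makes it bounded everywhere. *)
Lemma bounded_density (P : probability (borel K) R) (t : R) : 0 <= t ->
  (forall A : set (borel K), measurable A -> (P A <= t%:E * mu A)%E) ->
  exists k : K -> R, [/\ measurable_fun [set: borel K] k,
    forall x, 0 <= k x <= t &
    forall f, continuous f -> \int[P]_x f x = \int[mu]_x (f x * k x)].
Proof.
move=> t0 Pmu.
have dom : P `<< mu.
  apply/null_content_dominatesP => A mA muA0; apply/eqP.
  by rewrite eq_le measure_ge0 andbT (le_trans (Pmu A mA)) // muA0 mule0.
pose k := Radon_Nikodym (charge_of_finite_measure P) mu.
have kfin x : k x \is a fin_num by exact: Radon_Nikodym_fin_num.
have ik : mu.-integrable [set: borel K] k by exact: Radon_Nikodym_integrable.
have kint (A : set (borel K)) : measurable A -> P A = (\int[mu]_(x in A) k x)%E.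
  by move=> mA; rewrite -Radon_Nikodym_integral.
pose r x := fine (k x); have kE x : k x = (r x)%:E by rewrite fineK.
have mk : measurable_fun [set: borel K] k by exact: measurable_int ik.
have mr : measurable_fun [set: borel K] r by exact: measurableT_comp.
have mr1 (s : R) : measurable ([set x | s < r x] : set (borel K)).
  have := mr measurableT `]s, +oo[%classic (measurable_itv _).
  rewrite setTI (_ : _ @^-1` _ = [set x | s < r x]) //.
  by apply/seteqP; split => x /=; rewrite in_itv /= andbT.
have mr2 (s : R) : measurable ([set x | r x < s] : set (borel K)).
  have := mr measurableT `]-oo, s[%classic (measurable_itv _).
  by rewrite setTI (_ : _ @^-1` _ = [set x | r x < s]).
have up : {ae mu, forall x, r x <= t}.
  pose A : set (borel K) := [set x | t < r x]; have mA : measurable A by exact: mr1.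
  have mkt : measurable_fun A (fun x => k x - t%:E)%E.
    apply: emeasurable_funB; first exact: measurable_funTS.
    exact: measurable_cst.
  have ikA : mu.-integrable A k by exact: integrableS ik.
  have itA : mu.-integrable A (cst t%:E).
    by apply: finite_measure_integrable_cst.
  have : (\int[mu]_(x in A) `|k x - t%:E|)%E = 0%E.
    rewrite (eq_integral (fun x => k x - t%:E)%E); last first.
      move=> x /set_mem Ax; rewrite gee0_abs // kE -EFinB lee_fin subr_ge0.
      exact: ltW.
    apply/eqP; rewrite eq_le; apply/andP; split; last first.
      apply: integral_ge0 => x Ax; rewrite kE -EFinB lee_fin subr_ge0.
      exact: ltW.
    rewrite integralB // -kint // integral_cst // sube_le0.
    exact: Pmu.
  move/(ae_eq_integral_abs mu mA mkt); apply: filterS => x /= h.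
  rewrite leNgt; apply/negP => Ax; have := h Ax; rewrite kE -EFinB => -[].
  by move/eqP; rewrite subr_eq0 gt_eqF.
have lo : {ae mu, forall x, 0 <= r x}.
  pose A : set (borel K) := [set x | r x < 0]; have mA : measurable A by exact: mr2.
  have mkA : measurable_fun A k by exact: measurable_funTS.
  have : (\int[mu]_(x in A) `|k x|)%E = 0%E.
    rewrite (eq_integral (fun x => - k x)%E); last first.
      by move=> x /set_mem Ax; rewrite lee0_abs // kE lee_fin ltW.
    apply/eqP; rewrite eq_le; apply/andP; split; last first.
      by apply: integral_ge0 => x Ax; rewrite kE -EFinN lee_fin oppr_ge0 ltW.
    rewrite integralN; last first.
      have ikA : mu.-integrable A k by exact: integrableS ik.
      exact: integrable_add_def.
    by rewrite -kint // oppe_le0 measure_ge0.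
  move/(ae_eq_integral_abs mu mA mkA); apply: filterS => x /= h.
  rewrite leNgt; apply/negP => Ax; have := h Ax; rewrite kE => -[] r0.
  by move: Ax; rewrite /A /= r0 ltxx.
exists (fun x => Num.max 0 (Num.min (r x) t)).
have mk' : measurable_fun [set: borel K] (fun x => Num.max 0 (Num.min (r x) t)).
  by apply: measurable_maxr => //; apply: measurable_minr.
split=> // [x|f cf]; first by rewrite le_max lexx ge_max t0 /= ge_min lexx orbT.
have iPf := cont_integrable cK P cf.
have mf := cont_measurable cf.
rewrite /Rintegral -(Radon_Nikodym_change_of_variables dom measurableT iPf).
congr fine; apply: ae_eq_integral => //.
- by apply: emeasurable_funM => //; exact/measurable_EFinP.
- by apply/measurable_EFinP; exact: measurable_funM.
apply: filterS2 up lo => x rt r0 _ /=; rewrite -/k kE -EFinM.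
by rewrite min_l // max_r.
Qed.

Variables (lam : (K -> R) -> R) (B : R).
Hypothesis B0 : 0 <= B.
Hypothesis lamD : forall f g, continuous f -> continuous g ->
  lam (fun x => f x + g x) = lam f + lam g.
Hypothesis lamZ : forall (t : R) f, 0 <= t -> continuous f ->
  lam (fun x => t * f x) = t * lam f.
Hypothesis lam_le : forall f, continuous f -> `|lam f| <= B * \int[mu]_x `|f x|.

(** Adding [B + 1] times the integral turns the functional into a positive one
    of positive mass, to which the representation theorem applies. *)
Theorem L1_functional_density : exists h : K -> R,
  [/\ measurable_fun [set: borel K] h, exists M : R, forall x, `|h x| <= M &
  forall f, continuous f -> lam f = \int[mu]_x (f x * h x)].
Proof.
have posI := Rintegral_positive cK mu.
pose L (f : K -> R) := (B + 1) * \int[mu]_x f x + lam f.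
have lam_nonneg f : nonneg_cont f -> `|lam f| <= B * \int[mu]_x f x.
  move=> [cf f0]; apply: (le_trans (lam_le cf)).
  rewrite [leLHS](_ : _ = B * \int[mu]_x f x) //; congr (_ * _).
  by apply: eq_Rintegral => x _; rewrite ger0_norm.
have L_ge f : nonneg_cont f -> \int[mu]_x f x <= L f.
  move=> nf; have := lam_nonneg f nf; rewrite ler_norml /L => /andP[]; lra.
have L_le f : nonneg_cont f -> L f <= (2 * B + 1) * \int[mu]_x f x.
  move=> nf; have := lam_nonneg f nf; rewrite ler_norml /L => /andP[]; lra.
have posL : positive_functional L.
  split=> [f g nf ng|s f s0 nf|f nf].
  - rewrite /L (pf_add posI) // lamD; [ring|by case: nf|by case: ng].
  - by rewrite /L (pf_scale posI) // lamZ //; [ring|case: nf].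
  - by apply: le_trans (L_ge f nf); exact: (pf_ge0 posI).
have one := one_nonneg_cont R K.
pose m := L (fun=> 1).
have m1 : 1 <= m by rewrite -(Rintegral_one mu); exact: L_ge.
have m0 : 0 < m by exact: lt_le_trans m1.
have mn0 : m != 0 by rewrite gt_eqF.
pose L' (f : K -> R) := m^-1 * L f.
have posL' : positive_functional L'.
  by apply: positive_functional_scale; rewrite // invr_ge0 ltW.
have L'1 : L' (fun=> 1) = 1 by rewrite /L' mulVf.
have [P rP LP] := riesz_markov hK cK posL' L'1.
pose t := m^-1 * (2 * B + 1).
have t0 : 0 <= t.
  by rewrite mulr_ge0 ?invr_ge0 ?(ltW m0) // addr_ge0 // mulr_ge0.
have Pt f : nonneg_cont f -> \int[P]_x f x <= t * \int[mu]_x f x.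
  move=> nf; rewrite -LP // /L' /t -mulrA ler_wpM2l ?L_le // invr_ge0.
  exact: ltW.
have [k [mk kt Pk]] := bounded_density t0 (regular_measure_le rP t0 Pt).
have ik : intg mu k.
  apply: (@bounded_integrable _ _ _ _ t) => // x.
  by have /andP[k0 k1] := kt x; rewrite ger0_norm.
have ifk (f : K -> R) : continuous f -> intg mu (fun x => f x * k x).
  move=> cf; have [M fM] := cont_bounded cK cf.
  apply: (@bounded_integrable _ _ _ _ (M * t)).
    by apply: measurable_funM => //; exact: cont_measurable.
  move=> x; have /andP[k0 k1] := kt x; rewrite normrM (ger0_norm k0).
  exact: ler_pM.
pose h x := m * k x - (B + 1).
have mh : measurable_fun [set: borel K] h.
  apply: measurable_funB; last exact: measurable_cst.
  by apply: measurable_funM; [exact: measurable_cst|].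
have hM x : `|h x| <= m * t + (B + 1).
  have /andP[k0 k1] := kt x; apply: (le_trans (ler_normB _ _)).
  rewrite (@ger0_norm _ (B + 1)) ?addr_ge0 // lerD2r ger0_norm.
    by rewrite ler_pM2l.
  by rewrite mulr_ge0 // ltW.
have ifh (f : K -> R) : continuous f -> intg mu (fun x => f x * h x).
  move=> cf; have [M fM] := cont_bounded cK cf.
  apply: (@bounded_integrable _ _ _ _ (M * (m * t + (B + 1)))).
    by apply: measurable_funM => //; exact: cont_measurable.
  by move=> x; rewrite normrM; apply: ler_pM.
have rep (f : K -> R) : nonneg_cont f -> lam f = \int[mu]_x (f x * h x).
  move=> nf; have [cf f0] := nf.
  have -> : lam f = m * L' f - (B + 1) * \int[mu]_x f x.
    by rewrite /L' mulVKf // /L addrAC subrr add0r.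
  rewrite LP // Pk // -!RintegralZl //; last 2 first.
  - exact: cont_integrable.
  - exact: ifk.
  rewrite -RintegralB //; last 2 first.
  - by apply: (intg_scale m); exact: ifk.
  - by apply: (intg_scale (B + 1)); exact: cont_integrable.
  by apply: eq_Rintegral => x _; rewrite /h; ring.
exists h; split=> //; first by exists (m * t + (B + 1)).
move=> f cf.
have np := cut_nonneg_cont 0 cf.
have cN : continuous (fun x => -1 * f x) by exact: scale_cont.
have nn := cut_nonneg_cont 0 cN.
have fE x : f x + cutoff 0 (fun x => -1 * f x) x = cutoff 0 f x.
  rewrite /cutoff !subr0 mulN1r; have [f0|/ltW f0] := leP 0 (f x).
    by rewrite max_r ?oppr_le0 // addr0.
  by rewrite max_l ?oppr_ge0 // subrr.
have : lam f = lam (cutoff 0 f) - lam (cutoff 0 (fun x => -1 * f x)).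
  apply/eqP; rewrite eq_sym subr_eq -lamD //; last by case: nn.
  by apply/eqP; congr lam; apply/funext => x; rewrite fE.
move=> ->; rewrite (rep _ np) (rep _ nn) -RintegralB //; last 2 first.
- by apply: ifh; case: np.
- by apply: ifh; case: nn.
by apply: eq_Rintegral => x _; rewrite -fE -mulrBl addrK.
Qed.
End ScalarDensity.


(** * Integrable vector functions *)

Section RealDot.
Variables (R : realType) (N : nat).
Local Notation E := (euclidean R N).
Implicit Types (v w u : E) (z : R[i]).

Lemma Renorm_sqr z : Renorm z ^+ 2 = complex.Re z ^+ 2 + complex.Im z ^+ 2.
Proof.
rewrite /Renorm normc_def /= sqr_sqrtr //.
by rewrite addr_ge0 // sqr_ge0.
Qed.

Lemma abs_Re_le z : `|complex.Re z| <= Renorm z.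
Proof.
rewrite -(@ler_pXn2r _ 2%N) ?nnegrE ?Renorm_ge0 //.
by rewrite real_normK ?num_real // Renorm_sqr lerDl sqr_ge0.
Qed.

Lemma abs_Im_le z : `|complex.Im z| <= Renorm z.
Proof.
rewrite -(@ler_pXn2r _ 2%N) ?nnegrE ?Renorm_ge0 //.
by rewrite real_normK ?num_real // Renorm_sqr lerDr sqr_ge0.
Qed.

Lemma Renorm_le_abs z : Renorm z <= `|complex.Re z| + `|complex.Im z|.
Proof.
rewrite -(@ler_pXn2r _ 2%N) ?nnegrE ?Renorm_ge0 ?addr_ge0 //.
rewrite sqrrD !real_normK ?num_real // Renorm_sqr -addrA lerD2l lerDr.
by rewrite mulrn_wge0 // mulr_ge0.
Qed.

(** The real part of the Hermitian inner product. *)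
Definition rdot v w : R :=
  \sum_i (complex.Re (v i 0) * complex.Re (w i 0) +
          complex.Im (v i 0) * complex.Im (w i 0)).

Lemma RenormE v : Renorm v = l2norm v. Proof. by []. Qed.

Lemma rdot_sqr v : rdot v v = Renorm v ^+ 2.
Proof.
rewrite RenormE l2norm_sqr; apply: eq_bigr => i _.
by rewrite Renorm_sqr !expr2.
Qed.

Lemma rdotDl v w u : rdot (v + w) u = rdot v u + rdot w u.
Proof.
rewrite /rdot -big_split /=; apply: eq_bigr => i _.
by rewrite mxE; case: (v i 0) => a b; case: (w i 0) => c d /=; ring.
Qed.

Lemma rdotNl v w : rdot (- v) w = - rdot v w.
Proof.
rewrite /rdot -sumrN; apply: eq_bigr => i _.
by rewrite mxE; case: (v i 0) => a b /=; ring.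
Qed.

Lemma rdotC v w : rdot v w = rdot w v.
Proof. by apply: eq_bigr => i _; ring. Qed.

Lemma rdotBl v w u : rdot (v - w) u = rdot v u - rdot w u.
Proof. by rewrite rdotDl rdotNl. Qed.

Lemma rdot_le v w : `|rdot v w| <= Renorm v * Renorm w.
Proof.
apply: (le_trans (ler_norm_sum _ _ _)).
apply: (@le_trans _ _ (\sum_i Renorm (v i 0) * Renorm (w i 0))).
  apply: ler_sum => i _.
  rewrite -(@ler_pXn2r _ 2%N) ?nnegrE ?mulr_ge0 ?Renorm_ge0 //.
  rewrite real_normK ?num_real // exprMn !Renorm_sqr -subr_ge0.
  set x := complex.Re (v i 0); set y := complex.Im (v i 0).
  set x' := complex.Re (w i 0); set y' := complex.Im (w i 0).
  rewrite (_ : _ - _ = (x * y' - y * x') ^+ 2) ?sqr_ge0 //; ring.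
have h0 : 0 <= \sum_i Renorm (v i 0) * Renorm (w i 0).
  by apply: sumr_ge0 => i _; rewrite mulr_ge0 ?Renorm_ge0.
rewrite -(@ler_pXn2r _ 2%N) ?nnegrE ?mulr_ge0 ?Renorm_ge0 //.
by rewrite exprMn !RenormE !l2norm_sqr cauchy_schwarz.
Qed.

Lemma Renorm_sqrB v w :
  Renorm (v - w) ^+ 2 = Renorm v ^+ 2 - rdot v w * 2 + Renorm w ^+ 2.
Proof.
rewrite -!rdot_sqr rdotBl ![rdot _ (v - w)]rdotC !rdotBl (rdotC w v); ring.
Qed.

Lemma coord_le_Renorm v i : Renorm (v i 0) <= Renorm v.
Proof. exact: coord_le_l2norm. Qed.

Lemma Renorm_le_coord v :
  Renorm v <= \sum_i (`|complex.Re (v i 0)| + `|complex.Im (v i 0)|).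
Proof.
apply: (le_trans (l2norm_le_sum v)); apply: ler_sum => i _.
exact: Renorm_le_abs.
Qed.

Lemma ReB (z w : R[i]) : complex.Re (z - w) = complex.Re z - complex.Re w.
Proof. by case: z; case: w. Qed.

Lemma ImB (z w : R[i]) : complex.Im (z - w) = complex.Im z - complex.Im w.
Proof. by case: z; case: w. Qed.
End RealDot.

Section ComplexContinuity.
Variables (R : realType) (K : ptopologicalType).

Lemma complex_pair_cont (p q : K -> R) : continuous p -> continuous q ->
  continuous (fun x => (p x +i* q x)%C : R[i]).
Proof.
move=> cp cq x; apply/(@cvg_RenormP R R[i]) => e e0.
have e2 : 0 < e / 2 by rewrite divr_gt0.
have /cvgrPdist_lt/(_ _ e2) hp := cp x; have /cvgrPdist_lt/(_ _ e2) hq := cq x.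
apply: filterS2 hp hq => y py qy.
rewrite (le_lt_trans (Renorm_le_abs _)) // ReB ImB /= [ltRHS](splitr e).
exact: ltrD.
Qed.

Lemma Re_continuous : continuous (fun z : R[i] => complex.Re z : R).
Proof.
move=> z; apply/(@cvgrPdist_lt _ _ _ (nbhs z)) => e e0.
apply/(@nbhs_RenormP R R[i]); exists e => // w; apply: le_lt_trans.
by rewrite -ReB abs_Re_le.
Qed.

Lemma Im_continuous : continuous (fun z : R[i] => complex.Im z : R).
Proof.
move=> z; apply/(@cvgrPdist_lt _ _ _ (nbhs z)) => e e0.
apply/(@nbhs_RenormP R R[i]); exists e => // w; apply: le_lt_trans.
by rewrite -ImB abs_Im_le.
Qed.

Lemma Re_comp_cont (T : topologicalType) (f : T -> R[i]) :
  continuous f -> continuous (fun x => complex.Re (f x)).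
Proof.
move=> cf x; apply: (@continuous_comp _ _ _ f (fun z : R[i] => complex.Re z : R)).
  exact: cf.
exact: Re_continuous.
Qed.

Lemma Im_comp_cont (T : topologicalType) (f : T -> R[i]) :
  continuous f -> continuous (fun x => complex.Im (f x)).
Proof.
move=> cf x; apply: (@continuous_comp _ _ _ f (fun z : R[i] => complex.Im z : R)).
  exact: cf.
exact: Im_continuous.
Qed.
End ComplexContinuity.

Section VectorMeasurable.
Variables (R : realType) (K : ptopologicalType) (N : nat).
Variable mu : probability (borel K) R.
Local Notation E := (euclidean R N).
Local Notation X := (bcfun K E).
Implicit Types f g : K -> E.

Definition mvec f : Prop :=
  (forall i, measurable_fun [set: borel K] (fun x => complex.Re (f x i 0))) /\
  (forall i, measurable_fun [set: borel K] (fun x => complex.Im (f x i 0))).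

Definition ivec f : Prop := mvec f /\ intg mu (fun x => Renorm (f x)).

Lemma mvec_rdot f g : mvec f -> mvec g ->
  measurable_fun [set: borel K] (fun x => rdot (f x) (g x)).
Proof.
move=> [mf1 mf2] [mg1 mg2]; rewrite /rdot; apply: measurable_sum => i.
by apply: measurable_funD; apply: measurable_funM.
Qed.

Lemma mvec_Renorm f : mvec f ->
  measurable_fun [set: borel K] (fun x => Renorm (f x)).
Proof.
move=> mf; have -> : (fun x => Renorm (f x)) = fun x => Num.sqrt (rdot (f x) (f x)).
  by apply/funext => x; rewrite rdot_sqr sqrtr_sqr ger0_norm ?Renorm_ge0.
apply: (@measurableT_comp _ _ _ _ _ _ (@Num.sqrt R)); last exact: mvec_rdot.
by apply: continuous_measurable_fun; exact: sqrt_continuous.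
Qed.

Lemma mvec_sub f g : mvec f -> mvec g -> mvec (fun x => f x - g x).
Proof.
move=> [mf1 mf2] [mg1 mg2]; split=> i.
- rewrite (_ : (fun x => _) = fun x =>
    complex.Re (f x i 0) - complex.Re (g x i 0)); first exact: measurable_funB.
  by apply/funext => x; rewrite !mxE ReB.
- rewrite (_ : (fun x => _) = fun x =>
    complex.Im (f x i 0) - complex.Im (g x i 0)); first exact: measurable_funB.
  by apply/funext => x; rewrite !mxE ImB.
Qed.

Lemma coord_cont (f : K -> E) i : continuous f ->
  continuous (fun x => (f x : 'cV[R[i]]_N) i 0).
Proof.
move=> cf x.
apply: (@continuous_comp _ _ _ f (fun v : E => (v : 'cV[R[i]]_N) i 0)).
  exact: cf.
exact: euclidean_coord_continuous.
Qed.

Lemma Re_coord_cont (f : X) i : continuous (fun x => complex.Re (f x i 0)).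
Proof. by apply: Re_comp_cont; apply: coord_cont; exact: bcfun_cont. Qed.

Lemma Im_coord_cont (f : X) i : continuous (fun x => complex.Im (f x i 0)).
Proof. by apply: Im_comp_cont; apply: coord_cont; exact: bcfun_cont. Qed.

Lemma mvec_cont f : continuous f -> mvec f.
Proof.
move=> cf; split=> i; apply: cont_measurable.
  by apply: Re_comp_cont; exact: coord_cont.
by apply: Im_comp_cont; exact: coord_cont.
Qed.

Lemma ivec_sub f g : ivec f -> ivec g -> ivec (fun x => f x - g x).
Proof.
move=> [mf fi] [mg gi]; split; first exact: mvec_sub.
apply: (intg_le _ _ (intg_add fi gi)); first by apply: mvec_Renorm; exact: mvec_sub.
move=> x; rewrite ger0_norm ?Renorm_ge0 // -[Renorm (g x)]RenormN.
exact: RenormD.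
Qed.

Lemma ivec_bounded f (M : R) : mvec f -> (forall x, Renorm (f x) <= M) -> ivec f.
Proof.
move=> mf fM; split=> //; apply: (@bounded_integrable _ _ _ _ M).
  exact: mvec_Renorm.
by move=> x; rewrite ger0_norm ?Renorm_ge0.
Qed.

Hypotheses (hK : hausdorff_space K) (cK : compact [set: K]).

Lemma ivec_cont f : continuous f -> ivec f.
Proof.
move=> cf; split; first exact: mvec_cont.
by apply: cont_integrable => //; exact: Renorm_cont.
Qed.

Lemma ivec_coord f i : ivec f -> intg mu (fun x => complex.Re (f x i 0)) /\
  intg mu (fun x => complex.Im (f x i 0)).
Proof.
move=> [[mf1 mf2] fi]; split.
  apply: (intg_le _ _ fi) => // x.
  exact: le_trans (abs_Re_le _) (coord_le_Renorm _ _).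
apply: (intg_le _ _ fi) => // x.
exact: le_trans (abs_Im_le _) (coord_le_Renorm _ _).
Qed.

Hypothesis rmu : regular_measure mu.

Theorem cont_dense_vec f (e : R) : ivec f -> 0 < e ->
  exists phi : X, \int[mu]_x Renorm (f x - phi x) <= e.
Proof.
move=> fi e0; have N0 : 0 <= 2 * N%:R :> R by rewrite mulr_ge0.
have [d d0 Nd] := small_multiple N0 e0.
have [p hp] : {p : 'I_N -> K -> R & forall i, continuous (p i) /\
    \int[mu]_x `|complex.Re (f x i 0) - p i x| <= d}.
  apply: (@choice _ _ (fun i h => continuous h /\
    \int[mu]_x `|complex.Re (f x i 0) - h x| <= d)) => i.
  have [h _] := ivec_coord i fi.
  by have [phi cphi hphi] := cont_dense_L1 hK cK rmu h d0; exists phi.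
have [q hq] : {q : 'I_N -> K -> R & forall i, continuous (q i) /\
    \int[mu]_x `|complex.Im (f x i 0) - q i x| <= d}.
  apply: (@choice _ _ (fun i h => continuous h /\
    \int[mu]_x `|complex.Im (f x i 0) - h x| <= d)) => i.
  have [_ h] := ivec_coord i fi.
  by have [phi cphi hphi] := cont_dense_L1 hK cK rmu h d0; exists phi.
pose phi x : E := \col_i (p i x +i* q i x)%C.
have cphi : continuous phi.
  apply: euclidean_continuous => i.
  rewrite (_ : (fun x => _) = fun x => (p i x +i* q i x)%C).
    by apply: complex_pair_cont; [case: (hp i)|case: (hq i)].
  by apply/funext => x; rewrite mxE.
exists (cont_bcfun cK cphi).
have iphi := ivec_cont cphi.
have ip i : intg mu (p i) by apply: cont_integrable => //; case: (hp i).
have iq i : intg mu (q i) by apply: cont_integrable => //; case: (hq i).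
have iF1 i : intg mu (fun x => `|complex.Re (f x i 0) - p i x|).
  by apply: intg_dist => //; case: (ivec_coord i fi).
have iF2 i : intg mu (fun x => `|complex.Im (f x i 0) - q i x|).
  by apply: intg_dist => //; case: (ivec_coord i fi).
pose F i x := `|complex.Re (f x i 0) - p i x| + `|complex.Im (f x i 0) - q i x|.
have iF i : intg mu (F i) by exact: intg_add.
apply: (@le_trans _ _ (\int[mu]_x (\sum_i F i x))).
  apply: Rintegral_le; first by case: (ivec_sub fi iphi).
    exact: intg_sum.
  move=> x; apply: (le_trans (Renorm_le_coord _)); apply: ler_sum => i _.
  by rewrite !mxE ReB ImB.
rewrite Rintegral_sum //.
apply: (@le_trans _ _ (\sum_(i < N) (d + d))).
  apply: ler_sum => i _; rewrite (RintegralD measurableT (iF1 i) (iF2 i)).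
  by apply: lerD; [case: (hp i)|case: (hq i)].
rewrite sumr_const card_ord -mulr_natl; apply: le_trans (ltW Nd).
by rewrite le_eqVlt; apply/orP; left; apply/eqP; ring.
Qed.
End VectorMeasurable.


(** * Fixed functionals have square-integrable fixed densities *)

Section VectorDensity.
Variables (R : realType) (K : ptopologicalType) (N : nat).
Variable mu : probability (borel K) R.
Hypotheses (hK : hausdorff_space K) (cK : compact [set: K]).
Hypothesis rmu : regular_measure mu.
Local Notation E := (euclidean R N).
Local Notation X := (bcfun K E).

(** A total function of [phi], so that [phi] ranges over plain functions as in
    [L1_functional_density]; the default value of [insubd] only concerns
    discontinuous [phi]. *)
Definition vlift (e : E) (phi : K -> R) : X :=
  locked (insubd (0 : X) (fun x => (phi x)%:C *: e : E)).

Lemma vliftE e (phi : K -> R) x : continuous phi -> vlift e phi x = (phi x)%:C *: e.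
Proof.
move=> cphi; rewrite /vlift -lock -[LHS]/(val (insubd _ _) x) insubdK //.
apply: cont_bounded_continuous => //; apply: (@real_scale_cont _ _ _ phi) => //.
exact: cst_continuous.
Qed.

Lemma bcfun_sumE n (F : 'I_n -> X) x : (\sum_i F i) x = \sum_i F i x.
Proof. by elim/big_ind2: _ => // f u g v <- <-. Qed.

Lemma bcfun_coord_decomposition (f : X) :
  f = \sum_j (vlift (delta_mx j 0) (fun x => complex.Re (f x j 0)) +
              vlift ('i%C *: delta_mx j 0) (fun x => complex.Im (f x j 0))).
Proof.
have cR := @Re_coord_cont R K N f; have cI := @Im_coord_cont R K N f.
apply: bcfun_eqP => x; rewrite bcfun_sumE.
have pw j : (vlift (delta_mx j 0) (fun x => complex.Re (f x j 0)) +
      vlift ('i%C *: delta_mx j 0) (fun x => complex.Im (f x j 0))) x =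
    (complex.Re (f x j 0))%:C *: delta_mx j 0 +
    (complex.Im (f x j 0))%:C *: ('i%C *: delta_mx j 0).
  rewrite -(vliftE (delta_mx j 0) x (cR j)).
  rewrite -(vliftE ('i%C *: delta_mx j 0) x (cI j)).
  exact: bcfunDE.
rewrite (eq_bigr _ (fun j _ => pw j)).
apply/matrixP => k o; rewrite (ord1 o) summxE (bigD1 k) //= big1 ?addr0; last first.
  by move=> j jk; rewrite !mxE eq_sym (negPf jk) /= !mulr0 addr0.
rewrite !mxE !eqxx /= mulr1; case: (f x k 0) => u v /=.
by apply/eqP; rewrite eq_complex /=; apply/andP; split; apply/eqP; ring.
Qed.

(** On each of the [2 N] real coordinate directions the functional has a scalar
    density, and these are the coordinates of [h]. *)
Theorem vector_density (nu : X -> R[i]) (B : R) : dual nu -> 0 <= B ->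
  (forall f : X, Renorm (nu f) <= B * \int[mu]_x Renorm (f x)) ->
  exists h : K -> E, [/\ mvec h, exists M : R, forall x, Renorm (h x) <= M &
    forall f : X, complex.Re (nu f) = \int[mu]_x rdot (f x) (h x)].
Proof.
move=> dnu B0 nuB.
have dens (e : E) : exists h : K -> R,
    [/\ measurable_fun [set: borel K] h, exists M : R, forall x, `|h x| <= M &
    forall phi, continuous phi ->
      complex.Re (nu (vlift e phi)) = \int[mu]_x (phi x * h x)].
  apply: (L1_functional_density hK cK rmu (B := B * Renorm e)).
  - by rewrite mulr_ge0 ?Renorm_ge0.
  - move=> f g cf cg; rewrite -ReD -(dualD dnu); congr (complex.Re (nu _)).
    apply: bcfun_eqP => x; rewrite (vliftE e x (add_cont cf cg)) rmorphD scalerDl.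
    by rewrite -(vliftE e x cf) -(vliftE e x cg); exact/esym/bcfunDE.
  - move=> t f t0 cf; rewrite -Re_scale -(dualZ dnu); congr (complex.Re (nu _)).
    apply: bcfun_eqP => x; rewrite (vliftE e x (scale_cont (t := t) cf)) rmorphM -scalerA.
    by rewrite -(vliftE e x cf); exact/esym/bcfunZE.
  - move=> f cf; apply: (le_trans (abs_Re_le _)); apply: (le_trans (nuB _)).
    rewrite -mulrA ler_wpM2l // -RintegralZl //; last first.
      by apply: intg_norm; exact: cont_integrable.
    rewrite le_eqVlt; apply/orP; left; apply/eqP; apply: eq_Rintegral => x _.
    by rewrite (vliftE e x cf) RenormZ Renorm_real mulrC.
have [p hp] := choice (fun j : 'I_N => dens (delta_mx j 0)).
have [q hq] := choice (fun j : 'I_N => dens ('i%C *: delta_mx j 0)).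
have [P hP] := choice (fun j => let: And3 _ h _ := hp j in h).
have [Q hQ] := choice (fun j => let: And3 _ h _ := hq j in h).
pose h x : E := \col_j (p j x +i* q j x)%C.
have hRe x j : complex.Re (h x j 0) = p j x by rewrite mxE.
have hIm x j : complex.Im (h x j 0) = q j x by rewrite mxE.
have hRe' j : (fun x => complex.Re (h x j 0)) = p j by apply/funext => x; exact: hRe.
have hIm' j : (fun x => complex.Im (h x j 0)) = q j by apply/funext => x; exact: hIm.
have mp j : measurable_fun [set: borel K] (p j) by case: (hp j).
have mq j : measurable_fun [set: borel K] (q j) by case: (hq j).
exists h; split.
- by split=> j; [rewrite hRe'|rewrite hIm'].
- exists (\sum_j (P j + Q j)) => x; apply: (le_trans (Renorm_le_coord _)).
  by apply: ler_sum => j _; rewrite hRe hIm lerD.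
move=> f.
have cR := @Re_coord_cont R K N f; have cI := @Im_coord_cont R K N f.
have ib (u v : K -> R) (M : R) : continuous u -> measurable_fun [set: borel K] v ->
    (forall x, `|v x| <= M) -> intg mu (fun x => u x * v x).
  move=> cu mv vM; have [L uL] := cont_bounded cK cu.
  apply: (@bounded_integrable _ _ _ _ (L * M)).
    by apply: measurable_funM => //; exact: cont_measurable.
  by move=> x; rewrite normrM; apply: ler_pM.
rewrite {1}(bcfun_coord_decomposition f) (dual_sum dnu).
rewrite (big_morph _ (@ReD R) (erefl : complex.Re 0 = 0)).
rewrite /rdot Rintegral_sum; last first.
  move=> j; apply: intg_add.
    by apply: (ib _ _ (P j)) => // [|x]; rewrite ?hRe' ?hRe.
  by apply: (ib _ _ (Q j)) => // [|x]; rewrite ?hIm' ?hIm.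
apply: eq_bigr => j _; rewrite (dualD dnu) ReD.
have [_ _ hpj] := hp j; have [_ _ hqj] := hq j.
apply: (etrans (congr2 +%R (hpj _ (cR j)) (hqj _ (cI j)))).
rewrite -RintegralD //; last 2 first.
- exact: (ib _ _ (P j)).
- exact: (ib _ _ (Q j)).
by apply: eq_Rintegral => x _; rewrite hRe hIm.
Qed.
End VectorDensity.


Lemma ae_imp (R : realType) (K : ptopologicalType) (mu : probability (borel K) R)
    (P Q : K -> Prop) : (forall x, P x -> Q x) ->
  {ae mu, forall x, P x} -> {ae mu, forall x, Q x}.
Proof. by move=> PQ; apply: (@filterS _ _ (ae_filter_ringOfSetsType mu)). Qed.

Section CocycleL2.
Variables (R : realType) (G : semitopologicalSemigroupType) (K : ptopologicalType).
Variables (a : semigroup_action G K) (mu : probability (borel K) R).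
Variables (N : nat) (c : cocycle R N a).
Hypotheses (hK : hausdorff_space K) (cK : compact [set: K]).
Hypothesis ue : uniquely_ergodic a mu.
Local Notation E := (euclidean R N).
Local Notation X := (bcfun K E).
Local Notation V := (cocycle_koopman c).
Local Notation V2 := (cocycle_koopman2 c).

Let rmu : regular_measure mu. Proof. by have [] := ue. Qed.

Let push_eq g (f : borel K -> \bar R) :
  (\int[pushforward mu (a g : borel K -> borel K)]_x f x = \int[mu]_x f x)%E.
Proof.
have [_ inv _] := ue.
apply: eq_measure_integral => [|mg A mA _]; first exact: act_cont_measurable.
exact: esym (inv A g mA).
Qed.

Lemma act_intg g (F : K -> R) : intg mu F -> intg mu (fun x => F (a g x)).
Proof.
move=> iF; have mF := intg_measurable iF; have mg := act_cont_measurable a g.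
have mFg : measurable_fun [set: borel K] (fun x => F (a g x)).
  exact: (measurableT_comp (f := F : borel K -> R) mF mg).
apply/integrableP; split; first exact/measurable_EFinP.
have /integrableP[_] := iF; apply: le_lt_trans.
rewrite -[leRHS](push_eq g) (ge0_integral_pushforward mg) //.
by apply: measurableT_comp => //; exact/measurable_EFinP.
Qed.

Lemma act_Rintegral g (F : K -> R) : intg mu F ->
  \int[mu]_x F (a g x) = \int[mu]_x F x.
Proof.
move=> iF; have mF := intg_measurable iF; have mg := act_cont_measurable a g.
rewrite /Rintegral -[in RHS](push_eq g) (integral_pushforward mg) //.
- exact/measurable_EFinP.
- exact: act_intg.
Qed.

Lemma cocycle_entry_cont g i j : continuous (fun x => c g x i j).
Proof.
move=> x; apply: (@continuous_comp _ _ _ (c g) (fun U : 'M[R[i]]_N => U i j)).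
  apply: (@continuous_comp _ _ _ (fun y => (g, y))
    (fun p : G * K => c p.1 p.2)); last exact: cocycle_cont.
  by apply: cvg_pair; [exact: cvg_cst|exact: cvg_id].
exact: coord_continuous.
Qed.

Lemma Re_sum n (F : 'I_n -> R[i]) :
  complex.Re (\sum_i F i) = \sum_i complex.Re (F i).
Proof. exact: (big_morph _ (@ReD R) (erefl : complex.Re 0 = 0)). Qed.

Lemma Im_sum n (F : 'I_n -> R[i]) :
  complex.Im (\sum_i F i) = \sum_i complex.Im (F i).
Proof.
have ImD (z w : R[i]) : complex.Im (z + w) = complex.Im z + complex.Im w.
  by case: z; case: w.
exact: (big_morph _ ImD (erefl : complex.Im 0 = 0)).
Qed.

Lemma mvec_koopman2 g (f : K -> E) : mvec f -> mvec (V2 g f).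
Proof.
move=> [mf1 mf2]; have mg := act_cont_measurable a g.
have mc1 i j : measurable_fun [set: borel K] (fun x => complex.Re (c g x i j)).
  by apply: cont_measurable; apply: Re_comp_cont; exact: cocycle_entry_cont.
have mc2 i j : measurable_fun [set: borel K] (fun x => complex.Im (c g x i j)).
  by apply: cont_measurable; apply: Im_comp_cont; exact: cocycle_entry_cont.
have mfg1 j : measurable_fun [set: borel K] (fun x => complex.Re (f (a g x) j 0)).
  exact: (measurableT_comp
    (f := (fun x => complex.Re (f x j 0)) : borel K -> R) (mf1 j) mg).
have mfg2 j : measurable_fun [set: borel K] (fun x => complex.Im (f (a g x) j 0)).
  exact: (measurableT_comp
    (f := (fun x => complex.Im (f x j 0)) : borel K -> R) (mf2 j) mg).
split=> i.
- rewrite (_ : (fun x => _) = fun x =>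
    \sum_j (complex.Re (c g x i j) * complex.Re (f (a g x) j 0) -
            complex.Im (c g x i j) * complex.Im (f (a g x) j 0))).
    by apply: measurable_sum => j; apply: measurable_funB; apply: measurable_funM.
  apply/funext => x; rewrite /cocycle_koopman2 mxE Re_sum; apply: eq_bigr => j _.
  by case: (c g x i j) => u v; case: (f (a g x) j 0) => u' v' /=.
- rewrite (_ : (fun x => _) = fun x =>
    \sum_j (complex.Re (c g x i j) * complex.Im (f (a g x) j 0) +
            complex.Im (c g x i j) * complex.Re (f (a g x) j 0))).
    by apply: measurable_sum => j; apply: measurable_funD; apply: measurable_funM.
  apply/funext => x; rewrite /cocycle_koopman2 mxE Im_sum; apply: eq_bigr => j _.
  by case: (c g x i j) => u v; case: (f (a g x) j 0) => u' v' /=.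
Qed.

Lemma Renorm_koopman2 g (f : K -> E) x : Renorm (V2 g f x) = Renorm (f (a g x)).
Proof. by rewrite /cocycle_koopman2 Renorm_unitary // cocycle_unitary. Qed.

Lemma koopman2B g (f h : K -> E) x :
  V2 g (fun y => f y - h y) x = V2 g f x - V2 g h x.
Proof. by rewrite /cocycle_koopman2 mulmxBr. Qed.

Lemma ivec_koopman2 g (f : K -> E) : ivec mu f -> ivec mu (V2 g f).
Proof.
move=> [mf fi]; split; first exact: mvec_koopman2.
rewrite (_ : (fun x => _) = fun x => Renorm (f (a g x))); first exact: (act_intg g fi).
by apply/funext => x; rewrite Renorm_koopman2.
Qed.

Lemma koopman2_isometry g (f : K -> E) : ivec mu f ->
  \int[mu]_x Renorm (V2 g f x) = \int[mu]_x Renorm (f x).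
Proof.
move=> [mf fi]; rewrite -(act_Rintegral g fi).
by apply: eq_Rintegral => x _; rewrite Renorm_koopman2.
Qed.

Lemma intg_rdot (f h : K -> E) (M : R) : ivec mu f -> mvec h ->
  (forall x, Renorm (h x) <= M) -> intg mu (fun x => rdot (f x) (h x)).
Proof.
move=> [mf fi] mh hM; apply: (intg_le _ _ (intg_scale M fi)).
  exact: mvec_rdot.
move=> x; apply: (le_trans (rdot_le _ _)).
by rewrite mulrC ler_wpM2r ?Renorm_ge0.
Qed.

Lemma Rintegral_rdot_le (f h : K -> E) (M : R) : ivec mu f -> mvec h ->
  (forall x, Renorm (h x) <= M) ->
  `|\int[mu]_x rdot (f x) (h x)| <= M * \int[mu]_x Renorm (f x).
Proof.
move=> fi mh hM; have ir := intg_rdot fi mh hM; have [_ ifn] := fi.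
apply: (le_trans (le_normr_Rintegral measurableT ir)).
rewrite -RintegralZl //; apply: Rintegral_le; [exact: intg_norm|exact: intg_scale|].
by move=> x; apply: (le_trans (rdot_le _ _)); rewrite mulrC ler_wpM2r ?Renorm_ge0.
Qed.

Lemma intg_sqr_Renorm (f : K -> E) (M : R) : ivec mu f -> mvec f ->
  (forall x, Renorm (f x) <= M) -> intg mu (fun x => Renorm (f x) ^+ 2).
Proof.
move=> fi mf fM; rewrite (_ : (fun x => _) = fun x => rdot (f x) (f x)).
  exact: intg_rdot fi mf fM.
by apply/funext => x; rewrite rdot_sqr.
Qed.

Lemma intg_eq0_ae (F : K -> R) : intg mu F -> (forall x, 0 <= F x) ->
  \int[mu]_x F x = 0 -> {ae mu, forall x, F x = 0}.
Proof.
move=> iF F0 F00; have mF := intg_measurable iF.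
have mF' : measurable_fun [set: borel K] (EFin \o F : borel K -> \bar R).
  exact/measurable_EFinP.
have : (\int[mu]_x `|(EFin \o F : borel K -> \bar R) x|)%E = 0%E.
  rewrite (eq_integral (EFin \o F : borel K -> \bar R)); last first.
    by move=> x _; rewrite gee0_abs ?lee_fin.
  by rewrite -[LHS]fineK ?integrable_fin_num //; congr EFin.
move/(ae_eq_integral_abs mu measurableT mF'); apply: filterS => x /= /(_ I).
by case.
Qed.

(** A bounded density [h] of a fixed functional satisfies
    [<V2 g h, h> = <h, h>] by approximation, and [V2 g] preserves norms, so the
    square norm of [V2 g h - h] expands to zero. *)
Theorem fixed_density nu : Fix_dual V nu -> exists h : K -> E,
  [/\ Fix2 mu c h, mvec h, exists M : R, forall x, Renorm (h x) <= M &
    forall f : X, complex.Re (nu f) = \int[mu]_x rdot (f x) (h x)].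
Proof.
move=> fnu; have [dnu fixnu] := fnu.
have [B B0 nuB] := dual_bounded dnu.
have nuL1 := fixed_functional_L1_bound hK cK ue fnu B0 nuB.
have [h [mh [M hM] nuh]] := vector_density hK cK rmu dnu B0 nuL1.
have M0 : 0 <= M := le_trans (Renorm_ge0 _) (hM point).
have ih : ivec mu h := ivec_bounded mu mh hM.
have ihh : intg mu (fun x => Renorm (h x) ^+ 2) := intg_sqr_Renorm ih mh hM.
exists h; split=> //; last by exists M.
split.
  split; [exact: mh.1|exact: mh.2|].
  have /integrableP[_] := ihh; apply: le_lt_trans; rewrite le_eqVlt; apply/orP.
  left; apply/eqP; apply: eq_integral => x _ /=.
  by rewrite ger0_norm // sqr_ge0.
move=> g.
have iVh : ivec mu (V2 g h) by exact: ivec_koopman2.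
have iVhh : intg mu (fun x => rdot (V2 g h x) (h x)) by exact: intg_rdot iVh mh hM.
have ihh' : intg mu (fun x => rdot (h x) (h x)) by exact: intg_rdot ih mh hM.
have key : \int[mu]_x rdot (V2 g h x) (h x) = \int[mu]_x rdot (h x) (h x).
  apply/eqP; rewrite -subr_eq0 -normr_le0; apply/ler_addgt0Pr => e e0.
  rewrite add0r.
  have [d d0 Md] := small_multiple (mulr_ge0 (ler0n _ 2) M0) e0.
  have [phi hphi] := cont_dense_vec hK cK rmu ih d0.
  have iphi : ivec mu phi by apply: ivec_cont => //; exact: bcfun_cont.
  have iVphi : ivec mu (V2 g phi) by exact: ivec_koopman2.
  have id := ivec_sub ih iphi; have iVd := ivec_koopman2 g id.
  have fixphi : \int[mu]_x rdot (V2 g phi x) (h x) = \int[mu]_x rdot (phi x) (h x).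
    by rewrite -nuh -[in RHS](fixnu g) /= nuh.
  have e1 : \int[mu]_x rdot (V2 g h x) (h x) - \int[mu]_x rdot (V2 g phi x) (h x) =
      \int[mu]_x rdot (V2 g (fun y => h y - phi y) x) (h x).
    rewrite -RintegralB //; last exact: intg_rdot iVphi mh hM.
    by apply: eq_Rintegral => x _; rewrite koopman2B rdotBl.
  have e2 : \int[mu]_x rdot (h x) (h x) - \int[mu]_x rdot (phi x) (h x) =
      \int[mu]_x rdot (h x - phi x) (h x).
    rewrite -RintegralB //; last exact: intg_rdot iphi mh hM.
    by apply: eq_Rintegral => x _; rewrite rdotBl.
  have b1 := Rintegral_rdot_le iVd mh hM; have b2 := Rintegral_rdot_le id mh hM.
  rewrite koopman2_isometry // -e1 in b1; rewrite -e2 -fixphi in b2.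
  have MI : M * \int[mu]_x Renorm (h x - phi x) <= M * d by rewrite ler_wpM2l.
  move: b1 b2; rewrite !ler_norml => /andP[b1 b1'] /andP[b2 b2'].
  by apply/andP; split; lra.
have inorm : intg mu (fun x => Renorm (V2 g h x) ^+ 2).
  rewrite (_ : (fun x => _) = fun x => Renorm (h (a g x)) ^+ 2).
    exact: (act_intg g ihh).
  by apply/funext => x; rewrite Renorm_koopman2.
have idiff : intg mu (fun x => Renorm (V2 g h x - h x) ^+ 2).
  rewrite (_ : (fun x => _) = fun x =>
    Renorm (V2 g h x) ^+ 2 - 2 * rdot (V2 g h x) (h x) + Renorm (h x) ^+ 2).
    by apply: intg_add => //; apply: intg_sub => //; exact: intg_scale.
  by apply/funext => x; rewrite Renorm_sqrB mulrC.
have z0 : \int[mu]_x (Renorm (V2 g h x - h x) ^+ 2) = 0.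
  have -> : \int[mu]_x (Renorm (V2 g h x - h x) ^+ 2) = \int[mu]_x
      (Renorm (V2 g h x) ^+ 2 - 2 * rdot (V2 g h x) (h x) + Renorm (h x) ^+ 2).
    by apply: eq_Rintegral => x _; rewrite Renorm_sqrB mulrC.
  have i2 := intg_scale 2 iVhh.
  rewrite (RintegralD measurableT (intg_sub inorm i2) ihh).
  rewrite (RintegralB measurableT inorm i2) (RintegralZl 2 measurableT iVhh) key.
  have -> : \int[mu]_x (Renorm (V2 g h x) ^+ 2) = \int[mu]_x (Renorm (h x) ^+ 2).
    rewrite -(act_Rintegral g ihh).
    by apply: eq_Rintegral => x _; rewrite Renorm_koopman2.
  have -> : \int[mu]_x rdot (h x) (h x) = \int[mu]_x (Renorm (h x) ^+ 2).
    by apply: eq_Rintegral => x _; rewrite rdot_sqr.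
  lra.
have sq0 x : 0 <= Renorm (V2 g h x - h x) ^+ 2 by exact: sqr_ge0.
apply: ae_imp (intg_eq0_ae idiff sq0 z0) => x /eqP.
by rewrite sqrf_eq0 => /eqP /Renorm_eq0/eqP; rewrite subr_eq0 => /eqP.
Qed.

(** The difference [nu] of two fixed functionals has a fixed density, whose
    continuous representative [u] satisfies [Re (nu u) = ||u||^2]; if [nu u = 0]
    then the density vanishes almost everywhere, and so does [nu]. *)
Theorem fix_separates_of_Fix2 :
  (forall f : K -> E, Fix2 mu c f ->
     exists2 h : X, Fix V h & {ae mu, forall x, f x = h x}) ->
  separates (Fix V) (Fix_dual V).
Proof.
move=> h12 nu1 nu2 [d1 f1] [d2 f2] nu12.
pose nu (f : X) := nu1 f - nu2 f.
have fnu : Fix_dual V nu.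
  split=> [|g]; first exact: dual_sub.
  by apply/funext => f; rewrite /nu /= -[in RHS](f1 g) -[in RHS](f2 g).
have [h [fh mh [M hM] nuh]] := fixed_density fnu.
have [u fu hu] := h12 h fh.
exists u => // nu12u; apply: nu12; apply/funext => f.
have ih : ivec mu h := ivec_bounded mu mh hM.
have iu : ivec mu u by apply: ivec_cont => //; exact: bcfun_cont.
have ihh : intg mu (fun x => Renorm (h x) ^+ 2) := intg_sqr_Renorm ih mh hM.
have h0 : {ae mu, forall x, Renorm (h x) ^+ 2 = 0}.
  apply: intg_eq0_ae => // [x|]; first exact: sqr_ge0.
  have := nuh u; rewrite /nu nu12u subrr /= => ->.
  congr fine; apply: ae_eq_integral => //.
  - by apply/measurable_EFinP; exact: intg_measurable ihh.
  - by apply/measurable_EFinP; apply: mvec_rdot => //; case: iu.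
  - by apply: ae_imp hu => x hux _ /=; rewrite -hux rdot_sqr.
have Re0 k : complex.Re (nu k) = 0.
  rewrite nuh -[RHS](_ : \int[mu]_x (0 : R) = 0); last first.
    by rewrite Rintegral_cst // mul0r.
  congr fine; apply: ae_eq_integral => //.
  - apply/measurable_EFinP; apply: mvec_rdot => //.
    by apply: mvec_cont; exact: bcfun_cont.
  - apply: ae_imp h0 => x /eqP; rewrite sqrf_eq0 => /eqP/Renorm_eq0 -> _ /=.
    by rewrite /rdot big1 // => i _; rewrite !mxE /= !mulr0 addr0.
have nu0 k : nu k = 0.
  have := Re0 k; have := Re0 ('i%C *: k).
  rewrite /nu (dualZ d1) (dualZ d2).
  case: (nu1 k) => p q; case: (nu2 k) => p' q' /= h1 h2.
  by apply/eqP; rewrite eq_complex /=; apply/andP; split; apply/eqP; lra.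
by apply/eqP; rewrite -subr_eq0; apply/eqP; exact: nu0.
Qed.
End CocycleL2.


(** * Complex Hahn-Banach consequences *)

Section ComplexHahnBanach.
Variables (R : realType) (X : normedModType R[i]).
Implicit Types (x y : X) (l : X -> R).

Lemma Renorm_sublinear : sublinear (fun x : X => Renorm x).
Proof. by split=> [x y|t x t0]; [exact: RenormD|exact: Renorm_scale]. Qed.

Lemma real_linear_abs l x : real_linear l -> (forall y, l y <= Renorm y) ->
  `|l x| <= Renorm x.
Proof.
move=> ll ln; rewrite ler_norml ln andbT lerNl -real_linearN //.
by rewrite -RenormN; exact: ln.
Qed.

(** [l x - i l (i x)] is complex linear with real part [l]. *)
Lemma complexify l : real_linear l -> (forall x, l x <= Renorm x) ->
  exists2 nu : X -> R[i], dual nu & forall x, complex.Re (nu x) = l x.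
Proof.
move=> ll ln; have [lD lZ] := ll.
pose nu x := (l x +i* - l ('i%C *: x))%C.
have nuD x y : nu (x + y) = nu x + nu y.
  by rewrite /nu scalerDr !lD opprD.
have nuZ (z : R[i]) x : nu (z *: x) = z * nu x.
  have e (s t : R) y : l ((s +i* t)%C *: y) = s * l y + t * l ('i%C *: y).
    have -> : (s +i* t)%C = s%:C + t%:C * 'i%C :> R[i].
      by apply/eqP; rewrite eq_complex /=; apply/andP; split; apply/eqP; ring.
    by rewrite scalerDl lD lZ -scalerA lZ.
  case: z => s t; rewrite /nu scalerA.
  have -> : 'i%C * (s +i* t)%C = (- t +i* s)%C :> R[i].
    by apply/eqP; rewrite eq_complex /=; apply/andP; split; apply/eqP; ring.
  rewrite (e s t x) (e (- t) s x); apply/eqP; rewrite eq_complex /=.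
  by apply/andP; split; apply/eqP; ring.
have nun x : Renorm (nu x) <= 2 * Renorm x.
  have -> : 2 * Renorm x = Renorm x + Renorm ('i%C *: x).
    by rewrite RenormZ /Renorm normc_def /= expr0n expr1n add0r sqrtr1 mul1r; ring.
  have -> : nu x = (l x)%:C - 'i%C * (l ('i%C *: x))%:C.
    by apply/eqP; rewrite eq_complex /=; apply/andP; split; apply/eqP; ring.
  apply: (le_trans (RenormD _ _)); rewrite RenormN; apply: lerD.
    by rewrite Renorm_real real_linear_abs.
  rewrite -[_ * _]/(_ *: _ : R[i]) RenormZ Renorm_real.
  by rewrite {1}/Renorm normc_def /= expr0n expr1n add0r sqrtr1 mul1r real_linear_abs.
exists nu => //; split=> [z x y|x]; first by rewrite nuD nuZ.
apply/(@cvg_RenormP R R[i]) => e e0; apply/nbhs_RenormP.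
exists (e / 2); first by rewrite divr_gt0.
move=> y xy; have -> : nu x - nu y = nu (x - y).
  by rewrite nuD -[X in _ = _ + nu X]scaleN1r nuZ mulN1r.
apply: (le_lt_trans (nun _)); lra.
Qed.

Lemma dual_separates_points x : (forall nu, dual nu -> nu x = 0) -> x = 0.
Proof.
move=> h; apply: contrapT => /eqP x0.
have nx : 0 < Renorm x.
  rewrite lt0r Renorm_ge0 andbT; apply: contra x0 => /eqP x0.
  by apply/eqP; exact: Renorm_eq0.
have [||||l [ll ln lx]] :=
  @convex_separation R X (fun y : X => Renorm y) [set x] (Renorm x) Renorm_sublinear.
- by move=> y; exact: RenormN.
- by exists x.
- move=> y z t -> -> _; rewrite -scalerDl -rmorphD /=.
  by rewrite addrC subrK scale1r.
- by move=> y ->.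
have [nu dnu nul] := complexify ll ln.
have := lx x erefl; rewrite -nul h //=.
by rewrite leNgt nx.
Qed.

(** A functional that is bounded below on the affine space [x - D] by a positive
    constant vanishes on [D], because [D] is a linear space. *)
Lemma dense_of_annihilator (D : set X) :
  D 0 -> (forall x y, D x -> D y -> D (x + y)) ->
  (forall (z : R[i]) x, D x -> D (z *: x)) ->
  (forall nu, dual nu -> (forall x, D x -> nu x = 0) -> forall x, nu x = 0) ->
  forall x (e : R), 0 < e -> exists2 d, D d & Renorm (x - d) < e.
Proof.
move=> D0 DD DZ ann x e e0; apply: contrapT => nd.
have far d : D d -> e <= Renorm (x - d).
  by move=> Dd; rewrite leNgt; apply/negP => lt; apply: nd; exists d.
have [||||l [ll ln lx]] := @convex_separation R X (fun y : X => Renorm y)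
  [set x - d | d in D] e Renorm_sublinear.
- by move=> y; exact: RenormN.
- by exists (x - 0), 0.
- move=> _ _ t [d Dd <-] [d' Dd' <-] _.
  exists (t%:C *: d + (1 - t)%:C *: d'); first by apply: DD; exact: DZ.
  rewrite !scalerBr addrACA -scalerDl -rmorphD /= opprD.
  by rewrite (addrC t) subrK scale1r.
- by move=> _ [d Dd <-]; exact: far.
have [nu dnu nul] := complexify ll ln.
have lD0 d : D d -> l d = 0.
  move=> Dd; apply/eqP; apply: contrapT => /negP ld0.
  pose t := (l x - e + 1) / l d.
  have := lx (x - t%:C *: d) (ex_intro2 _ _ _ (DZ _ _ Dd) erefl).
  rewrite real_linearB //; have [_ ->] := ll.
  by rewrite /t divfK //; lra.
have nuD d : D d -> nu d = 0.
  move=> Dd; apply/eqP; rewrite eq_complex nul lD0 //= eqxx /=.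
  have := nul ('i%C *: d); rewrite lD0; last exact: DZ.
  rewrite (dualZ dnu); case: (nu d) => u v /=.
  by rewrite mul0r mul1r sub0r => /eqP; rewrite oppr_eq0.
have := lx (x - 0) (ex_intro2 _ _ _ D0 erefl).
by rewrite subr0 -nul (ann nu dnu nuD) /= leNgt e0.
Qed.
End ComplexHahnBanach.


(** * Abstract mean ergodic theory *)

Section Tails.
Variable I : directedSet.

Lemma tails_proper : ProperFilter (tails I).
Proof.
split=> [[i0 h]|]; first exact: (h i0 (directed_refl i0)).
split=> [|P Q [i hP] [j hQ]|P Q PQ [i hP]].
- by have [i0] := directed_inhabited I; exists i0.
- have [k [ik jk]] := directed_ub i j; exists k => l kl; split.
    exact: hP (directed_trans ik kl).
  exact: hQ (directed_trans jk kl).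
- by exists i => j ij; apply: PQ; exact: hP.
Qed.
End Tails.

#[local] Existing Instance tails_proper.

Section Nets.
Variables (R : realType) (X : normedModType R[i]) (I : directedSet).

Lemma norm_limitP (u : I -> X) l : norm_limit u l <->
  forall e : R, 0 < e -> exists i0, forall i, directed_le i0 i ->
    Renorm (l - u i) < e.
Proof. exact: (@cvg_RenormP R X I (tails I) _ u l). Qed.

Lemma norm_limit_weak (u : I -> X) l : norm_limit u l -> weak_limit u l.
Proof.
move=> /norm_limitP ul nu dnu; apply/(@cvg_RenormP R R[i]) => e e0.
have [B B0 nuB] := dual_bounded dnu.
have [d d0 Bd] := small_multiple B0 e0.
have [i0 h] := ul d d0; exists i0 => i /h /ltW /(ler_wpM2l B0) lt.
by rewrite -(dualB dnu); apply: le_lt_trans (nuB _) (le_lt_trans lt Bd).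
Qed.

Lemma weak_limit_unique (u : I -> X) l l' :
  weak_limit u l -> weak_limit u l' -> l = l'.
Proof.
move=> ul ul'; apply/eqP; rewrite -subr_eq0; apply/eqP.
apply: dual_separates_points => nu dnu; rewrite (dualB dnu).
apply/eqP; rewrite subr_eq0; apply/eqP.
exact: (@norm_cvg_unique R[i] R[i]) (ul nu dnu) (ul' nu dnu).
Qed.
End Nets.

Definition seq_complete (R : realType) (X : normedModType R[i]) : Prop :=
  forall u : nat -> X,
  (forall e : R, 0 < e -> exists n : nat, forall p q : nat,
     (n <= p)%N -> (n <= q)%N -> Renorm (u p - u q) < e) ->
  exists l, forall e : R, 0 < e -> exists n : nat, forall p : nat, (n <= p)%N ->
     Renorm (l - u p) < e.

Section Hull.
Variables (R : realType) (X : normedModType R[i]).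
Variables (G : semitopologicalSemigroupType) (V : G -> X -> X).
Hypothesis VD : forall g f h, V g (f + h) = V g f + V g h.
Hypothesis VZ : forall g (z : R[i]) f, V g (z *: f) = z *: V g f.
Hypothesis Vcontr : forall g f, Renorm (V g f) <= Renorm f.
Hypothesis VM : forall g h, V (g * h)%g = V h \o V g.
Implicit Types (f h : X) (T P : X -> X).

Lemma V0 g : V g 0 = 0. Proof. by have := VZ g 0 0; rewrite !scale0r. Qed.
Lemma VN g f : V g (- f) = - V g f. Proof. by rewrite -scaleN1r VZ scaleN1r. Qed.
Lemma VB g f h : V g (f - h) = V g f - V g h. Proof. by rewrite VD VN. Qed.
Lemma V_sum g n (F : 'I_n -> X) : V g (\sum_i F i) = \sum_i V g (F i).
Proof. exact: (big_morph _ (VD g) (V0 g)). Qed.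

Lemma bounded_operator_contr T : linear T ->
  (forall f, Renorm (T f) <= Renorm f) -> bounded_operator T.
Proof.
move=> Tl Tc; split=> // f; apply/cvg_RenormP => e e0; apply/nbhs_RenormP.
exists e => // h fh; apply: le_lt_trans fh.
have -> : T f - T h = T (f - h).
  by have := Tl (-1) h f; rewrite !scaleN1r ![- _ + _]addrC => ->.
exact: Tc.
Qed.

Lemma cc_add T : convex_comb V T -> forall f h, T (f + h) = T f + T h.
Proof.
move=> [n [t [g [_ _ ->]]]] f h; rewrite -big_split /=.
by apply: eq_bigr => i _; rewrite VD scalerDr.
Qed.

Lemma cc_scale T : convex_comb V T -> forall z f, T (z *: f) = z *: T f.
Proof.
move=> [n [t [g [_ _ ->]]]] z f; rewrite scaler_sumr.
by apply: eq_bigr => i _; rewrite VZ !scalerA mulrC.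
Qed.

Lemma cc_contr T : convex_comb V T -> forall f, Renorm (T f) <= Renorm f.
Proof.
move=> [n [t [g [t0 t1 ->]]]] f; apply: (le_trans (Renorm_sum _)).
rewrite -[leRHS]mul1r -t1 mulr_suml; apply: ler_sum => i _.
by rewrite Renorm_scale // ler_wpM2l.
Qed.

Lemma cc_fix T : convex_comb V T -> forall f, Fix V f -> T f = f.
Proof.
move=> [n [t [g [t0 t1 ->]]]] f Ff; rewrite -[RHS]scale1r.
rewrite -(rmorph1 (real_complex R)) -t1 rmorph_sum scaler_suml.
by apply: eq_bigr => i _; rewrite Ff.
Qed.

Lemma cc_dual T : convex_comb V T -> forall nu, Fix_dual V nu ->
  forall f, nu (T f) = nu f.
Proof.
move=> [n [t [g [t0 t1 ->]]]] nu [dnu fnu] f; rewrite (dual_sum dnu).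
rewrite -[RHS]mul1r -(rmorph1 (real_complex R)) -t1 rmorph_sum mulr_suml.
by apply: eq_bigr => i _; rewrite (dualZ dnu) -[in RHS](fnu (g i)).
Qed.

Lemma cc_V g : convex_comb V (V g).
Proof.
exists 1%N, (fun=> 1), (fun=> g); split=> //; first by rewrite big_ord1.
by apply/funext => f; rewrite big_ord1 scale1r.
Qed.

Lemma cc_comp g T : convex_comb V T -> convex_comb V (V g \o T).
Proof.
move=> [n [t [k [t0 t1 ->]]]]; exists n, t, (fun i => (k i * g)%g); split=> //.
apply/funext => f /=; rewrite V_sum; apply: eq_bigr => i _.
by rewrite VZ VM.
Qed.

Lemma cc_bounded T : convex_comb V T -> bounded_operator T.
Proof.
move=> cT; apply: bounded_operator_contr; last exact: cc_contr.
by move=> z f h; rewrite cc_add // cc_scale.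
Qed.

Lemma cc_hull T : convex_comb V T -> closed_convex_hull V T.
Proof. by move=> cT; split; [exact: cc_bounded|exact: subset_closure]. Qed.

Lemma ptws_nbhs T f (e : R) : 0 < e ->
  nbhs (T : {ptws X -> X}) [set S : {ptws X -> X} | Renorm (T f - S f) < e].
Proof.
move=> e0; have /(_ _ f) Tf := (@pointwise_cvgP X X (nbhs (T : {ptws X -> X})) T _).1
  (@cvg_id {ptws X -> X} (nbhs (T : {ptws X -> X}))).
exact: ((@cvg_RenormP R X {ptws X -> X} (nbhs (T : {ptws X -> X})) _
  (fun S => S f) (T f)).1 Tf e e0).
Qed.

(** A member of the closed convex hull agrees at any one vector with a convex
    combination up to any error, which is all that most properties need. *)
Lemma hull_approx T f (e : R) : closed_convex_hull V T -> 0 < e ->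
  exists2 S, convex_comb V S & Renorm (T f - S f) < e.
Proof.
move=> [_ clT] e0; have [S [cS TS]] := clT _ (ptws_nbhs T f e0).
by exists S.
Qed.

Lemma hull_contr T f : closed_convex_hull V T -> Renorm (T f) <= Renorm f.
Proof.
move=> hT; apply/ler_addgt0Pr => e e0; have [S cS Te] := hull_approx f hT e0.
have := Renorm_le_sub (T f) (S f); have := cc_contr cS f; lra.
Qed.

Lemma eq_of_Renorm (f h : X) : (forall e : R, 0 < e -> Renorm (f - h) <= e) -> f = h.
Proof.
move=> fh; apply/eqP; rewrite -subr_eq0; apply/eqP/Renorm_eq0/eqP.
rewrite eq_le Renorm_ge0 andbT; apply/ler_addgt0Pr => e e0.
by rewrite add0r; exact: fh.
Qed.

Lemma hull_fix T f : closed_convex_hull V T -> Fix V f -> T f = f.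
Proof.
move=> hT Ff; apply: eq_of_Renorm => e e0.
have [S cS] := hull_approx f hT e0; rewrite (cc_fix cS Ff); exact: ltW.
Qed.

Lemma hull_dual T nu f : closed_convex_hull V T -> Fix_dual V nu ->
  nu (T f) = nu f.
Proof.
move=> hT fnu; have [dnu _] := fnu; have [B B0 nuB] := dual_bounded dnu.
apply/eqP; rewrite -subr_eq0; apply/eqP/(@Renorm_eq0 R R[i])/eqP.
rewrite eq_le Renorm_ge0 andbT; apply/ler_addgt0Pr => e e0; rewrite add0r.
have [d d0 Bd] := small_multiple B0 e0.
have [S cS lt] := hull_approx f hT d0.
rewrite -(cc_dual cS fnu f) -(dualB dnu); apply: (le_trans (nuB _)).
exact: le_trans (ler_wpM2l B0 (ltW lt)) (ltW Bd).
Qed.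

Lemma hull_add T f h : closed_convex_hull V T -> T (f + h) = T f + T h.
Proof. by move=> [[lT _] _]; have := lT 1 f h; rewrite !scale1r. Qed.

Lemma hull_sub T f h : closed_convex_hull V T -> T (f - h) = T f - T h.
Proof.
move=> [[lT _] _]; have := lT (-1) h f.
by rewrite !scaleN1r ![- _ + _]addrC.
Qed.

Lemma hull_scale T z f : closed_convex_hull V T -> T (z *: f) = z *: T f.
Proof.
move=> hT; have [[lT _] _] := hT; have := lT z f 0; rewrite !addr0 => ->.
have -> : T 0 = 0 by have := hull_sub 0 0 hT; rewrite !subrr.
by rewrite addr0.
Qed.

Lemma hull_comp g T : closed_convex_hull V T -> closed_convex_hull V (V g \o T).
Proof.
move=> hT; split.
  apply: bounded_operator_contr => [z f h|f] /=.
    by rewrite hull_add // hull_scale // VD VZ.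
  exact: le_trans (Vcontr _ _) (hull_contr f hT).
move=> B nB; have [_ clT] := hT.
have : {ptws, (fun S : {ptws X -> X} => V g \o S) @ nbhs (T : {ptws X -> X})
    --> V g \o T}.
  apply/pointwise_cvgP => f; apply/cvg_RenormP => e e0.
  apply: filterS (ptws_nbhs T f e0) => S.
  by rewrite /= -VB; apply: le_lt_trans; exact: Vcontr.
move=> /(_ B nB) /clT [S [cS BS]]; exists (V g \o S); split=> //.
exact: cc_comp.
Qed.

Lemma hull_limit (I : directedSet) (A : I -> X -> X) P :
  (forall i, closed_convex_hull V (A i)) -> (forall f, norm_limit (A^~ f) (P f)) ->
  closed_convex_hull V P.
Proof.
move=> hA AP; split.
  have lim f e : 0 < e -> exists i, Renorm (P f - A i f) < e.
    move=> e0; have /norm_limitP/(_ e e0)[i h] := AP f.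
    by exists i; apply: h; exact: directed_refl.
  apply: bounded_operator_contr => [z f h|f]; last first.
    apply/ler_addgt0Pr => e e0; have [i lt] := lim f e e0.
    have := Renorm_le_sub (P f) (A i f); have := hull_contr f (hA i); lra.
  have c1 : A^~ (z *: f + h) @ tails I --> z *: P f + P h.
    rewrite (_ : A^~ _ = fun i => z *: A i f + A i h).
      apply: cvgD; last exact: AP.
      by apply: cvgZr; exact: AP.
    by apply/funext => i; rewrite hull_add // hull_scale.
  exact: norm_cvg_unique (AP _) c1.
apply: (@closed_cvg _ _ (tails I) _ (A : I -> {ptws X -> X})
  (closure (convex_comb V : set {ptws X -> X})) (@closed_closure _ _)).
  by apply: nearW => i; case: (hA i).
by apply/pointwise_cvgP => f; exact: AP.
Qed.

Lemma lin0 (E : set X) : lin E 0.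
Proof.
exists 0%N, (fun=> 0), (fun=> 0); split; first by case.
by rewrite big_ord0.
Qed.

Lemma lin_sub (E : set X) f : E f -> lin E f.
Proof.
move=> Ef; exists 1%N, (fun=> 1), (fun=> f); split=> //.
by rewrite big_ord1 scale1r.
Qed.

Lemma linZ (E : set X) z f : lin E f -> lin E (z *: f).
Proof.
move=> [n [c [u [Eu ->]]]]; exists n, (fun i => z * c i), u; split=> //.
by rewrite scaler_sumr; apply: eq_bigr => i _; rewrite scalerA.
Qed.

Lemma linD (E : set X) f h : lin E f -> lin E h -> lin E (f + h).
Proof.
move=> [n [c [u [Eu ->]]]] [m [d [v [Ev ->]]]].
exists (n + m)%N, (family_cat c d), (family_cat u v); split=> [k|].
  exact: family_catP.
rewrite big_split_ord /=; congr (_ + _); apply: eq_bigr => i _.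
  by rewrite !family_catl.
by rewrite !family_catr.
Qed.

Lemma clinP f : clin_range_IV V f <-> forall e : R, 0 < e ->
  exists2 w, lin (range_IV V) w & Renorm (f - w) < e.
Proof.
split=> [clf e e0|h B /nbhs_RenormP[e e0 eB]].
  have : nbhs f [set w | Renorm (f - w) < e] by apply/nbhs_RenormP; exists e.
  by move=> /clf [w [lw fw]]; exists w.
by have [w lw fw] := h e e0; exists w; split=> //; exact: eB.
Qed.

Lemma clin_of_lin f : lin (range_IV V) f -> clin_range_IV V f.
Proof. by move=> lf; apply/clinP => e e0; exists f; rewrite ?subrr ?Renorm0. Qed.

Lemma clin_sub f h : clin_range_IV V f -> clin_range_IV V h ->
  clin_range_IV V (f - h).
Proof.
move=> /clinP cf /clinP ch; apply/clinP => e e0.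
have e2 : 0 < e / 2 by rewrite divr_gt0.
have [w lw fw] := cf _ e2; have [w' lw' hw'] := ch _ e2.
exists (w - w'); first by rewrite -scaleN1r; apply: linD => //; exact: linZ.
have -> : f - h - (w - w') = (f - w) - (h - w') by rewrite !opprD !opprK addrACA.
apply: (le_lt_trans (RenormD _ _)); rewrite RenormN [ltRHS](splitr e).
exact: ltrD.
Qed.

Lemma clin_closed f : (forall e : R, 0 < e ->
  exists2 w, clin_range_IV V w & Renorm (f - w) < e) -> clin_range_IV V f.
Proof.
move=> h; apply/clinP => e e0; have e2 : 0 < e / 2 by rewrite divr_gt0.
have [w /clinP cw fw] := h _ e2; have [w' lw' ww'] := cw _ e2; exists w' => //.
apply: (le_lt_trans (Renorm_sub_le f w w')); rewrite [ltRHS](splitr e).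
exact: ltrD.
Qed.

Lemma Fix_sub f h : Fix V f -> Fix V h -> Fix V (f - h).
Proof. by move=> Ff Fh g; rewrite VB Ff Fh. Qed.

Lemma Fix_closed f : (forall e : R, 0 < e ->
  exists2 u, Fix V u & Renorm (f - u) < e) -> Fix V f.
Proof.
move=> h g; apply: eq_of_Renorm => e e0.
have e2 : 0 < e / 2 by rewrite divr_gt0.
have [u Fu fu] := h _ e2.
apply: (le_trans (Renorm_sub_le _ u _)).
rewrite -{1}(Fu g) -VB (RenormB u f); have := Vcontr g (f - u); lra.
Qed.

Lemma Fix0 : Fix V 0. Proof. by move=> g; exact: V0. Qed.

Section RightErgodic.
Variables (I : directedSet) (A : I -> X -> X).
Hypothesis rA : right_ergodic_net V A.

Lemma net_hull i : closed_convex_hull V (A i). Proof. by case: rA. Qed.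

Lemma net_range_small f (e : R) : clin_range_IV V f -> 0 < e ->
  exists i0, forall i, directed_le i0 i -> Renorm (A i f) < e.
Proof.
move=> /clinP cf e0.
have rng w : lin (range_IV V) w -> A^~ w @ tails I --> (0 : X).
  move=> [n [c [u [ru ->]]]].
  have -> : A^~ (\sum_i c i *: u i) = fun i => \sum_k c k *: A i (u k).
    apply/funext => i; have hA := net_hull i.
    rewrite (big_morph _ (fun f h => hull_add f h hA) (hull_fix hA Fix0)).
    by apply: eq_bigr => k _; rewrite hull_scale.
  have lim0 k : A^~ (u k) @ tails I --> (0 : X).
    have [g [h ->]] := ru k; have [_ /(_ h g)] := rA.
    rewrite (_ : (fun i => A i h - A i (V g h)) = A^~ (h - V g h)) //.
    by apply/funext => i; rewrite (hull_sub _ _ (net_hull i)).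
  elim: n c u ru lim0 => [|n IHn] c u ru lim0.
    rewrite (_ : (fun i => _) = fun=> 0); first exact: cvg_cst.
    by apply/funext => i; rewrite big_ord0.
  rewrite (_ : (fun i => _) = fun i => c ord0 *: A i (u ord0) +
    \sum_(k < n) c (lift ord0 k) *: A i (u (lift ord0 k))); last first.
    by apply/funext => i; rewrite big_ord_recl.
  rewrite -[X in _ --> X](addr0 (0 : X)).
  rewrite -[X in _ --> X + _](scaler0 X (c ord0)); apply: cvgD.
    by apply: cvgZr; exact: lim0.
  by apply: IHn.
have e2 : 0 < e / 2 by rewrite divr_gt0.
have [w lw fw] := cf _ e2.
have /norm_limitP/(_ _ e2)[i0 h] := rng w lw.
exists i0 => i /h; rewrite sub0r RenormN => lt.
have hA := net_hull i.
have := hull_contr (f - w) hA; rewrite hull_sub //.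
have := Renorm_le_sub (A i f) (A i w); lra.
Qed.

Lemma net_limit_sum u v : Fix V u -> clin_range_IV V v ->
  norm_limit (A^~ (u + v)) u.
Proof.
move=> Fu cv; apply/norm_limitP => e e0.
have [i0 h] := net_range_small cv e0; exists i0 => i /h.
have hA := net_hull i; rewrite hull_add // (hull_fix hA Fu).
by rewrite opprD addrA subrr add0r RenormN.
Qed.

(** Ergodic nets fix the first summand and kill the second one, and they are
    contractive. *)
Lemma Fix_part_le u v : Fix V u -> clin_range_IV V v ->
  Renorm u <= Renorm (u + v).
Proof.
move=> Fu cv; apply/ler_addgt0Pr => e e0.
have /norm_limitP/(_ e e0)[i h] := net_limit_sum Fu cv.
have := h i (directed_refl i); have := hull_contr (u + v) (net_hull i).
have := Renorm_le_sub u (A i (u + v)); lra.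
Qed.

Lemma Fix_clin_trivial : Fix V `&` clin_range_IV V = [set 0].
Proof.
apply/seteqP; split=> [f [Ff cf]|_ ->]; last first.
  by split; [exact: Fix0|exact/clin_of_lin/lin0].
have cNf : clin_range_IV V (- f).
  by rewrite -sub0r; apply: clin_sub => //; exact/clin_of_lin/lin0.
have := Fix_part_le Ff cNf; rewrite subrr Renorm0 => f0.
by apply: Renorm_eq0; apply/eqP; rewrite eq_le f0 Renorm_ge0.
Qed.

(** A functional that vanishes on the range of [I - V] is fixed, and if it
    vanishes on the fixed vectors too then separation makes it zero; so the sum
    is dense. By [Fix_part_le] the first components of approximants of [f] form
    a Cauchy sequence, so the sum is also closed. *)
Theorem decomposition_of_separates : seq_complete X ->
  separates (Fix V) (Fix_dual V) ->
  direct_sum_decomposition (Fix V) (clin_range_IV V).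
Proof.
move=> Xcomplete sep; split; last exact: Fix_clin_trivial.
pose D := [set f | exists u v, [/\ Fix V u, lin (range_IV V) v & f = u + v]].
have DF u : Fix V u -> D u.
  by move=> Fu; exists u, 0; split; rewrite ?addr0 //; exact: lin0.
have Dr v : lin (range_IV V) v -> D v.
  by move=> lv; exists 0, v; split; rewrite ?add0r //; exact: Fix0.
have dense : forall f (e : R), 0 < e -> exists2 d, D d & Renorm (f - d) < e.
  apply: dense_of_annihilator.
  - exact/DF/Fix0.
  - move=> _ _ [u [v [Fu lv ->]]] [u' [v' [Fu' lv' ->]]].
    exists (u + u'), (v + v'); split; [|exact: linD|by rewrite addrACA].
    by move=> g; rewrite VD Fu Fu'.
  - move=> z _ [u [v [Fu lv ->]]]; exists (z *: u), (z *: v).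
    by split; [move=> g; rewrite VZ Fu|exact: linZ|rewrite scalerDr].
  - move=> nu dnu nuD f; apply: contrapT => nuf.
    have fnu : Fix_dual V nu.
      split=> // g; apply/funext => h; apply/eqP; rewrite eq_sym -subr_eq0 /=.
      rewrite -(dualB dnu); apply/eqP/nuD/Dr/lin_sub.
      by exists g, h.
    have fnu0 : Fix_dual V (fun=> 0).
      split=> [|g]; last by [].
      split=> [z h k|h]; [by rewrite mulr0 addr0|exact: cvg_cst].
    have [|u Fu] := sep nu (fun=> 0) fnu fnu0.
      by move=> e; apply: nuf; rewrite e.
    by rewrite (nuD u (DF u Fu)).
move=> f.
have [d hd] := choice (fun n : nat =>
  let: ex_intro2 d Dd fd := dense f (n.+1%:R^-1) ltac:(by rewrite invr_gt0) in
  ex_intro (fun d => D d /\ Renorm (f - d) < n.+1%:R^-1) d (conj Dd fd)).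
have [u hu] := choice (fun n => (hd n).1).
have [v huv] := choice hu.
have small (e : R) : 0 < e -> exists n : nat, forall p : nat, (n <= p)%N ->
    Renorm (f - d p) < e.
  by move=> /harmonic_small[n hn]; exists n => p /hn; exact: lt_trans (hd p).2.
have cauchy (e : R) : 0 < e -> exists n : nat, forall p q : nat,
    (n <= p)%N -> (n <= q)%N -> Renorm (u p - u q) < e.
  move=> e0; have e2 : 0 < e / 2 by rewrite divr_gt0.
  have [n hn] := small _ e2; exists n => p q np nq.
  have [Fp lp dp] := huv p; have [Fq lq dq] := huv q.
  have := Fix_part_le (Fix_sub Fp Fq) (clin_sub (clin_of_lin lp) (clin_of_lin lq)).
  have -> : u p - u q + (v p - v q) = d p - d q.
    by rewrite dp dq opprD addrACA.
  have := Renorm_sub_le (d p) f (d q); rewrite (RenormB (d p) f).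
  have := hn p np; have := hn q nq; lra.
have [l hl] := Xcomplete u cauchy.
exists l, (f - l); split.
- apply: Fix_closed => e e0; have [n hn] := hl e e0; exists (u n); last exact: hn.
  by have [] := huv n.
- apply: clin_closed => e e0; have e2 : 0 < e / 2 by rewrite divr_gt0.
  have [n hn] := hl _ e2; have [m hm] := small _ e2.
  pose p := maxn n m; exists (v p).
    by apply: clin_of_lin; have [] := huv p.
  have -> : f - l - v p = (f - d p) - (l - u p).
    have [_ _ ->] := huv p.
    by rewrite opprB addrA opprD addrA [X in _ = X - l]addrAC subrK addrAC.
  apply: (le_lt_trans (RenormD _ _)); rewrite RenormN [ltRHS](splitr e).
  by apply: ltrD; [apply: hm; exact: leq_maxr|apply: hn; exact: leq_maxl].
- by rewrite subrKC.
Qed.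
End RightErgodic.


(** The common limit of all right ergodic nets is the first component of the
    decomposition. *)
Theorem ergodic_projection (I : directedSet) (A : I -> X -> X) :
  right_ergodic_net V A ->
  direct_sum_decomposition (Fix V) (clin_range_IV V) ->
  exists P, [/\ mean_ergodic_projection V P,
    projection_along P (Fix V) (clin_range_IV V) &
    forall (J : directedSet) (C : J -> X -> X), right_ergodic_net V C ->
      forall f, norm_limit (C^~ f) (P f)].
Proof.
move=> rA [dec _].
have [P hP] := choice dec.
have [Q hQ] := choice hP.
have FP f : Fix V (P f) by have [] := hQ f.
have cQ f : clin_range_IV V (Q f) by have [] := hQ f.
have fPQ f : f = P f + Q f by have [] := hQ f.
have lim (J : directedSet) (C : J -> X -> X) f : right_ergodic_net V C ->
    norm_limit (C^~ f) (P f).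
  by move=> rC; rewrite [X in C^~ X]fPQ; exact: net_limit_sum.
have hullP : closed_convex_hull V P.
  by apply: (hull_limit (A := A)) => [i|f]; [case: rA|exact: lim].
have uniq u v : Fix V u -> clin_range_IV V v -> P (u + v) = u.
  by move=> Fu cv; exact: norm_cvg_unique (lim _ _ _ rA) (net_limit_sum rA Fu cv).
have PF u : Fix V u -> P u = u by exact: hull_fix.
have P0 v : clin_range_IV V v -> P v = 0.
  by move=> cv; rewrite -[v]add0r; apply: uniq => //; exact: Fix0.
have TP T : closed_convex_hull V T -> T \o P = P.
  by move=> hT; apply/funext => f /=; exact: hull_fix.
have PV g f : P (V g f) = P f.
  apply/eqP; rewrite eq_sym -subr_eq0 -(hull_sub _ _ hullP); apply/eqP/P0.
  by apply/clin_of_lin/lin_sub; exists g, f.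
have PT T : closed_convex_hull V T -> P \o T = P.
  move=> hT; apply/funext => f /=; apply: eq_of_Renorm => e e0.
  have [S cS TS] := hull_approx f hT e0.
  have PS : P (S f) = P f.
    have [n [t [g [t0 t1 ->]]]] := cS.
    rewrite (big_morph _ (fun f h => hull_add f h hullP) (PF _ Fix0)).
    rewrite -[RHS]scale1r -(rmorph1 (real_complex R)) -t1 rmorph_sum scaler_suml.
    by apply: eq_bigr => i _; rewrite hull_scale // PV.
  rewrite -PS -(hull_sub _ _ hullP).
  exact: le_trans (hull_contr _ hullP) (ltW TS).
exists P; split.
- by split=> // T hT; split; [exact: PT|exact: TP].
- split; first by case: hullP.
  + exact: TP.
  + apply/seteqP; split=> [_ [f _ <-]|f Ff]; first exact: FP.
    by exists f => //; exact: PF.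
  + apply/seteqP; split=> [f /= Pf0|f cf]; last exact: P0.
    by rewrite (fPQ f) Pf0 add0r.
- by move=> J C rC f; exact: lim.
Qed.

Lemma projection_fixed P f : mean_ergodic_projection V P -> Fix V (P f).
Proof.
move=> [hP Pzero] g; have [_ VP] := Pzero _ (cc_hull (cc_V g)).
exact: (congr1 (@^~ f) VP).
Qed.

(** A fixed functional takes the same value at [f] and at the fixed vector
    [P f]. *)
Lemma separates_of_mean_ergodic :
  mean_ergodic V -> separates (Fix V) (Fix_dual V).
Proof.
move=> [P mP] nu1 nu2 f1 f2 nu12; have [hP _] := mP.
apply: contrapT => h; apply: nu12; apply/funext => f.
rewrite -(hull_dual f hP f1) -(hull_dual f hP f2); apply: contrapT => ne.
by apply: h; exists (P f); first exact: projection_fixed.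
Qed.

Lemma separates_of_weak_to_fixed (I : directedSet) (A : I -> X -> X) :
  right_ergodic_net V A -> weakly_convergent_to_fixed V A ->
  separates (Fix V) (Fix_dual V).
Proof.
move=> [hA _] wA nu1 nu2 f1 f2 nu12.
have lim nu f l : Fix_dual V nu -> weak_limit (A^~ f) l -> nu l = nu f.
  move=> fnu /(_ nu fnu.1) cv.
  have cst : (fun i => nu (A i f)) @ tails I --> nu f.
    rewrite (_ : (fun i => _) = fun=> nu f); first exact: cvg_cst.
    by apply/funext => i; rewrite hull_dual.
  exact: (@norm_cvg_unique R[i] R[i]) cv cst.
apply: contrapT => h; apply: nu12; apply/funext => f.
have [l Fl Al] := wA f.
rewrite -(lim nu1 f l f1 Al) -(lim nu2 f l f2 Al); apply: contrapT => ne.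
by apply: h; exists l.
Qed.

Lemma dual_V nu g : dual nu -> dual (nu \o V g).
Proof.
move=> dnu; split=> [z f h|f] /=.
  by rewrite VD VZ (dualD dnu) (dualZ dnu).
apply: continuous_comp; last by have [_ c] := dnu; exact: c.
by have [_ c] := cc_bounded (cc_V g); exact: c.
Qed.

Lemma weak_limit_V (I : directedSet) (u : I -> X) l g :
  weak_limit u l -> weak_limit (fun i => V g (u i)) (V g l).
Proof. by move=> ul nu dnu; exact: ul (dual_V g dnu). Qed.

Lemma weak_limit_fixed (I : directedSet) (A : I -> X -> X) f l :
  ergodic_net V A -> weak_limit (A^~ f) l -> Fix V l.
Proof.
move=> [_ rA] Al g; apply/eqP; rewrite eq_sym -subr_eq0; apply/eqP.
have w1 : weak_limit (fun i => A i f - V g (A i f)) (l - V g l).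
  move=> nu dnu; rewrite (dualB dnu).
  rewrite (_ : (fun i => _) = fun i => nu (A i f) - nu (V g (A i f))).
    by apply: (@cvgB _ R[i]); [exact: Al|exact: weak_limit_V dnu].
  by apply/funext => i; rewrite (dualB dnu).
exact: weak_limit_unique w1 (norm_limit_weak (rA f g)).
Qed.

(** Each index occurs twice, and the two copies precede each other. *)
Definition doubled (I : directedSet) : directedSet.
Proof.
refine (@DirectedSet (I * bool) (fun i j => directed_le i.1 j.1) _ _ _ _).
- by move=> i; exact: directed_refl.
- by move=> i j k; exact: directed_trans.
- move=> i j; have [k [ik jk]] := directed_ub i.1 j.1.
  by exists (k, true).
- by have [i0] := directed_inhabited I; exact: (inhabits (i0, true)).
Defined.

Definition interleave (I : directedSet) (A : I -> X -> X) (g : G)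
    (i : doubled I) : X -> X := if i.2 then A i.1 else V g \o A i.1.

(** [V g] is contractive, so it preserves the smallness of [A i (f - V h f)];
    left multiplication by [V g] does not disturb right ergodicity. *)
Lemma interleave_right_ergodic (I : directedSet) (A : I -> X -> X) g :
  right_ergodic_net V A -> right_ergodic_net V (interleave A g).
Proof.
move=> [hA rA]; split=> [[i b]|f h].
  by rewrite /interleave; case: b => /=; [exact: hA|exact: hull_comp].
apply/norm_limitP => e e0; have /norm_limitP/(_ e e0)[i0 hi0] := rA f h.
exists (i0, true) => -[i b] /= /hi0; rewrite !sub0r !RenormN => lt.
rewrite /interleave; case: b => //=.
by rewrite -VB; apply: le_lt_trans lt; exact: Vcontr.
Qed.

(** If the interleaved net converges weakly, its two halves have the same
    limit, so the limit of the first half is fixed by [V g]. *)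
Lemma every_weak_to_fixed :
  every_net (@right_ergodic_net R X G V) (@weakly_convergent R X) ->
  every_net (@right_ergodic_net R X G V) (@weakly_convergent_to_fixed R X G V).
Proof.
move=> h I A rA f; have [l Al] := h I A rA f.
exists l => // g; have [l' Bl'] := h _ _ (interleave_right_ergodic g rA) f.
have sub (b : bool) : weak_limit (fun i => interleave A g (i, b : bool) f) l'.
  move=> nu dnu P nP; have [[i0 b0] hi0] := Bl' nu dnu P nP.
  by exists i0 => i ii; exact: (hi0 (i, b)).
have e1 : l = l' by exact: weak_limit_unique Al (sub true).
by have := weak_limit_unique (@weak_limit_V _ _ _ g Al) (sub false); rewrite -e1.
Qed.

End Hull.


(** * Ergodic nets from invariant means *)

Section MeanSeparation.
Variables (R : realType) (T : topologicalType).
Local Notation CbT := (bcfun T R[i]).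
Variables (m : CbT -> R[i]) (one : CbT).
Hypothesis oneE : forall x, one x = 1.
Hypothesis dm : dual m.
Hypothesis m1 : m one = 1.
Hypothesis nm : dual_norm m = 1.

Lemma dual_norm_bound (f : CbT) : Renorm (m f) <= Renorm f.
Proof.
have [B B0 mB] := dual_bounded dm.
have [f0|fn0] := eqVneq (Renorm f) 0.
  by rewrite (Renorm_eq0 f0) (dual0 dm) !Renorm0.
have fp : 0 < Renorm f by rewrite lt0r fn0 Renorm_ge0.
have fi : 0 <= (Renorm f)^-1 by rewrite invr_ge0 ltW.
have : Renorm (m ((Renorm f)^-1%:C *: f)) <= 1.
  rewrite -nm; apply: ub_le_sup.
    exists B => _ [h /= h1 <-]; apply: (le_trans (mB h)).
    rewrite -[leRHS]mulr1 ler_wpM2l // -lecR RenormK.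
    by rewrite (rmorph1 (real_complex R)).
  exists ((Renorm f)^-1%:C *: f) => //=.
  by rewrite -RenormK Renorm_scale // mulVf.
rewrite (dualZ dm) -[_ * _]/(_ *: _ : R[i]) Renorm_scale //.
by rewrite ler_pdivrMl // mulr1.
Qed.

(** If [d <= phi <= M] then [M - phi] has norm at most [M - d], so a mean
    cannot send [phi] to 0. *)
Lemma mean_positive (phi : CbT) (r : T -> R) (d : R) : 0 < d ->
  (forall x, phi x = (r x)%:C) -> (forall x, d <= r x) -> m phi != 0.
Proof.
move=> d0 phiE dr; apply/eqP => mphi.
pose M := Num.max (supnorm phi) d.
have rM x : r x <= M.
  rewrite /M le_max; apply/orP; left; apply: le_trans (supnorm_ub phi x).
  by rewrite phiE Renorm_real ler_norm.
have dM : d <= M by rewrite /M le_max lexx orbT.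
have M0 : 0 <= M by apply: le_trans dM; exact: ltW.
have := dual_norm_bound (M%:C *: one - phi).
rewrite (dualB dm) (dualZ dm) m1 mphi mulr1 subr0 Renorm_real ger0_norm //.
have : supnorm (M%:C *: one - phi) <= M - d.
  apply: supnorm_le => [|x]; first by rewrite subr_ge0.
  have -> : (M%:C *: one - phi) x = (M - r x)%:C.
    have e : (M%:C *: one - phi) x = M%:C * one x - phi x by [].
    by rewrite e oneE mulr1 phiE -rmorphB.
  by rewrite Renorm_real ger0_norm ?subr_ge0 // lerD2l lerN2.
rewrite [Renorm _]/(supnorm _) => h1 h2; have := le_trans h2 h1; lra.
Qed.

Section SmallCombination.
Variables (X : normedModType R[i]) (I : finType) (y : T -> I -> X).

Definition conv_comb_at (Y : I -> X) : Prop :=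
  exists (n : nat) (t : 'I_n -> R) (g : 'I_n -> T),
    [/\ forall k, 0 <= t k, \sum_k t k = 1 &
        Y = fun i => \sum_k (t k)%:C *: y (g k) i].

Lemma conv_comb_at_convex : real_convex (conv_comb_at : set (I -> X)).
Proof.
move=> _ _ s [n [t [g [t0 t1 ->]]]] [m' [t' [g' [t'0 t'1 ->]]]] /andP[s0 s1].
exists (n + m')%N, (family_cat (fun k => s * t k) (fun k => (1 - s) * t' k)),
  (family_cat g g'); split=> [k||].
- by apply: (family_catP (P := fun r : R => 0 <= r)) => k'; rewrite mulr_ge0 // subr_ge0.
- rewrite big_split_ord /=; under eq_bigr do rewrite family_catl.
  under [X in _ + X]eq_bigr do rewrite family_catr.
  by rewrite -!mulr_sumr t1 t'1 !mulr1 subrKC.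
- apply/funext => i; rewrite big_split_ord /=.
  rewrite -[LHS]/(s%:C *: (\sum_k (t k)%:C *: y (g k) i) +
    (1 - s)%:C *: (\sum_k (t' k)%:C *: y (g' k) i)).
  rewrite !scaler_sumr; congr (_ + _); apply: eq_bigr => k _.
    by rewrite !family_catl scalerA -rmorphM.
  by rewrite !family_catr scalerA -rmorphM.
Qed.

(** If the combinations stayed away from 0, a real functional would be bounded
    below on the whole family by a positive constant; its coordinates are
    sent to 0 by the mean, so this contradicts positivity. *)
Theorem small_convex_combination :
  (forall l : X -> R, real_linear l -> (forall x, l x <= Renorm x) ->
    forall i, exists2 phi : CbT, (forall h, phi h = (l (y h i))%:C) & m phi = 0) ->
  forall e : R, 0 < e -> exists (n : nat) (t : 'I_n -> R) (g : 'I_n -> T),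
    [/\ forall k, 0 <= t k, \sum_k t k = 1 &
        forall i, Renorm (\sum_k (t k)%:C *: y (g k) i) < e].
Proof.
move=> hm e e0; apply: contrapT => nsmall.
pose q (Y : I -> X) := \sum_i Renorm (Y i).
have far Y : conv_comb_at Y -> e <= q Y.
  move=> [n [t [g [t0 t1 YE]]]]; rewrite leNgt; apply/negP => lt; apply: nsmall.
  exists n, t, g; split=> // i; apply: le_lt_trans lt.
  rewrite -[Renorm _]/(Renorm ((fun i => \sum_k (t k)%:C *: y (g k) i) i)) -YE.
  rewrite /q (bigD1 i) //= lerDl; apply: sumr_ge0 => j _; exact: Renorm_ge0.
have qsub : sublinear q.
  split=> [Y Z|s Y s0].
    by rewrite /q -big_split; apply: ler_sum => i _; exact: RenormD.
  by rewrite /q mulr_sumr; apply: eq_bigr => i _; exact: Renorm_scale.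
have qN Y : q (- Y) = q Y by apply: eq_bigr => i _; exact: RenormN.
have [h0 _] : exists h : T, True.
  apply: contrapT => nT; have : one = 0.
    by apply/val_inj/funext => x; exfalso; apply: nT; exists x.
  by move=> one0; move: m1; rewrite one0 (dual0 dm) => /eqP; rewrite eq_sym oner_eq0.
have ccy h : conv_comb_at (y h).
  exists 1%N, (fun=> 1), (fun=> h); split=> //; first by rewrite big_ord1.
  by apply/funext => i; rewrite big_ord1 scale1r.
have [|l [ll ln lC]] := convex_separation qsub qN _ conv_comb_at_convex far.
  by exists (y h0).
have [lD lZ] := ll.
pose D i (x : X) : I -> X := fun j => if j == i then x else 0.
have DD i x z : D i (x + z) = D i x + D i z.
  apply/funext => j; rewrite -[RHS]/(D i x j + D i z j) /D.
  by case: (j == i); rewrite ?addr0.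
have DZ i (s : R[i]) x : D i (s *: x) = s *: D i x.
  apply/funext => j; rewrite -[RHS]/(s *: D i x j) /D.
  by case: (j == i); rewrite ?scaler0.
have lDi i : real_linear (l \o D i).
  by split=> [x z|s x] /=; rewrite ?DD ?lD // DZ lZ.
have lDn i x : (l \o D i) x <= Renorm x.
  apply: (le_trans (ln _)); rewrite /q (bigD1 i) //= big1 ?addr0 /D ?eqxx //.
  by move=> j /negPf ->; rewrite Renorm0.
have sumE (Z : I -> I -> X) j : (\sum_i Z i) j = \sum_i Z i j.
  by elim/big_ind2: _ => // f u f' u' <- <-.
have lsum (Y : I -> X) : l Y = \sum_i l (D i (Y i)).
  have Ysum : Y = \sum_i D i (Y i).
    apply/funext => j; rewrite sumE (bigD1 j) //= big1 ?addr0 /D ?eqxx // => i.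
    by rewrite eq_sym => /negPf ->.
  by rewrite [LHS](congr1 l Ysum) (big_morph l lD (real_linear0 ll)).
have [phi hphi] := choice (fun i => let: ex_intro2 p pE mp := hm _ (lDi i) (lDn i) i in
  ex_intro (fun p : CbT => (forall h, p h = (l (D i (y h i)))%:C) /\ m p = 0)
    p (conj pE mp)).
have mD : {morph m : u v / u + v >-> u + v} := dualD dm.
have : m (\sum_i phi i) != 0.
  apply: (@mean_positive _ (fun h => l (y h)) e) => // [h|h]; last exact: lC.
  rewrite lsum rmorph_sum.
  rewrite (_ : (\sum_i phi i) h = \sum_i phi i h).
    by apply: eq_bigr => i _; rewrite (hphi i).1.
  by elim/big_ind2: _ => // f u f' u' <- <-.
rewrite (big_morph m mD (dual0 dm)) big1 ?eqxx // => i _.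
exact: (hphi i).2.
Qed.
End SmallCombination.
End MeanSeparation.

Section NetExistence.
Variables (R : realType) (X : normedModType R[i]).
Variables (G : semitopologicalSemigroupType) (V : G -> X -> X).
Hypothesis VD : forall g f h, V g (f + h) = V g f + V g h.
Hypothesis VZ : forall g (z : R[i]) f, V g (z *: f) = z *: V g f.
Hypothesis Vcontr : forall g f, Renorm (V g f) <= Renorm f.
Hypothesis VM : forall g h, V (g * h)%g = V h \o V g.

(** An index is a finite family of pairs [(f, g)] together with a precision; the
    order is inclusion of families and increase of the precision. *)
Definition requirements : directedSet.
Proof.
pose C := ({n : nat & 'I_n -> X * G} * nat)%type.
pose le (i j : C) := (forall k, exists k', projT2 i.1 k = projT2 j.1 k') /\
  (i.2 <= j.2)%N.
refine (@DirectedSet C le _ _ _ _).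
- by move=> i; split=> // k; exists k.
- move=> i j k [ij ij2] [jk jk2]; split; last exact: leq_trans jk2.
  move=> l; have [l' ->] := ij l; have [l'' ->] := jk l'; by exists l''.
- move=> [[n F] p] [[n' F'] p'].
  exists (existT _ (n + n')%N (family_cat F F'), maxn p p'); split; split=> /=.
  + by move=> k; exists (lshift n' k); rewrite family_catl.
  + exact: leq_maxl.
  + by move=> k; exists (rshift n k); rewrite family_catr.
  + exact: leq_maxr.
- by apply: inhabits; split; [exists 0%N => -[]|exact: 0%N].
Defined.

(** A diagonal argument: at the index [(F, p)] the net meets the requirements
    of [F] up to [1 / (p + 1)]. *)
Lemma net_of_requirements (b : X -> G -> (X -> X) -> R) :
  (forall n (F : 'I_n -> X * G) (e : R), 0 < e -> exists2 T, convex_comb V T &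
     forall k, b (F k).1 (F k).2 T < e) ->
  exists (I : directedSet) (A : I -> X -> X), (forall i, convex_comb V (A i)) /\
    forall f g (e : R), 0 < e -> exists i0, forall i, directed_le i0 i ->
      b f g (A i) < e.
Proof.
move=> h.
have [A hA] := choice (fun i : requirements =>
  let: ex_intro2 T cT bT := h (projT1 i.1) (projT2 i.1) (i.2.+1%:R^-1)
    ltac:(by rewrite invr_gt0) in
  ex_intro (fun T => convex_comb V T /\
    forall k, b (projT2 i.1 k).1 (projT2 i.1 k).2 T < i.2.+1%:R^-1) T (conj cT bT)).
exists requirements, A; split=> [i|f g e e0]; first exact: (hA i).1.
have [p hp] := harmonic_small e0.
exists (existT _ 1%N (fun=> (f, g)), p) => i [/(_ ord0)[k /= fgk] /hp].
by have := (hA i).2 k; rewrite -fgk /=; exact: lt_trans.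
Qed.

Section InvariantMean.
(** [T] is the semigroup itself or its opposite, with [tau] the identity; the
    invariance of the mean is phrased through the product of [G] in both cases. *)
Variables (T : topologicalType) (tau : T -> G).
Local Notation CbT := (bcfun T R[i]).
Variables (m : CbT -> R[i]) (one : CbT).
Hypothesis oneE : forall x, one x = 1.
Hypothesis dm : dual m.
Hypothesis m1 : m one = 1.
Hypothesis nm : dual_norm m = 1.
Hypothesis Vcont : forall f, continuous (fun x => V (tau x) f).
Hypothesis linv : forall g (phi psi : CbT),
  (forall x x', tau x' = (g * tau x)%g -> psi x = phi x') -> m psi = m phi.

Section Orbit.
Variables (l : X -> R).
Hypotheses (ll : real_linear l) (ln : forall x, l x <= Renorm x).

Lemma orbit_subproof (u : T -> X) (M : R) : continuous u ->
  (forall x, Renorm (u x) <= M) ->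
  (fun x => (l (u x))%:C) \in @bounded_continuous R T R[i].
Proof.
move=> cu uM; apply/asboolP; split.
  move=> x; apply/(@cvg_RenormP R R[i]) => e e0.
  have /cvg_RenormP/(_ e e0) := cu x; apply: filterS => y.
  apply: le_lt_trans; rewrite -rmorphB Renorm_real -(real_linearB _ _ ll).
  exact: real_linear_abs.
apply/bounded_funE; exists M => x; rewrite Renorm_real.
exact: le_trans (real_linear_abs _ ll ln) (uM x).
Qed.

Lemma orbit_bound f x : Renorm (V (tau x) f) <= Renorm f.
Proof. exact: Vcontr. Qed.

Definition orbit_fun f : CbT := BCFun (orbit_subproof (@Vcont f) (orbit_bound f)).

(** As [V] reverses products, the orbit function of [V g f] is a left translate
    of the orbit function of [f]. *)
Lemma orbit_fun_range f g :
  let y x := V (tau x) f - V (tau x) (V g f) in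
  exists2 phi : CbT, (forall x, phi x = (l (y x))%:C) & m phi = 0.
Proof.
exists (orbit_fun f - orbit_fun (V g f)) => [x|].
  rewrite (real_linearB _ _ ll) rmorphB.
  by [].
rewrite (dualB dm); apply/eqP; rewrite subr_eq0 eq_sym; apply/eqP.
apply: (linv (g := g)) => x x' e /=.
by rewrite e VM.
Qed.

Hypothesis rinv : forall g (phi psi : CbT),
  (forall x x', tau x' = (tau x * g)%g -> psi x = phi x') -> m psi = m phi.

Lemma orbit_fun_invariance f g :
  let y x := V (tau x) f - V g (V (tau x) f) in
  exists2 phi : CbT, (forall x, phi x = (l (y x))%:C) & m phi = 0.
Proof.
have cVg : continuous (fun x => V g (V (tau x) f)).
  move=> x; apply/cvg_RenormP => e e0.
  have /cvg_RenormP/(_ e e0) := @Vcont f x; apply: filterS => y.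
  by apply: le_lt_trans; rewrite -(VB VD VZ); exact: Vcontr.
have bVg x : Renorm (V g (V (tau x) f)) <= Renorm f.
  exact: le_trans (Vcontr _ _) (Vcontr _ _).
pose psi : CbT := BCFun (orbit_subproof cVg bVg).
exists (orbit_fun f - psi) => [x|].
  rewrite (real_linearB _ _ ll) rmorphB.
  by [].
rewrite (dualB dm); apply/eqP; rewrite subr_eq0 eq_sym; apply/eqP.
apply: (rinv (g := g)) => x x' e /=.
by rewrite e VM.
Qed.
End Orbit.

Lemma conv_comb_operator n (t : 'I_n -> R) (g : 'I_n -> T) :
  (forall k, 0 <= t k) -> \sum_k t k = 1 ->
  convex_comb V (fun f => \sum_k (t k)%:C *: V (tau (g k)) f).
Proof. by move=> t0 t1; exists n, t, (fun k => tau (g k)). Qed.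

Theorem right_net_exists : exists (I : directedSet) (A : I -> X -> X),
  right_ergodic_net V A.
Proof.
have [|I [A [cA hA]]] :=
    @net_of_requirements (fun f g S => Renorm (S f - S (V g f))).
  move=> n F e e0.
  pose y x (k : 'I_n) := V (tau x) (F k).1 - V (tau x) (V (F k).2 (F k).1).
  have [|N [t [g [t0 t1 small]]]] :=
    small_convex_combination oneE dm m1 nm (y := y) _ e0.
    by move=> l ll ln k; exact: orbit_fun_range.
  exists (fun f => \sum_k (t k)%:C *: V (tau (g k)) f).
    exact: conv_comb_operator.
  move=> k; rewrite -sumrB (eq_bigr (fun j => (t j)%:C *: y (g j) k)) ?small //.
  by move=> j _; rewrite -scalerBr.
exists I, A; split=> [i|f g]; first exact: (cc_hull VD VZ Vcontr).
apply/norm_limitP => e e0; have [i0 hi0] := hA f g e e0.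
by exists i0 => i /hi0; rewrite sub0r RenormN.
Qed.

Hypothesis rinv : forall g (phi psi : CbT),
  (forall x x', tau x' = (tau x * g)%g -> psi x = phi x') -> m psi = m phi.

Theorem net_exists : exists (I : directedSet) (A : I -> X -> X),
  ergodic_net V A.
Proof.
have [|I [A [cA hA]]] := @net_of_requirements (fun f g S =>
    Renorm (S f - S (V g f)) + Renorm (S f - V g (S f))).
  move=> n F e e0; have e2 : 0 < e / 2 by rewrite divr_gt0.
  pose y x (k : 'I_n * bool) :=
    let f := (F k.1).1 in let g := (F k.1).2 in
    if k.2 then V (tau x) f - V (tau x) (V g f)
    else V (tau x) f - V g (V (tau x) f).
  have [|N [t [g [t0 t1 small]]]] :=
    small_convex_combination oneE dm m1 nm (y := y) _ e2.
    move=> l ll ln [k []]; first exact: orbit_fun_range.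
    exact: orbit_fun_invariance.
  exists (fun f => \sum_k (t k)%:C *: V (tau (g k)) f).
    exact: conv_comb_operator.
  move=> k; rewrite [ltRHS](splitr e); apply: ltrD.
    rewrite -sumrB (eq_bigr (fun j => (t j)%:C *: y (g j) (k, true))) ?small //.
    by move=> j _; rewrite -scalerBr.
  rewrite (V_sum VD VZ) -sumrB.
  rewrite (eq_bigr (fun j => (t j)%:C *: y (g j) (k, false))) ?small //.
  by move=> j _; rewrite VZ -scalerBr.
exists I, A; split=> [|f g].
  split=> [i|f g]; first exact: (cc_hull VD VZ Vcontr).
  apply/norm_limitP => e e0; have [i0 hi0] := hA f g e e0.
  exists i0 => i /hi0; rewrite sub0r RenormN; apply: le_lt_trans.
  by rewrite lerDl Renorm_ge0.
apply/norm_limitP => e e0; have [i0 hi0] := hA f g e e0.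
exists i0 => i /hi0; rewrite sub0r RenormN; apply: le_lt_trans.
by rewrite lerDr Renorm_ge0.
Qed.
End InvariantMean.
End NetExistence.


(** * The Koopman semigroup of a cocycle *)

Section Complete.
Variables (R : realType) (K : ptopologicalType) (N : nat).
Hypothesis cK : compact [set: K].
Local Notation E := (euclidean R N).
Local Notation X := (bcfun K E).

Lemma real_cauchy_limit (r : nat -> R) :
  (forall e : R, 0 < e -> exists n : nat, forall p q : nat,
     (n <= p)%N -> (n <= q)%N -> `|r p - r q| < e) ->
  exists l : R, forall (e : R) (n : nat), (forall p q : nat,
     (n <= p)%N -> (n <= q)%N -> `|r p - r q| < e) ->
     forall p : nat, (n <= p)%N -> `|l - r p| <= e.
Proof.
move=> rc; have cr : cvgn r.
  apply: cauchy_cvg; apply: cauchy_exP => e e0.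
  have [n hn] := rc e e0; exists (r n); exists n => // p np /=.
  by rewrite /ball /= hn.
exists (limn r) => e n hn p np; apply/ler_addgt0Pr => d d0.
have /cvgrPdist_lt/(_ d d0)[m _ hm] := cr.
pose q := maxn n m.
have h1 : `|limn r - r q| < d by apply: hm; exact: leq_maxr.
have h2 : `|r q - r p| < e by apply: hn => //; exact: leq_maxl.
rewrite -(subrKA (r q)) (le_trans (ler_normD _ _)) //; lra.
Qed.

Lemma coord_sub_le (f g : X) x i :
  `|complex.Re (f x i 0) - complex.Re (g x i 0)| <= Renorm (f - g) /\
  `|complex.Im (f x i 0) - complex.Im (g x i 0)| <= Renorm (f - g).
Proof.
have h : Renorm ((f x - g x : E) i 0) <= Renorm (f - g).
  apply: (le_trans (coord_le_Renorm (f x - g x : E) i)).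
  by rewrite Renorm_supnorm -bcfunBE; exact: supnorm_ub.
rewrite !mxE in h; split.
  by rewrite -ReB; exact: le_trans (abs_Re_le _) h.
by rewrite -ImB; exact: le_trans (abs_Im_le _) h.
Qed.

(** Pointwise limits of the coordinates are limits uniformly in the point. *)
Theorem bcfun_complete : seq_complete X.
Proof.
move=> u uc.
have [p hp] := choice (fun xi : K * 'I_N => real_cauchy_limit
  (r := fun n => complex.Re (u n xi.1 xi.2 0)) (fun e e0 =>
    let: ex_intro n hn := uc e e0 in ex_intro _ n (fun k q nk nq =>
      le_lt_trans (coord_sub_le (u k) (u q) xi.1 xi.2).1 (hn k q nk nq)))).
have [q hq] := choice (fun xi : K * 'I_N => real_cauchy_limit
  (r := fun n => complex.Im (u n xi.1 xi.2 0)) (fun e e0 =>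
    let: ex_intro n hn := uc e e0 in ex_intro _ n (fun k q nk nq =>
      le_lt_trans (coord_sub_le (u k) (u q) xi.1 xi.2).2 (hn k q nk nq)))).
pose l x : E := \col_i (p (x, i) +i* q (x, i))%C.
have N0 : 0 <= 2 * N%:R :> R by rewrite mulr_ge0.
have unif (e : R) : 0 < e -> exists n : nat, forall k : nat, (n <= k)%N ->
    forall x, Renorm (l x - u k x) < e.
  move=> e0; have [d d0 Nd] := small_multiple N0 e0.
  have [n hn] := uc d d0; exists n => k nk x.
  apply: (@le_lt_trans _ _ (\sum_(i < N) (d + d))).
    apply: (le_trans (Renorm_le_coord _)); apply: ler_sum => i _.
    rewrite !mxE ReB ImB /=; apply: lerD.
      apply: (hp (x, i) d n) => // s t ns nt.
      exact: le_lt_trans (coord_sub_le (u s) (u t) x i).1 (hn s t ns nt).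
    apply: (hq (x, i) d n) => // s t ns nt.
    exact: le_lt_trans (coord_sub_le (u s) (u t) x i).2 (hn s t ns nt).
  by rewrite sumr_const card_ord -mulr_natl [ltLHS](_ : _ = 2 * N%:R * d); [|ring].
have cl : continuous l.
  move=> x; apply/cvg_RenormP => e e0; have e3 : 0 < e / 3 by rewrite divr_gt0.
  have [n /(_ n (leqnn n)) hn] := unif _ e3.
  have /cvg_RenormP/(_ _ e3) := @bcfun_cont _ _ _ (u n) x.
  apply: filterS => y uxy.
  have := Renorm_sub_le (l x) (u n x) (l y).
  have := Renorm_sub_le (u n x) (u n y) (l y).
  rewrite (RenormB (u n y) (l y)); have := hn x; have := hn y; lra.
exists (cont_bcfun cK cl) => e e0; have e2 : 0 < e / 2 by rewrite divr_gt0.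
have [n hn] := unif _ e2; exists n => k /hn hk.
rewrite Renorm_supnorm; apply: (@le_lt_trans _ _ (e / 2)); last lra.
by apply: supnorm_le => [|x]; [exact: ltW|exact/ltW/hk].
Qed.
End Complete.

Section Koopman.
Variables (R : realType) (G : semitopologicalSemigroupType) (K : ptopologicalType).
Variables (a : semigroup_action G K) (N : nat) (c : cocycle R N a).
Hypothesis cK : compact [set: K].
Local Notation E := (euclidean R N).
Local Notation X := (bcfun K E).
Local Notation V := (cocycle_koopman c).

Lemma koopmanE g (f : X) x : V g f x = c g x *m f (a g x). Proof. by []. Qed.

Lemma koopmanD g (f h : X) : V g (f + h) = V g f + V g h.
Proof. by apply: bcfun_eqP => x; rewrite bcfunDE !koopmanE bcfunDE mulmxDr. Qed.

Lemma koopmanZ g (z : R[i]) (f : X) : V g (z *: f) = z *: V g f.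
Proof. by apply: bcfun_eqP => x; rewrite bcfunZE !koopmanE bcfunZE -scalemxAr. Qed.

Lemma koopman_contr g (f : X) : Renorm (V g f) <= Renorm f.
Proof.
rewrite !Renorm_supnorm; apply: supnorm_le => [|x]; first exact: supnorm_ge0.
by rewrite Renorm_cocycle_koopman; exact: supnorm_ub.
Qed.

Lemma koopman_joint_cont (f : X) :
  continuous (fun p : K * G => V p.2 f p.1 : E).
Proof.
apply: euclidean_continuous => i.
rewrite (_ : (fun p => _) = fun p : K * G => \sum_(j < N)
    c p.2 p.1 i j * (f (a p.2 p.1) : 'cV[R[i]]_N) j 0); last first.
  by apply/funext => p; rewrite koopmanE mxE.
move=> p; apply: cvg_bigsum => j.
have swap : continuous (fun p : K * G => (p.2, p.1)).
  by move=> r; apply: cvg_pair; [exact: cvg_snd|exact: cvg_fst].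
apply: cvgM.
  apply: (@continuous_comp _ _ _ (fun p : K * G => c p.2 p.1)
    (fun U : 'M[R[i]]_N => U i j)); last exact: coord_continuous.
  apply: (@continuous_comp _ _ _ (fun p : K * G => (p.2, p.1))
    (fun p : G * K => c p.1 p.2)); [exact: swap|exact: cocycle_cont].
apply: (@continuous_comp _ _ _ (fun p : K * G => a p.2 p.1)
  (fun x => (f x : 'cV[R[i]]_N) j 0)).
  apply: (@continuous_comp _ _ _ (fun p : K * G => (p.2, p.1))
    (fun p : G * K => a p.1 p.2)); [exact: swap|exact: act_cont].
by apply: coord_cont; exact: bcfun_cont.
Qed.

(** Joint continuity on [K * G] is uniform in the compact variable. *)
Lemma koopman_strongly_continuous (f : X) : continuous (fun g => V g f).
Proof.
move=> g0; apply/cvg_RenormP => e e0; have e2 : 0 < e / 2 by rewrite divr_gt0.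
have e4 : 0 < e / 4 by rewrite divr_gt0.
have e44 : e / 4 + e / 4 = e / 2 by lra.
have e2e : e / 2 < e by lra.
have : \forall g \near g0, [set: K] `<=`
    (fun x => Renorm (V g0 f x - V g f x) < e / 2).
  move: cK => /compact_near_coveringP; apply.
  move=> x _.
  have /cvg_RenormP/(_ _ e4) h1 := @koopman_joint_cont f (x, g0).
  have /cvg_RenormP/(_ _ e4) h2 := @bcfun_cont _ _ _ (V g0 f) x.
  have h2' : \forall y \near x & g \near g0, Renorm (V g0 f x - V g0 f y) < e / 4.
    by exists ([set y | Renorm (V g0 f x - V g0 f y) < e / 4], setT);
      [split=> //; exact: filterT|case=> y g [/= ? _]].
  apply: filterS2 h1 h2' => -[y g] /= u v.
  apply: (le_lt_trans (Renorm_sub_le (V g0 f y) (V g0 f x) (V g f y))).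
  by rewrite -e44; apply: ltrD; [rewrite RenormB; exact: v|exact: u].
apply: filterS => g hg; rewrite Renorm_supnorm.
apply: le_lt_trans e2e.
by apply: supnorm_le => [|x]; [exact: ltW|exact/ltW/(hg x)].
Qed.
End Koopman.


Section MeanErgodicL2.
Variables (R : realType) (G : semitopologicalSemigroupType) (K : ptopologicalType).
Variables (a : semigroup_action G K) (mu : probability (borel K) R).
Variables (N : nat) (c : cocycle R N a).
Hypotheses (hK : hausdorff_space K) (cK : compact [set: K]).
Hypothesis ue : uniquely_ergodic a mu.
Local Notation E := (euclidean R N).
Local Notation X := (bcfun K E).
Local Notation V := (cocycle_koopman c).
Local Notation V2 := (cocycle_koopman2 c).

Let rmu : regular_measure mu. Proof. by have [] := ue. Qed.

Let VD := koopmanD c.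
Let VZ := koopmanZ c.
Let Vcontr := koopman_contr c.

(** The coordinate [i] of [P f] at [x] is a functional of [f] that is fixed
    since [P \o V g = P], and it has norm at most 1. *)
Lemma coord_functional_bound (P : X -> X) : mean_ergodic_projection V P ->
  forall (f : X) x i, Renorm ((P f x : 'cV[R[i]]_N) i 0) <= \int[mu]_y Renorm (f y).
Proof.
move=> [hP Pzero] f x i.
pose nu (h : X) : R[i] := (P h x : 'cV[R[i]]_N) i 0.
have nun h : Renorm (nu h) <= 1 * Renorm h.
  rewrite mul1r; apply: le_trans (hull_contr Vcontr h hP).
  apply: (le_trans (coord_le_Renorm (P h x) i)).
  by rewrite [leRHS]Renorm_supnorm; exact: supnorm_ub.
have nuB h k : nu h - nu k = nu (h - k).
  rewrite /nu (hull_sub h k hP) -[(P h - P k) x]/(P h x - P k x).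
  by rewrite !mxE.
have dnu : dual nu.
  split=> [z h k|h].
    rewrite /nu (hull_add _ _ hP) (hull_scale _ _ hP).
    by rewrite -[(z *: P h + P k) x]/(z *: P h x + P k x) !mxE.
  apply/(@cvg_RenormP R R[i] X (nbhs h) _ nu (nu h)) => e e0; apply/nbhs_RenormP.
  exists e => // k hk; rewrite nuB; apply: (le_lt_trans (nun _)).
  by rewrite mul1r.
have fnu : Fix_dual V nu.
  split=> // g; apply/funext => h; rewrite /nu /=.
  have [PV _] := Pzero _ (cc_hull VD VZ Vcontr (cc_V V g)).
  by rewrite -[in RHS](congr1 (@^~ h) PV).
by have := fixed_functional_L1_bound hK cK ue fnu ler01 nun f; rewrite mul1r.
Qed.

Lemma projection_L1_bound (P : X -> X) (f : X) : mean_ergodic_projection V P ->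
  Renorm (P f) <= N%:R * \int[mu]_y Renorm (f y).
Proof.
move=> mP; have I0 : 0 <= \int[mu]_y Renorm (f y).
  by apply: Rintegral_ge0 => x _; exact: Renorm_ge0.
rewrite [leLHS]Renorm_supnorm; apply: supnorm_le => [|x]; first by rewrite mulr_ge0.
apply: (le_trans (l2norm_le_sum _)).
apply: (@le_trans _ _ (\sum_(i < N) \int[mu]_y Renorm (f y))).
  by apply: ler_sum => i _; exact: coord_functional_bound.
by rewrite sumr_const card_ord mulr_natl.
Qed.

Lemma ivec_L2 (f : K -> E) : L2 mu f -> ivec mu f.
Proof.
move=> [f1 f2 f3]; have mf : mvec f by [].
split=> //; have i2 : intg mu (fun x => Renorm (f x) ^+ 2).
  apply/integrableP; split.
    apply/measurable_EFinP.
    rewrite (_ : (fun x => _) = fun x => rdot (f x) (f x)); first exact: mvec_rdot.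
    by apply/funext => x; rewrite rdot_sqr.
  apply: le_lt_trans f3; rewrite le_eqVlt; apply/orP; left; apply/eqP.
  by apply: eq_integral => x _ /=; rewrite ger0_norm // sqr_ge0.
have i1 : intg mu (fun=> 1 : R) by apply: (cont_integrable cK); exact: cst_cont.
apply: (intg_le _ _ (intg_add i2 i1)); first exact: mvec_Renorm.
move=> x; rewrite ger0_norm ?Renorm_ge0 //.
have := sqr_ge0 (Renorm (f x) - 1); have := Renorm_ge0 (f x).
rewrite sqrrB; nra.
Qed.

(** [V2 g] fixes [f] and preserves distances in mean, so [phi] and [V g phi] are
    equally far from [f]; convexity and uniform approximation do the rest. *)
Lemma hull_L1_dist (T : X -> X) (f : K -> E) (phi : X) :
  closed_convex_hull V T -> Fix2 mu c f ->
  \int[mu]_x Renorm (f x - T phi x) <= \int[mu]_x Renorm (f x - phi x).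
Proof.
move=> hT [L2f fixf]; have fi := ivec_L2 L2f.
have iX (h : X) : ivec mu h by apply: (ivec_cont mu cK); exact: bcfun_cont.
have iD (h : X) : ivec mu (fun x => f x - h x) := ivec_sub fi (iX h).
have VL g : \int[mu]_x Renorm (f x - V g phi x) = \int[mu]_x Renorm (f x - phi x).
  rewrite -(koopman2_isometry c ue g (iD phi)); congr fine.
  apply: ae_eq_integral => //.
  - by apply/measurable_EFinP; apply: mvec_Renorm; case: (iD (V g phi)).
  - apply/measurable_EFinP; apply: mvec_Renorm.
    by have [] := ivec_koopman2 c ue g (iD phi).
  - by apply: ae_imp (fixf g) => x fx _; rewrite koopman2B fx.
apply/ler_addgt0Pr => e e0.
have [S cS TS] := hull_approx phi hT e0.
have SL : \int[mu]_x Renorm (f x - S phi x) <= \int[mu]_x Renorm (f x - phi x).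
  have [n [t [g [t0 t1 SE]]]] := cS.
  have SEx x : f x - S phi x = \sum_k (t k)%:C *: (f x - V (g k) phi x).
    under eq_bigr do rewrite scalerBr.
    rewrite sumrB -scaler_suml -rmorph_sum t1 scale1r SE.
    by rewrite bcfun_sumE.
  apply: (@le_trans _ _ (\int[mu]_x (\sum_k t k * Renorm (f x - V (g k) phi x)))).
    apply: Rintegral_le; first by case: (iD (S phi)).
      by apply: intg_sum => k; apply: intg_scale; case: (iD (V (g k) phi)).
    move=> x; rewrite SEx; apply: (le_trans (Renorm_sum _)).
    by apply: ler_sum => k _; rewrite Renorm_scale.
  rewrite Rintegral_sum; last first.
    by move=> k; apply: intg_scale; case: (iD (V (g k) phi)).
  rewrite -[leRHS]mul1r -t1 mulr_suml; apply: ler_sum => k _.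
  rewrite RintegralZl //; first by rewrite VL.
  by case: (iD (V (g k) phi)).
have ie : intg mu (fun=> e) by apply: (cont_integrable cK); exact: cst_cont.
apply: (@le_trans _ _ (\int[mu]_x (Renorm (f x - S phi x) + e))).
  apply: Rintegral_le; first by case: (iD (T phi)).
    by apply: intg_add => //; case: (iD (S phi)).
  move=> x; apply: (le_trans (Renorm_sub_le _ (S phi x) _)); rewrite lerD2l.
  rewrite RenormB; apply: le_trans (ltW TS).
  by rewrite [leRHS]Renorm_supnorm -bcfunBE; exact: supnorm_ub.
rewrite RintegralD //; last by case: (iD (S phi)).
by rewrite Rintegral_cst //= (probability_setT mu) mulr1 lerD2r.
Qed.

(** The projection is bounded from the mean to the uniform norm, so it maps
    continuous functions that approximate [f] in mean to a uniform Cauchy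
    sequence of fixed functions, which still approximates [f] in mean. *)
Theorem Fix2_sub_of_mean_ergodic : mean_ergodic V ->
  forall f : K -> E, Fix2 mu c f ->
    exists2 h : X, Fix V h & {ae mu, forall x, f x = h x}.
Proof.
move=> [P mP] f Ff; have [hP _] := mP; have fi := ivec_L2 Ff.1.
have FP h : Fix V (P h) := projection_fixed VD VZ Vcontr h mP.
have [phi hphi] := choice (fun n : nat => cont_dense_vec hK cK rmu fi
  (e := n.+1%:R^-1) ltac:(by rewrite invr_gt0)).
have iX (h : X) : ivec mu h by apply: (ivec_cont mu cK); exact: bcfun_cont.
have iD (h : X) : ivec mu (fun x => f x - h x) := ivec_sub fi (iX h).
have small (e : R) : 0 < e -> exists n : nat, forall p : nat, (n <= p)%N ->
    \int[mu]_x Renorm (f x - phi p x) <= e.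
  by move=> /harmonic_small[n hn]; exists n => p /hn/ltW; exact: le_trans.
have N0 : 0 <= 2 * N%:R :> R by rewrite mulr_ge0.
have cauchy (e : R) : 0 < e -> exists n : nat, forall p q : nat,
    (n <= p)%N -> (n <= q)%N -> Renorm (P (phi p) - P (phi q)) < e.
  move=> e0; have [d d0 Nd] := small_multiple N0 e0.
  have [n hn] := small d d0; exists n => p q np nq.
  rewrite -(hull_sub _ _ hP); apply: (le_lt_trans (projection_L1_bound _ mP)).
  have le2 : \int[mu]_x Renorm ((phi p - phi q) x) <= d + d.
    apply: (@le_trans _ _ (\int[mu]_x (Renorm (f x - phi p x) +
      Renorm (f x - phi q x)))).
      apply: Rintegral_le; first by case: (iX (phi p - phi q)).
        by apply: intg_add; [case: (iD (phi p))|case: (iD (phi q))].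
      move=> x; rewrite bcfunBE (le_trans (Renorm_sub_le _ (f x) _)) //.
      by rewrite RenormB.
    rewrite RintegralD //; [|by case: (iD (phi p))|by case: (iD (phi q))].
    by apply: lerD; exact: hn.
  apply: (le_lt_trans (ler_wpM2l (ler0n _ N) le2)).
  by rewrite [ltLHS](_ : _ = 2 * N%:R * d); [|ring].
have [h hh] := bcfun_complete cK cauchy.
have Fh : Fix V h.
  apply: (Fix_closed VD VZ Vcontr) => e e0; have [n hn] := hh e e0.
  by exists (P (phi n)); [exact: FP|exact: hn].
exists h => //.
have z0 : \int[mu]_x Renorm (f x - h x) = 0.
  apply/eqP; rewrite eq_le; apply/andP; split; last first.
    by apply: Rintegral_ge0 => x _; exact: Renorm_ge0.
  apply/ler_addgt0Pr => e e0; rewrite add0r.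
  have e2 : 0 < e / 2 by rewrite divr_gt0.
  have ee : e / 2 + e / 2 = e by lra.
  have [n hn] := hh _ e2; have [m hm] := small _ e2.
  pose p := maxn n m.
  have ie : intg mu (fun=> e / 2) by apply: (cont_integrable cK); exact: cst_cont.
  apply: (@le_trans _ _ (\int[mu]_x (Renorm (f x - P (phi p) x) + e / 2))).
    apply: Rintegral_le; first by case: (iD h).
      by apply: intg_add => //; case: (iD (P (phi p))).
    move=> x; apply: (le_trans (Renorm_sub_le _ (P (phi p) x) _)); rewrite lerD2l.
    rewrite RenormB; apply: le_trans (ltW (hn p (leq_maxl _ _))).
    by rewrite [leRHS]Renorm_supnorm -bcfunBE; exact: supnorm_ub.
  rewrite RintegralD //; last by case: (iD (P (phi p))).
  rewrite Rintegral_cst //= (probability_setT mu) mulr1 -[leRHS]ee lerD2r.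
  apply: le_trans (hm p (leq_maxr _ _)); exact: hull_L1_dist.
have fh0 x : 0 <= Renorm (f x - h x) by exact: Renorm_ge0.
apply: ae_imp (intg_eq0_ae (iD h).2 fh0 z0) => x /Renorm_eq0/eqP.
by rewrite subr_eq0 => /eqP.
Qed.
End MeanErgodicL2.


(** * The equivalences *)

Section Equivalences.
Variables (R : realType) (X : normedModType R[i]).
Variables (G : semitopologicalSemigroupType) (V : G -> X -> X).
Hypothesis VD : forall g f h, V g (f + h) = V g f + V g h.
Hypothesis VZ : forall g (z : R[i]) f, V g (z *: f) = z *: V g f.
Hypothesis Vcontr : forall g f, Renorm (V g f) <= Renorm f.
Hypothesis Xcomplete : seq_complete X.

Lemma weak_of_norm (I : directedSet) (A : I -> X -> X) :
  norm_convergent A -> weakly_convergent A.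
Proof. by move=> h f; have [l Al] := h f; exists l; exact: norm_limit_weak. Qed.

Lemma weak_to_fixed_of_norm (I : directedSet) (A : I -> X -> X) :
  norm_convergent_to_fixed V A -> weakly_convergent_to_fixed V A.
Proof. by move=> h f; have [l Fl Al] := h f; exists l => //; exact: norm_limit_weak. Qed.

Lemma norm_of_norm_to_fixed (I : directedSet) (A : I -> X -> X) :
  norm_convergent_to_fixed V A -> norm_convergent A.
Proof. by move=> h f; have [l _ Al] := h f; exists l. Qed.

Lemma weak_of_weak_to_fixed (I : directedSet) (A : I -> X -> X) :
  weakly_convergent_to_fixed V A -> weakly_convergent A.
Proof. by move=> h f; have [l _ Al] := h f; exists l. Qed.

Lemma norm_to_fixed_of_separates (I : directedSet) (A : I -> X -> X) :
  right_ergodic_net V A -> separates (Fix V) (Fix_dual V) ->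
  norm_convergent_to_fixed V A.
Proof.
move=> rA sep; have dec := decomposition_of_separates VD VZ Vcontr rA Xcomplete sep.
have [P [mP [_ _ rP _] lim]] := ergodic_projection VZ Vcontr rA dec.
by move=> f; exists (P f); [rewrite -rP; exists f|exact: lim].
Qed.

Lemma mean_ergodic_of_separates (I : directedSet) (A : I -> X -> X) :
  right_ergodic_net V A -> separates (Fix V) (Fix_dual V) -> mean_ergodic V.
Proof.
move=> rA sep; have dec := decomposition_of_separates VD VZ Vcontr rA Xcomplete sep.
by have [P [mP _ _]] := ergodic_projection VZ Vcontr rA dec; exists P.
Qed.

Lemma separates_of_decomposition (I : directedSet) (A : I -> X -> X) :
  right_ergodic_net V A -> direct_sum_decomposition (Fix V) (clin_range_IV V) ->
  separates (Fix V) (Fix_dual V).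
Proof.
move=> rA dec; have [P [mP _ _]] := ergodic_projection VZ Vcontr rA dec.
by apply: (separates_of_mean_ergodic VD VZ Vcontr); exists P.
Qed.

(** Weak limits are unique, so the limit is the projection that every right
    ergodic net converges to in norm. *)
Lemma limit_of_right_net (I : directedSet) (A : I -> X -> X) (P : X -> X) :
  mean_ergodic V -> right_ergodic_net V A ->
  (forall f, norm_limit (A^~ f) (P f)) \/ (forall f, weak_limit (A^~ f) (P f)) ->
  mean_ergodic_projection V P /\ projection_along P (Fix V) (clin_range_IV V).
Proof.
move=> me rA AP; have sep := separates_of_mean_ergodic VD VZ Vcontr me.
have dec := decomposition_of_separates VD VZ Vcontr rA Xcomplete sep.
have [Q [mQ pQ lim]] := ergodic_projection VZ Vcontr rA dec.
suff -> : P = Q by [].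
apply/funext => f; apply: (weak_limit_unique (u := A^~ f)).
  by case: AP => // AP; exact: norm_limit_weak.
by apply: norm_limit_weak; exact: lim.
Qed.

Lemma weak_to_fixed_of_ergodic (I : directedSet) (A : I -> X -> X) :
  ergodic_net V A -> weakly_convergent A -> weakly_convergent_to_fixed V A.
Proof.
move=> eA h f; have [l Al] := h f; exists l => //.
exact: (weak_limit_fixed VD VZ Vcontr eA Al).
Qed.
End Equivalences.

Section KoopmanNets.
Variables (R : realType) (G : semitopologicalSemigroupType) (K : ptopologicalType).
Variables (a : semigroup_action G K) (N : nat) (c : cocycle R N a).
Hypothesis cK : compact [set: K].
Local Notation V := (cocycle_koopman c).

(** The Koopman representation reverses products, so it is right invariance on
    the opposite semigroup that makes averages of [V g] right ergodic. *)
Lemma koopman_right_net : right_amenable R (opposite G) ->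
  exists (I : directedSet) (A : I -> _ -> _), @right_ergodic_net R _ G V I A.
Proof.
move=> [m [[dm m1 nm] inv]].
apply: (right_net_exists (koopmanD c) (koopmanZ c) (koopman_contr c)
  (cocycle_koopmanM c) (T := opposite G) (tau := fun x => x) (m := m)
  (one := bcone R (opposite G))) => //.
- by move=> f; exact: (@koopman_strongly_continuous _ _ _ _ _ c cK f).
- move=> g phi psi h; rewrite -(inv g phi); congr m; apply/val_inj/funext => x.
  exact: h.
Qed.

Lemma koopman_net : amenable R G ->
  exists (I : directedSet) (A : I -> _ -> _), @ergodic_net R _ G V I A.
Proof.
move=> [m [[dm m1 nm] inv]].
apply: (net_exists (koopmanD c) (koopmanZ c) (koopman_contr c)
  (cocycle_koopmanM c) (T := G) (tau := fun x => x) (m := m)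
  (one := bcone R G)) => //.
- by move=> f; exact: (@koopman_strongly_continuous _ _ _ _ _ c cK f).
- move=> g phi psi h; rewrite -(inv g phi).2; congr m; apply/val_inj/funext => x.
  exact: h.
- move=> g phi psi h; rewrite -(inv g phi).1; congr m; apply/val_inj/funext => x.
  exact: h.
Qed.
End KoopmanNets.

Theorem theorem2p8 (R : realType) (G : semitopologicalSemigroupType)
    (K : ptopologicalType) (a : semigroup_action G K)
    (mu : probability (borel K) R) (N : nat) (c : cocycle R N a) :
  hausdorff_space K -> compact [set: K] -> uniquely_ergodic a mu ->
  let V := cocycle_koopman c in
  let Fix2_sub_Fix := forall f : K -> euclidean R N, Fix2 mu c f ->
    exists2 h : bcfun K (euclidean R N), Fix V h & {ae mu, forall x, f x = h x} in
  let limit_is_projection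
      (Net : forall I : directedSet, (I -> _ -> _) -> Prop) :=
    every_net Net (fun I A => forall P,
      (forall f, norm_limit (A^~ f) (P f)) \/
      (forall f, weak_limit (A^~ f) (P f)) ->
      mean_ergodic_projection V P /\
      projection_along P (Fix V) (clin_range_IV V)) in
  (right_amenable R (opposite G) \/
     right_amenable R G /\ some_net (@right_ergodic_net R _ G V) (fun _ _ => True) ->
   let Net := @right_ergodic_net R _ G V in
   [<-> Fix2_sub_Fix;
        mean_ergodic V;
        separates (Fix V) (Fix_dual V);
        direct_sum_decomposition (Fix V) (clin_range_IV V);
        some_net Net (@weakly_convergent_to_fixed R _ G V);
        every_net Net (@weakly_convergent_to_fixed R _ G V);
        every_net Net (@weakly_convergent R _);
        some_net Net (@norm_convergent_to_fixed R _ G V);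
        every_net Net (@norm_convergent_to_fixed R _ G V);
        every_net Net (@norm_convergent R _)] /\
   (mean_ergodic V -> limit_is_projection Net)) /\
  (amenable R G ->
   let Net := @ergodic_net R _ G V in
   [<-> Fix2_sub_Fix;
        mean_ergodic V;
        separates (Fix V) (Fix_dual V);
        direct_sum_decomposition (Fix V) (clin_range_IV V);
        some_net Net (@weakly_convergent R _);
        some_net Net (@weakly_convergent_to_fixed R _ G V);
        every_net Net (@weakly_convergent R _);
        every_net Net (@weakly_convergent_to_fixed R _ G V);
        some_net Net (@norm_convergent R _);
        some_net Net (@norm_convergent_to_fixed R _ G V);
        every_net Net (@norm_convergent R _);
        every_net Net (@norm_convergent_to_fixed R _ G V)] /\
   (mean_ergodic V -> limit_is_projection Net)).
Proof.
move=> hK cK ue V Fix2_sub_Fix limit_is_projection.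
have VD := koopmanD c; have VZ := koopmanZ c; have Vcontr := koopman_contr c.
have VM := cocycle_koopmanM c; have Xc := @bcfun_complete R K N cK.
have sepF2 : Fix2_sub_Fix -> separates (Fix V) (Fix_dual V).
  exact: (fix_separates_of_Fix2 hK cK ue).
have F2ofme : mean_ergodic V -> Fix2_sub_Fix.
  exact: (Fix2_sub_of_mean_ergodic hK cK ue).
have sepme := separates_of_mean_ergodic VD VZ Vcontr.
have lim_proj (Net : forall I : directedSet, (I -> _ -> _) -> Prop) :
    (forall I A, Net I A -> @right_ergodic_net R _ G V I A) ->
    mean_ergodic V -> limit_is_projection Net.
  move=> sub me I A /sub rA P; exact: (limit_of_right_net VD VZ Vcontr Xc me rA).
split=> [amen Net|amen Net].
- have [I0 [A0 r0]] : exists (I : directedSet) (A : I -> _ -> _),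
      @right_ergodic_net R _ G V I A.
    case: amen => [|[_ [I [A [rA _]]]]]; first exact: koopman_right_net.
    by exists I, A.
  have weak_sep : every_net Net (@weakly_convergent R _) ->
      separates (Fix V) (Fix_dual V).
    move=> /(every_weak_to_fixed VD VZ Vcontr VM) /(_ _ _ r0).
    exact: (separates_of_weak_to_fixed r0).
  have normfix (sep : separates (Fix V) (Fix_dual V)) :
      every_net Net (@norm_convergent_to_fixed R _ G V).
    by move=> I A rA; exact: (norm_to_fixed_of_separates VD VZ Vcontr Xc rA).
  split; last exact: lim_proj.
  tfae.
  + by move/sepF2; exact: (mean_ergodic_of_separates VD VZ Vcontr Xc r0).
  + exact: sepme.
  + exact: (decomposition_of_separates VD VZ Vcontr r0 Xc).
  + move=> /(separates_of_decomposition VD VZ Vcontr r0) /normfix h.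
    by exists I0, A0; split=> //; exact: weak_to_fixed_of_norm (h _ _ r0).
  + move=> [I [A [rA /(separates_of_weak_to_fixed rA)/normfix h]]].
    by move=> J B rB; exact: weak_to_fixed_of_norm (h _ _ rB).
  + by move=> h I A /h; exact: weak_of_weak_to_fixed.
  + by move=> /weak_sep/normfix h; exists I0, A0; split=> //; exact: h.
  + move=> [I [A [rA /weak_to_fixed_of_norm]]].
    by move=> /(separates_of_weak_to_fixed rA)/normfix.
  + by move=> h I A /h; exact: norm_of_norm_to_fixed.
  + move=> h; apply: F2ofme; apply: (mean_ergodic_of_separates VD VZ Vcontr Xc r0).
    by apply: weak_sep => I A /h; exact: weak_of_norm.
- have [I0 [A0 e0]] := koopman_net c cK amen; have r0 := e0.1.
  have sep_some : some_net Net (@weakly_convergent R _) ->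
      separates (Fix V) (Fix_dual V).
    move=> [I [A [eA /(weak_to_fixed_of_ergodic VD VZ Vcontr eA)]]].
    exact: (separates_of_weak_to_fixed eA.1).
  have normfix (sep : separates (Fix V) (Fix_dual V)) :
      every_net Net (@norm_convergent_to_fixed R _ G V).
    by move=> I A eA; exact: (norm_to_fixed_of_separates VD VZ Vcontr Xc eA.1).
  split; last by apply: lim_proj => I A [].
  tfae.
  + by move/sepF2; exact: (mean_ergodic_of_separates VD VZ Vcontr Xc r0).
  + exact: sepme.
  + exact: (decomposition_of_separates VD VZ Vcontr r0 Xc).
  + move=> /(separates_of_decomposition VD VZ Vcontr r0) /normfix h.
    exists I0, A0; split=> //.
    exact/weak_of_weak_to_fixed/weak_to_fixed_of_norm/(h _ _ e0).
  + move=> [I [A [eA h]]]; exists I, A; split=> //.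
    exact: (weak_to_fixed_of_ergodic VD VZ Vcontr eA).
  + move=> [I [A [eA /(separates_of_weak_to_fixed eA.1)/normfix h]]].
    move=> J B eB.
    exact/weak_of_weak_to_fixed/weak_to_fixed_of_norm/(h _ _ eB).
  + by move=> h I A eA; exact: (weak_to_fixed_of_ergodic VD VZ Vcontr eA (h _ _ eA)).
  + move=> h; exists I0, A0; split=> //; apply: norm_of_norm_to_fixed.
    apply: normfix => //.
    exact: (separates_of_weak_to_fixed r0 (h _ _ e0)).
  + move=> [I [A [eA h]]]; exists I, A; split=> //; apply: normfix => //.
    by apply: sep_some; exists I, A; split=> //; exact: weak_of_norm.
  + move=> [I [A [eA h]]] J B eB; apply: norm_of_norm_to_fixed.
    apply: normfix => //; apply: sep_some; exists I, A; split=> //.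
    by apply: weak_of_norm; exact: norm_of_norm_to_fixed.
  + move=> h; apply: normfix; apply: sep_some; exists I0, A0; split=> //.
    by apply: weak_of_norm; exact: h.
  + move=> h; apply: F2ofme; apply: (mean_ergodic_of_separates VD VZ Vcontr Xc r0).
    apply: sep_some; exists I0, A0; split=> //.
    by apply: weak_of_norm; apply: norm_of_norm_to_fixed; exact: h.
Qed.
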